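(* Run Algorithm 2 (described in the context) with the parameters listed in the context. Then there is a constant $C>0$, independent of $\varepsilon$, such that for every $\varepsilon\in(0,1]$ and every integer $T\ge C\varepsilon^{-4}$, with $t^*$ selected uniformly at random from $\{1,\dots,T\}$ (independently of the run), $$\mathbb{E}\|\nabla\Psi(z_{t^*})\|\le\varepsilon .$$ In particular (taking $T=\lceil C\varepsilon^{-4}\rceil$, each iteration using a constant number of samples) the stochastic oracle complexity is $O(\varepsilon^{-4})$.
   Context: Problem: minimize $f(x)=\mathbb{E}_{\xi\sim\Xi}[f(x,\xi)]$ over $x\in X$ subject to $\mathbb{E}_{\zeta\sim P}[A_\zeta x-b_\zeta]=0$. Write $A=\mathbb{E}_\zeta[A_\zeta]\in\mathbb{R}^{m\times n}$, $b=\mathbb{E}_\zeta[b_\zeta]\in\mathbb{R}^m$; only samples $A_\zeta,b_\zeta$ (with finite second moments) are available. $X=\{x\in\mathbb{R}^n:Hx\le h\}$ is polyhedral (one can project onto it). Assumptions: (i) $f:\mathbb{R}^n\to\mathbb{R}$ is $L_f$-smooth ($\nabla f$ is $L_f$-Lipschitz), $f(x)\ge\underline f>-\infty$ whenever $x\in X$, $Ax=b$; stochastic gradients satisfy $\mathbb{E}_\xi[\nabla f(x,\xi)]=\nabla f(x)$ and $\mathbb{E}_\xi\|\nabla f(x,\xi)-\nabla f(x)\|^2\le\sigma^2$. (ii) $X$ is compact (so the feasible set $\{x\in X: Ax=b\}$ is bounded); the origin is in the relative interior of $\{Ax-b:x\in X\}$; $A$ has full row rank. Notation: $\|A\|$ is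 the operator norm. For $\rho\ge0$: $L_\rho(x,y)=f(x)+\langle Ax-b,y\rangle+\frac\rho2\|Ax-b\|^2$; $K(x,y,z)=L_\rho(x,y)+\frac\mu2\|x-z\|^2$; $d(y,z)=\min_{x\in X}K(x,y,z)$; $x^*(y,z)=\mathrm{argmin}_{x\in X}K(x,y,z)$; $\Psi(z)=\min_{x\in X,Ax=b}\{f(x)+\frac\mu2\|x-z\|^2\}$ with minimizer $\bar x^*(z)$. Known global error bound: for $\mu>L_f$ there is a finite $\bar\sigma>0$, depending only on $L_f+\rho\|A\|^2+\mu$, $\mu-L_f$, $A$ and $H$, with $\|x^*(y,z)-\bar x^*(z)\|\le\bar\sigma\|Ax^*(y,z)-b\|$ for all $y,z$. Constants: $M_V=\max_{x,z\in X}\{K(x,0,z)-2d(0,z)+2\Psi(z)\}$; $M=\max_{x,z\in X}\{|f(x)|+\frac\mu2\|x-z\|^2+\frac\rho2\|Ax-b\|^2\}$; $M_\Psi$ is a uniform lower bound of $\Psi$ (e.g. $\underline f$); $r>0$ is such that for every nonzero direction $\mathbf d\in\mathrm{Range}(A)$ there is $x\in X$ with $\|Ax-b\|=r$ and $Ax-b$ in the direction of $\mathbf d$ (such $r$ exists by the assumptions); $M_y$ is a fixed number with $M_y>\frac{M_V-M_\Psi+2M}{r}$. Algorithm 2: choose $x_0=z_0\in X$, $y_0\in\mathbb{R}^m$, $\rho\ge0$. For $t=0,\dots,T-1$: draw $\zeta_t\sim P$ and set $y_{t+1}=y_t+\eta(A_{\zeta_t}x_t-b_{\zeta_t})$; if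 $\|y_{t+1}\|\ge M_y$, reset $y_{t+1}=0$; draw $\xi_t\sim\Xi$, $\zeta^1_t,\zeta^2_t\sim P$ and form $G_t=\nabla f(x_t,\xi_t)+A_{\zeta_t^1}^\top y_{t+1}+\rho A_{\zeta_t^1}^\top(A_{\zeta_t^2}x_t-b_{\zeta_t^2})+\mu(x_t-z_t)$, so that its conditional mean is $\nabla_xK(x_t,y_{t+1},z_t)$; $x_{t+1}=\mathrm{proj}_X(x_t-\tau G_t)$; $z_{t+1}=z_t+\beta(x_t-z_t)$. All samples are independent. Parameters: $\mu=\max\{2,4L_f\}$, $\lambda=L_K=L_f+\rho\|A\|^2+\mu$, $\tau=\frac{1}{6\lambda^2\sqrt T}$, $\eta=\min\left\{\frac{2\mu+\rho\|A\|}{4\|A\|^4},\frac{\tau}{200\|A\|^2},\frac{\tau(2\mu+\rho\|A\|^2)}{20\|A\|^2}\right\}$, $\beta=\min\left\{\frac{\tau}{100},\frac{1}{50\lambda},\frac{\eta}{36\mu\bar\sigma^2}\right\}$. *)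

(* Defs.v *)
From HB Require Import structures.
From mathcomp Require Export all_boot all_order all_algebra.
From mathcomp Require Export all_classical all_reals all_analysis.
Export Order.TTheory GRing.Theory Num.Theory.
Export numFieldNormedType.Exports.

Set Implicit Arguments.
Unset Strict Implicit.
Unset Printing Implicit Defensive.

Local Open Scope classical_set_scope.
Local Open Scope ring_scope.

Section Euclidean.
Variable R : realType.

Definition dotp n (u v : 'cV[R]_n) : R := \sum_(i < n) u i 0 * v i 0.

(* MathComp-Analysis equips matrices with the sup norm, which induces the same
   topology and derivatives; all metric statements below use this norm. *)
Definition enorm n (u : 'cV[R]_n) : R := Num.sqrt (dotp u u).

Definition opnorm m n (A : 'M[R]_(m, n)) : R :=
  sup [set enorm (A *m u) | u in [set u : 'cV[R]_n | enorm u <= 1]].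

Definition grad n (g : 'cV[R]_n -> R) (x : 'cV[R]_n) : 'cV[R]_n :=
  \col_i 'D_(delta_mx i 0) g x.

Definition smooth n (L : R) (g : 'cV[R]_n -> R) : Prop :=
  (forall x, differentiable g x) /\
  (forall x x', enorm (grad g x - grad g x') <= L * enorm (x - x')).

Definition polyhedron p n (H : 'M[R]_(p, n)) (h : 'cV[R]_p) : set 'cV[R]_n :=
  [set x | forall i, (H *m x) i 0 <= h i 0].

Definition affine_hull n (S : set 'cV[R]_n) : set 'cV[R]_n :=
  [set v | exists k (p : 'I_k -> 'cV[R]_n) (c : 'I_k -> R),
    [/\ forall i, S (p i), \sum_i c i = 1 & v = \sum_i c i *: p i]].

Definition relint n (S : set 'cV[R]_n) : set 'cV[R]_n :=
  [set v | S v /\ exists2 e : R, 0 < e &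
    forall u, affine_hull S u -> enorm (u - v) < e -> S u].

(* If there are several minimizers, an arbitrary one is chosen; if there is
   none, the value is arbitrary. *)
Definition argmin n (D : set 'cV[R]_n) (g : 'cV[R]_n -> R) : 'cV[R]_n :=
  get [set x | D x /\ forall u, D u -> g x <= g u].

Definition proj n (D : set 'cV[R]_n) (v : 'cV[R]_n) : 'cV[R]_n :=
  argmin D (fun u => enorm (v - u)).

End Euclidean.

Section Lagrangian.
Variables (R : realType) (m n : nat).
Variables (f : 'cV[R]_n -> R) (A : 'M[R]_(m, n)) (b : 'cV[R]_m).
Variables (X : set 'cV[R]_n) (rho mu : R).

Definition Lrho (x : 'cV[R]_n) (y : 'cV[R]_m) : R :=
  f x + dotp (A *m x - b) y + rho / 2 * enorm (A *m x - b) ^+ 2.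

Definition Kfun (x : 'cV[R]_n) (y : 'cV[R]_m) (z : 'cV[R]_n) : R :=
  Lrho x y + mu / 2 * enorm (x - z) ^+ 2.

Definition dfun (y : 'cV[R]_m) (z : 'cV[R]_n) : R :=
  inf [set Kfun x y z | x in X].

Definition xstar (y : 'cV[R]_m) (z : 'cV[R]_n) : 'cV[R]_n :=
  argmin X (fun x => Kfun x y z).

Definition feasible : set 'cV[R]_n := [set x | X x /\ A *m x = b].

Definition Psi (z : 'cV[R]_n) : R :=
  inf [set f x + mu / 2 * enorm (x - z) ^+ 2 | x in feasible].

Definition xbar (z : 'cV[R]_n) : 'cV[R]_n :=
  argmin feasible (fun x => f x + mu / 2 * enorm (x - z) ^+ 2).

Definition error_bound (sbar : R) : Prop := forall y z,
  enorm (xstar y z - xbar z) <= sbar * enorm (A *m xstar y z - b).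

Definition MVconst : R :=
  sup [set Kfun p.1 0 p.2 - 2 * dfun 0 p.2 + 2 * Psi p.2 | p in X `*` X].

Definition Mconst : R :=
  sup [set `|f p.1| + mu / 2 * enorm (p.1 - p.2) ^+ 2
           + rho / 2 * enorm (A *m p.1 - b) ^+ 2 | p in X `*` X].

Definition reach_radius (r : R) : Prop := forall v : 'cV[R]_n, A *m v != 0 ->
  exists x, [/\ X x, enorm (A *m x - b) = r
    & exists2 c : R, 0 < c & A *m x - b = c *: (A *m v)].

End Lagrangian.

Section StepSizes.
Variable R : realType.
(* [nA] stands for the operator norm of A. *)
Variables (Lf rho nA sbar : R) (T : nat).

Definition mu_par : R := Num.max 2 (4 * Lf).
Definition lambda_par : R := Lf + rho * nA ^+ 2 + mu_par.
Definition tau_par : R := 1 / (6 * lambda_par ^+ 2 * Num.sqrt T%:R).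
Definition eta_par : R :=
  Num.min ((2 * mu_par + rho * nA) / (4 * nA ^+ 4))
    (Num.min (tau_par / (200 * nA ^+ 2))
             (tau_par * (2 * mu_par + rho * nA ^+ 2) / (20 * nA ^+ 2))).
Definition beta_par : R :=
  Num.min (tau_par / 100)
    (Num.min (1 / (50 * lambda_par)) (eta_par / (36 * mu_par * sbar ^+ 2))).

End StepSizes.

Section Algorithm.
Variables (R : realType) (m n : nat) (Sz Sx : Type).
Variables (F : 'cV[R]_n -> Sx -> R).
Variables (Az : Sz -> 'M[R]_(m, n)) (bz : Sz -> 'cV[R]_m).
Variables (X : set 'cV[R]_n) (rho mu My tau eta beta : R).

Definition state : Type := ('cV[R]_n * 'cV[R]_m * 'cV[R]_n)%type.

Definition dual_step (y : 'cV[R]_m) (x : 'cV[R]_n) (zt : Sz) : 'cV[R]_m :=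
  let y' := y + eta *: (Az zt *m x - bz zt) in
  if My <= enorm y' then 0 else y'.

Definition gradK_est (x : 'cV[R]_n) (y : 'cV[R]_m) (z : 'cV[R]_n)
    (xi : Sx) (zt1 zt2 : Sz) : 'cV[R]_n :=
  grad (F ^~ xi) x + (Az zt1)^T *m y
  + rho *: ((Az zt1)^T *m (Az zt2 *m x - bz zt2)) + mu *: (x - z).

Definition step (s : state) (zt : Sz) (xi : Sx) (zt1 zt2 : Sz) : state :=
  let: (x, y, z) := s in
  let y' := dual_step y x zt in
  (proj X (x - tau *: gradK_est x y' z xi zt1 zt2), y', z + beta *: (x - z)).

Fixpoint run (x0 : 'cV[R]_n) (y0 : 'cV[R]_m) (zeta : nat -> Sz)
    (xi : nat -> Sx) (zeta1 zeta2 : nat -> Sz) (t : nat) : state :=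
  if t is t'.+1 then
    step (run x0 y0 zeta xi zeta1 zeta2 t')
         (zeta t') (xi t') (zeta1 t') (zeta2 t')
  else (x0, y0, x0).

Definition zrun x0 y0 zeta xi zeta1 zeta2 (t : nat) : 'cV[R]_n :=
  (run x0 y0 zeta xi zeta1 zeta2 t).2.

End Algorithm.

Section Probability.
Variable R : realType.

Definition has_mean d (S : measurableType d) (Q : probability S R)
    (g : S -> R) (v : R) : Prop :=
  Q.-integrable [set: S] (EFin \o g) /\ ('E_Q[g] = v%:E)%E.

Section Independence.
Variables (d : measure_display) (Om : measurableType d) (Pr : probability Om R).

Definition has_law d' (S : measurableType d') (Y : {RV Pr >-> S})
    (Q : probability S R) : Prop :=
  forall B, measurable B -> distribution Pr Y B = Q B.

Definition events_of d' (S : measurableType d') (Y : Om -> S) : set (set Om) :=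
  [set Y @^-1` B | B in @measurable _ S].

Definition mutually_independent (I : finType) (G : I -> set (set Om)) : Prop :=
  forall (J : {set I}) (E : I -> set Om), (forall i, i \in J -> G i (E i)) ->
  Pr (\bigcap_(i in [set` J]) E i) = (\prod_(i in J) Pr (E i))%E.

End Independence.

(* One index for each sample drawn in T iterations. *)
Definition sample_index (T : nat) : finType := ('I_T * 'I_4)%type.

Definition oracle_calls (T : nat) : nat := #|sample_index T|.

Section Samples.
Variables (d dz dx : measure_display) (Om : measurableType d).
Variables (Sz : measurableType dz) (Sx : measurableType dx).
Variables (Pr : probability Om R) (Pz : probability Sz R) (Px : probability Sx R).
Variables (zeta zeta1 zeta2 : nat -> {RV Pr >-> Sz}).
Variables (xi : nat -> {RV Pr >-> Sx}) (tstar : {RV Pr >-> nat}).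

Definition sample_events T (i : sample_index T) : set (set Om) :=
  match val i.2 with
  | 0%N => events_of (zeta i.1)
  | 1%N => events_of (xi i.1)
  | 2%N => events_of (zeta1 i.1)
  | _ => events_of (zeta2 i.1)
  end.

Definition sampling (T : nat) : Prop :=
  [/\ forall t, (t < T)%N ->
        [/\ has_law (zeta t) Pz, has_law (zeta1 t) Pz,
            has_law (zeta2 t) Pz & has_law (xi t) Px],
      forall k, (1 <= k <= T)%N -> Pr (tstar @^-1` [set k]) = (T%:R^-1)%:E
    & mutually_independent Pr (fun i : option (sample_index T) =>
        if i is Some j then sample_events j else events_of tstar)].

End Samples.
End Probability.

(* Main.v *)
(* Let E(x,y,z) be the Moreau envelope in x, with parameter 1/lambda, of K(.,y,z)
   restricted to X, and let V = E - 2 d + 2 Psi, which is bounded below by Psi.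
   Bounding each of the three terms at the new iterate through the minimizers at
   the old one shows that, in expectation, a step without reset changes V by at
   most - (mu beta / 2) |z - xbar(z)|^2 + O(tau^2): strong convexity of the
   envelope problem and the error bound absorb the cross terms.  A reset of the
   dual variable lowers V by at least r M_y - (M_V - M_Psi + 2 M) > 0, because d
   decreases linearly in |y|; for small tau this outweighs the O(tau) terms, so
   the same inequality holds.  Since X is compact and |y| < M_y after the first
   step, all second moments are bounded.

   Summing over t, with beta of order tau and tau of order T^(-1/2), the average
   of E |z_t - xbar(z_t)|^2 is O(T^(-1/2)).  As grad Psi(z) = mu (z - xbar(z)),
   the inequality |g| <= eps/2 + |g|^2 / (2 eps) gives the claim. *)
From HB Require Import structures.
Require Import Defs.
From mathcomp Require Import ring lra measurable_realfun.

Set Implicit Arguments.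
Unset Strict Implicit.
Unset Printing Implicit Defensive.

Local Open Scope classical_set_scope.
Local Open Scope ring_scope.

(** * Euclidean linear algebra *)

(** A step without reset is expanded around the old triple (x, y, z), so the proximal point, the
    minimizers and hence all coefficients are fixed before its samples are drawn; the dual noise
    then enters linearly and averages out. The price is that the gradient is sampled at the new dual
    variable, which costs a further term of order tau eta. A reset breaks this linearity, because
    whether it occurs depends on the sample. Both branches are therefore bounded sample by sample by
    one expression, [step_target], affine in the dual residual up to a multiple of its square, and
    only that expression is averaged. V minus a lower bound of Psi is nonnegative, so Tonelli's
    theorem handles all iterated integrals, and the recursion is written in the extended reals with
    additions only. Minimizers are picked by choice, so measurability has to come from continuity of
    [proj], [xbar] and V in their parameters. The threshold on tau does not depend on T; C is taken
    large enough for T >= C / eps^4 to enforce it. *)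

Section InnerProduct.
Variables (R : realType) (n : nat).
Implicit Types (u v w : 'cV[R]_n) (c : R).

Lemma dotpC u v : dotp u v = dotp v u.
Proof. by apply: eq_bigr => i _; rewrite mulrC. Qed.

Lemma dotpDl u v w : dotp (u + v) w = dotp u w + dotp v w.
Proof. by rewrite -big_split; apply: eq_bigr => i _; rewrite !mxE mulrDl. Qed.

Lemma dotpZl c u v : dotp (c *: u) v = c * dotp u v.
Proof. by rewrite mulr_sumr; apply: eq_bigr => i _; rewrite !mxE mulrA. Qed.

Lemma dotpNl u v : dotp (- u) v = - dotp u v.
Proof. by rewrite -scaleN1r dotpZl mulN1r. Qed.

Lemma dotpDr u v w : dotp w (u + v) = dotp w u + dotp w v.
Proof. by rewrite !(dotpC w) dotpDl. Qed.

Lemma dotpZr c u v : dotp v (c *: u) = c * dotp v u.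
Proof. by rewrite !(dotpC v) dotpZl. Qed.

Lemma dotpNr u v : dotp v (- u) = - dotp v u.
Proof. by rewrite !(dotpC v) dotpNl. Qed.

Lemma dotp0l u : dotp 0 u = 0.
Proof. by rewrite -(scale0r u) dotpZl mul0r. Qed.

Lemma dotp0r u : dotp u 0 = 0.
Proof. by rewrite dotpC dotp0l. Qed.

Definition dotpE := (dotpDl, dotpDr, dotpNl, dotpNr, dotpZl, dotpZr, dotp0l, dotp0r).

Lemma dotp_ge0 u : 0 <= dotp u u.
Proof. by apply: sumr_ge0 => i _; rewrite -expr2 sqr_ge0. Qed.

Lemma dotp_eq0 u : dotp u u = 0 -> u = 0.
Proof.
move=> /psumr_eq0P h; apply/matrixP => i j; rewrite (ord1 j) mxE.
apply/eqP; rewrite -[_ == _]orbb -mulf_eq0; apply/eqP/h => // k _.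
by rewrite -expr2 sqr_ge0.
Qed.

Lemma enorm_sqr u : enorm u ^+ 2 = dotp u u.
Proof. by rewrite sqr_sqrtr ?dotp_ge0. Qed.

Lemma enorm_ge0 u : 0 <= enorm u.
Proof. exact: sqrtr_ge0. Qed.

Lemma dotp_young u v c : 0 < c -> 2 * dotp u v <= c * dotp u u + c^-1 * dotp v v.
Proof.
move=> c0; have := dotp_ge0 (c *: u - v).
rewrite !dotpE (dotpC v u) => h.
have -> : c^-1 * dotp v v = c^-1 * (dotp v v - 2 * c * dotp u v + c * c * dotp u u)
    + 2 * dotp u v - c * dotp u u by field; rewrite gt_eqF.
have : 0 <= c^-1 * (dotp v v - 2 * c * dotp u v + c * c * dotp u u).
  by apply: mulr_ge0; [rewrite invr_ge0 ltW|lra].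
by move=> ?; lra.
Qed.

Lemma dotp_young1 u v : 2 * dotp u v <= dotp u u + dotp v v.
Proof. by have := dotp_young u v ltr01; rewrite invr1 !mul1r. Qed.

Lemma dotp_sqrD u v : dotp (u + v) (u + v) <= 2 * dotp u u + 2 * dotp v v.
Proof. by rewrite !dotpE (dotpC v u); have := dotp_young1 u v; lra. Qed.

Lemma dotp_CS u v : dotp u v ^+ 2 <= dotp u u * dotp v v.
Proof.
have uu := dotp_ge0 u; have vv := dotp_ge0 v.
have := dotp_ge0 (dotp v v *: u - dotp u v *: v).
have -> : dotp (dotp v v *: u - dotp u v *: v) (dotp v v *: u - dotp u v *: v)
   = dotp v v * (dotp u u * dotp v v - dotp u v ^+ 2).
  by rewrite !dotpE (dotpC v u); ring.
have [v0|v0] := eqVneq (dotp v v) 0; last first.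
  by rewrite pmulr_rge0 ?subr_ge0// lt_neqAle eq_sym v0.
by move=> _; rewrite (dotp_eq0 v0) !dotp0r expr0n mulr0.
Qed.

Lemma ler_abs_dotp u v : `|dotp u v| <= enorm u * enorm v.
Proof.
rewrite -(ler_pXn2r (n := 2)) ?nnegrE ?mulr_ge0 ?enorm_ge0//.
by rewrite exprMn !enorm_sqr real_normK ?num_real ?dotp_CS.
Qed.

Lemma ler_dotp u v : dotp u v <= enorm u * enorm v.
Proof. exact: le_trans (ler_norm _) (ler_abs_dotp _ _). Qed.

Lemma enorm_le u v : (enorm u <= enorm v) = (dotp u u <= dotp v v).
Proof. by rewrite ler_sqrt ?dotp_ge0. Qed.

Lemma enorm_leP u c : 0 <= c -> (enorm u <= c) = (dotp u u <= c ^+ 2).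
Proof.
move=> c0; rewrite -enorm_sqr ler_pXn2r// nnegrE; exact: enorm_ge0.
Qed.

Lemma enormD u v : enorm (u + v) <= enorm u + enorm v.
Proof.
rewrite enorm_leP ?addr_ge0 ?enorm_ge0// !dotpE (dotpC v u).
have := ler_dotp u v; rewrite -!enorm_sqr; nra.
Qed.

Lemma enormZ c u : enorm (c *: u) = `|c| * enorm u.
Proof.
by rewrite /enorm !dotpE mulrA -expr2 sqrtrM ?sqr_ge0// sqrtr_sqr.
Qed.

Lemma enormN u : enorm (- u) = enorm u.
Proof. by rewrite -scaleN1r enormZ normrN1 mul1r. Qed.

Lemma enormB u v : enorm (u - v) = enorm (v - u).
Proof. by rewrite -enormN opprB. Qed.

Lemma ler_dist_enorm u v : `|enorm u - enorm v| <= enorm (u - v).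
Proof.
have h (x y : 'cV[R]_n) : enorm x - enorm y <= enorm (x - y).
  by have := enormD (x - y) y; rewrite subrK lerBlDr.
by rewrite ler_norml h andbT lerNl opprB enormB h.
Qed.

Lemma enorm0 : enorm (0 : 'cV[R]_n) = 0.
Proof. by rewrite /enorm dotp0l sqrtr0. Qed.

Lemma enorm_eq0 u : enorm u = 0 -> u = 0.
Proof.
by move=> h; apply: dotp_eq0; rewrite -enorm_sqr h expr0n.
Qed.

Lemma coord_le_enorm u i : `|u i 0| <= enorm u.
Proof.
rewrite -(ler_pXn2r (n := 2)) ?nnegrE ?enorm_ge0// enorm_sqr.
rewrite real_normK ?num_real// /dotp (bigD1 i)//= -expr2 lerDl.
by apply: sumr_ge0 => j _; rewrite -expr2 sqr_ge0.
Qed.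

Lemma enorm_le_sum u : enorm u <= \sum_i `|u i 0|.
Proof.
rewrite enorm_leP ?sumr_ge0// expr2 mulr_suml; apply: ler_sum => i _.
rewrite (le_trans (ler_norm _))// normrM ler_wpM2l//.
by rewrite (bigD1 i)//= lerDl sumr_ge0.
Qed.

Lemma coord_le_normr u i : `|u i 0| <= `|u|.
Proof.
by rewrite [leRHS]/Num.Def.normr/= mx_normrE; apply: (le_bigmax _ _ (i, 0)).
Qed.

(** Limits and continuity refer to the sup norm; this comparison transfers Euclidean estimates to
    them. *)
Lemma enorm_le_normr u : enorm u <= n%:R * `|u|.
Proof.
apply: (le_trans (enorm_le_sum u)).
apply: (@le_trans _ _ (\sum_(i < n) `|u|)).
  by apply: ler_sum => i _; exact: coord_le_normr.
by rewrite sumr_const card_ord mulr_natl.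
Qed.

End InnerProduct.

(** * Operator norm, adjoint and Frobenius norm *)

Section Matrices.
Variables (R : realType) (m n : nat).
Implicit Types (B : 'M[R]_(m, n)) (u : 'cV[R]_n) (v : 'cV[R]_m).

Lemma dotp_trmx B u v : dotp (B^T *m v) u = dotp v (B *m u).
Proof.
rewrite /dotp; under eq_bigr do rewrite mxE mulr_suml.
rewrite exchange_big; apply: eq_bigr => i _; rewrite mxE mulr_sumr.
by apply: eq_bigr => j _; rewrite mxE; ring.
Qed.

(** The squared Frobenius norm, used for random matrices: it dominates the squared operator norm and
    has a mean as soon as the entries have second moments. *)
Definition frob B : R := \sum_i \sum_j B i j ^+ 2.

Lemma frob_ge0 B : 0 <= frob B.
Proof. by apply: sumr_ge0 => i _; apply: sumr_ge0 => j _; exact: sqr_ge0. Qed.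

Lemma dotp_mulmx_frob B u : dotp (B *m u) (B *m u) <= frob B * dotp u u.
Proof.
rewrite /frob mulr_suml; apply: ler_sum => i _.
have := dotp_CS (row i B)^T u; rewrite /dotp !mxE -expr2.
under eq_bigr do rewrite !mxE.
by under [X in _ <= X * _]eq_bigr do rewrite !mxE -expr2.
Qed.

Lemma opnorm_ubound B : has_ubound [set enorm (B *m u) | u in [set u : 'cV[R]_n | enorm u <= 1]].
Proof.
exists (Num.sqrt (frob B)) => _ [u /= u1 <-].
rewrite ler_sqrt ?frob_ge0//; apply: (le_trans (dotp_mulmx_frob B u)).
rewrite ler_piMr ?frob_ge0// -enorm_sqr.
by rewrite -[leRHS](expr1n _ 2) ler_pXn2r ?nnegrE ?enorm_ge0.
Qed.

Lemma opnorm_ge0 B : 0 <= opnorm B.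
Proof.
apply: ub_le_sup; first exact: opnorm_ubound.
by exists 0; rewrite /= ?enorm0 ?mulmx0 ?enorm0.
Qed.

Lemma enorm_mulmx B u : enorm (B *m u) <= opnorm B * enorm u.
Proof.
have [u0|u0] := eqVneq (enorm u) 0.
  by rewrite (enorm_eq0 u0) mulmx0 !enorm0 mulr0.
have up : 0 < enorm u by rewrite lt_neqAle eq_sym u0 enorm_ge0.
have : enorm (B *m ((enorm u)^-1 *: u)) <= opnorm B.
  apply: ub_le_sup; first exact: opnorm_ubound.
  exists ((enorm u)^-1 *: u) => //=.
  by rewrite enormZ ger0_norm ?invr_ge0 ?enorm_ge0// mulVf.
by rewrite -scalemxAr enormZ ger0_norm ?invr_ge0 ?enorm_ge0// ler_pdivrMl// mulrC.
Qed.

Lemma dotp_mulmx B u : dotp (B *m u) (B *m u) <= opnorm B ^+ 2 * dotp u u.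
Proof.
rewrite -!enorm_sqr -exprMn ler_pXn2r ?nnegrE ?mulr_ge0 ?enorm_ge0 ?opnorm_ge0//.
exact: enorm_mulmx.
Qed.

(** By duality |B^T v|^2 = <v, B B^T v>, so the norm of B also bounds its transpose once a factor
    |B^T v| is divided out. *)
Lemma enorm_tr_mulmx B v : enorm (B^T *m v) <= opnorm B * enorm v.
Proof.
have [u0|u0] := eqVneq (enorm (B^T *m v)) 0.
  by rewrite u0 mulr_ge0 ?opnorm_ge0 ?enorm_ge0.
have up : 0 < enorm (B^T *m v) by rewrite lt_neqAle eq_sym u0 enorm_ge0.
rewrite -(ler_pM2r up) -expr2 enorm_sqr dotp_trmx.
apply: (le_trans (ler_dotp _ _)); rewrite mulrC mulrAC.
by rewrite ler_wpM2r ?enorm_ge0// enorm_mulmx.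
Qed.

Lemma opnorm_gt0 B : B != 0 -> 0 < opnorm B.
Proof.
move=> B0; rewrite lt_neqAle opnorm_ge0 andbT; apply/negP => /eqP h.
move/negP: B0; apply; apply/eqP/matrixP => i j.
have := enorm_mulmx B (delta_mx j 0); rewrite -h mul0r => h0.
have /enorm_eq0 /matrixP/(_ i 0) : enorm (B *m delta_mx j 0 : 'cV[R]_m) = 0.
  by apply/eqP; rewrite eq_le h0 enorm_ge0.
by rewrite -colE !mxE.
Qed.

End Matrices.

(** * Gradients, the descent inequality and a criterion for differentiability *)

Section Gradients.
Variables (R : realType) (n : nat).
Implicit Types (g f : 'cV[R]_n -> R) (x u v : 'cV[R]_n).

Lemma derive_grad g x v : differentiable g x -> 'D_v g x = dotp (grad g x) v.
Proof.
move=> dg; rewrite deriveE// {1}(matrix_sum_delta v) linear_sum /=.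
apply: eq_bigr => i _; rewrite big_ord1 linearZ/= mxE deriveE//.
by rewrite mulrC.
Qed.

Lemma is_derive_line g x v (t : R) : (forall y, differentiable g y) ->
  is_derive t 1 (fun s : R => g (x + s *: v)) (dotp (grad g (x + t *: v)) v).
Proof.
move=> dg.
have h : derivable g (x + t *: v) v by exact: diff_derivable.
have -> : dotp (grad g (x + t *: v)) v = 'D_v g (x + t *: v) by rewrite derive_grad.
have e : (fun h : R => h^-1 *: (((fun s : R => g (x + s *: v)) \o shift t) (h *: 1) -
    g (x + t *: v))) =
  (fun h : R => h^-1 *: ((g \o shift (x + t *: v)) (h *: v) - g (x + t *: v))).
  apply/funext => s /=; congr (_ *: (g _ - _)).
  by rewrite scalerDl [s *: 1]mulr1 addrCA addrC.
by apply: DeriveDef; rewrite /derivable /derive e.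
Qed.

(** The difference of the two sides becomes a function [phi] along the segment. Its derivative at
    the point c given by the mean value theorem is nonnegative, because the gradient has moved by at
    most L c |u - x|. *)
Lemma smooth_lower f L x u : smooth L f ->
  f x + dotp (grad f x) (u - x) - L / 2 * dotp (u - x) (u - x) <= f u.
Proof.
move=> [df Lf]; set v : 'cV[R]_n := u - x.
pose phi (t : R) := f (x + t *: v) + (L / 2 * dotp v v * t ^+ 2 - t * dotp (grad f x) v).
pose dphi (t : R) := dotp (grad f (x + t *: v)) v + (L * dotp v v * t - dotp (grad f x) v).
have dphiP (t : R) : is_derive t 1 phi (dphi t).
  apply: is_deriveD; first exact: is_derive_line.
  have -> : (fun t : R => L / 2 * dotp v v * t ^+ 2 - t * dotp (grad f x) v) =
      (L / 2 * dotp v v) \*: (@idfun R ^+ 2) - dotp (grad f x) v \*: @idfun R.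
    by apply/funext => s; rewrite [s * _]mulrC.
  by apply: is_derive_eq; rewrite /GRing.scale/= expr1 mulr1; field.
have [c + ] : exists2 c, c \in `]0, 1[%R & phi 1 - phi 0 = dphi c * (1 - 0).
  apply: (@MVT _ phi dphi) => //.
  by apply: derivable_within_continuous => t _; exact: ex_derive.
rewrite in_itv/= => /andP[c0 c1].
rewrite subr0 mulr1 /phi scale0r scale1r addr0 expr1n expr0n /= => h.
have vE : x + v = u by rewrite /v addrC subrK.
suff : 0 <= dphi c by rewrite -h vE; lra.
rewrite /dphi.
have := ler_abs_dotp (grad f (x + c *: v) - grad f x) v.
rewrite dotpDl dotpNl.
have := Lf (x + c *: v) x; rewrite addrAC subrr add0r enormZ (gtr0_norm c0) => h1 h2.
have : enorm (grad f (x + c *: v) - grad f x) * enorm v <= L * (c * enorm v) * enorm v.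
  by rewrite ler_wpM2r ?enorm_ge0.
move=> h3; have := le_trans h2 h3.
have -> : L * (c * enorm v) * enorm v = L * dotp v v * c by rewrite -enorm_sqr; ring.
by rewrite ler_norml => /andP[]; lra.
Qed.

(** A named form of [dotp G], able to carry the linear structure expected of a differential. *)
Definition dotp_lin (G : 'cV[R]_n) (v : 'cV[R]_n) : R := dotp G v.

Fact dotp_lin_is_linear G : linear (dotp_lin G).
Proof. by move=> c u v; rewrite /dotp_lin dotpDr dotpZr. Qed.

HB.instance Definition _ G :=
  GRing.isLinear.Build R 'cV[R]_n R _ (dotp_lin G) (dotp_lin_is_linear G).

Lemma dotp_continuous (G : 'cV[R]_n) : continuous (dotp G).
Proof.
rewrite -[dotp G]/(dotp_lin G : _ -> _); apply/linear_bounded_continuous.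
apply/linear_boundedP; near=> M => v; rewrite /dotp_lin.
apply: (le_trans (ler_abs_dotp _ _)).
apply: (le_trans (ler_wpM2l (enorm_ge0 _) (enorm_le_normr _))).
rewrite mulrA ler_wpM2r//; near: M; exact: nbhs_pinfty_ge.
Unshelve. all: by end_near. Qed.

(** A remainder of second order is negligible and so determines the differential. This is the route
    to the gradient of Psi, which is known only as a minimum. *)
Lemma diff_of_quadratic g x G c :
  (forall u, `|g u - g x - dotp G (u - x)| <= c * dotp (u - x) (u - x)) ->
  differentiable g x /\ grad g x = G.
Proof.
move=> h.
pose K := (`|c| + 1) * n%:R ^+ 2.
have K0 : 0 < K + 1 by rewrite ltr_wpDl// /K mulr_ge0 ?addr_ge0 ?sqr_ge0.
have e : g \o shift x = cst (g x) + (dotp_lin G : 'cV[R]_n -> R) +o_ (0 : 'cV[R]_n) id.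
  apply/eqaddoP => eps eps0; near=> u => /=.
  rewrite !fctE /cst opprD addrA /dotp_lin /=.
  have := h (u + x); rewrite addrK => /le_trans; apply.
  have u2 : dotp u u <= (n%:R * `|u|) ^+ 2.
    by rewrite -enorm_sqr ler_pXn2r ?nnegrE ?enorm_ge0 ?mulr_ge0// enorm_le_normr.
  apply: (@le_trans _ _ ((`|c| + 1) * n%:R ^+ 2 * `|u| * `|u|)).
    rewrite (le_trans (ler_norm _))// normrM (ger0_norm (dotp_ge0 u)).
    rewrite (le_trans (ler_wpM2l _ u2))//.
    rewrite exprMn expr2 [(`|u|) ^+ 2]expr2 !mulrA !ler_wpM2r//.
    by rewrite lerDl.
  rewrite ler_wpM2r//; rewrite -/K.
  apply: (@le_trans _ _ ((K + 1) * `|u|)); first by rewrite ler_wpM2r// lerDl.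
  by rewrite -ler_pdivlMl//; near: u; apply: (@nbhs0_le _ 'cV[R]_n);
    rewrite mulr_gt0 ?invr_gt0.
have dE : 'd g x = dotp_lin G :> (_ -> _) by apply: diff_unique => //; exact: dotp_continuous.
have dg : differentiable g x.
  by apply/diff_locallyP; rewrite dE; split => //; exact: dotp_continuous.
split=> //; apply/matrixP => i j; rewrite (ord1 j) mxE deriveE// dE /dotp_lin.
rewrite /dotp (bigD1 i)//= big1 => [|k ki]; rewrite mxE eqxx ?mulr1 ?addr0//.
by rewrite (negbTE ki) mulr0.
Unshelve. all: by end_near. Qed.

End Gradients.

(** * Minimizers and projections *)

Section Minimizers.
Variables (R : realType) (n : nat).
Implicit Types (g : 'cV[R]_n -> R) (x u v z : 'cV[R]_n) (D : set 'cV[R]_n).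

(** One criterion covers Lipschitz and quadratic moduli; the constant may depend on the point, which
    suits functions that are only locally Lipschitz. *)
Lemma continuous_of_bound g :
  (forall x, exists C, forall u, `|g u - g x| <= C * (enorm (u - x) + dotp (u - x) (u - x))) ->
  continuous g.
Proof.
move=> h x; have [C hC] := h x.
pose K := (`|C| + 1) * (n%:R + n%:R ^+ 2) + 1.
have K0 : 0 < K by rewrite ltr_wpDl// mulr_ge0 ?addr_ge0 ?sqr_ge0.
apply/(@cvgrPdist_le _ _ _ (nbhs x)) => e e0; near=> u.
rewrite distrC (le_trans (hC u))//.
have ux1 : `|x - u| <= 1 by near: u; exact: cvgr_dist_le.
have ux : `|x - u| <= K^-1 * e.
  by near: u; apply: cvgr_dist_le => //; rewrite mulr_gt0 ?invr_gt0.
move: ux1 ux; rewrite distrC => ux1 ux.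
have h1 := enorm_le_normr (u - x).
have h2 : dotp (u - x) (u - x) <= n%:R ^+ 2 * `|u - x|.
  rewrite -enorm_sqr (@le_trans _ _ ((n%:R * `|u - x|) ^+ 2))//.
    by rewrite ler_pXn2r ?nnegrE ?enorm_ge0 ?mulr_ge0.
  rewrite exprMn ler_wpM2l ?sqr_ge0// expr2 -[leRHS]mul1r ler_wpM2r//.
apply: (@le_trans _ _ (K * `|u - x|)); last by rewrite mulrC -ler_pdivlMr// mulrC.
apply: (@le_trans _ _ ((`|C| + 1) * (n%:R * `|u - x| + n%:R ^+ 2 * `|u - x|))).
  rewrite (le_trans (ler_norm _))// normrM ler_pM//.
    by rewrite lerDl.
  by rewrite ger0_norm ?addr_ge0 ?enorm_ge0 ?dotp_ge0// lerD.
by rewrite -mulrDl mulrA ler_wpM2r// /K lerDl.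
Unshelve. all: by end_near. Qed.

Lemma smooth_continuous L g : smooth L g -> continuous g.
Proof. by move=> [dg _] x; exact: differentiable_continuous. Qed.

Lemma compact_enorm_bounded D : compact D -> exists2 B, 0 < B & forall x, D x -> enorm x <= B.
Proof.
move=> /compact_bounded [M [_ hM]].
exists (n%:R * (`|M| + 1) + 1); first by rewrite ltr_wpDl// mulr_ge0// addr_ge0.
move=> x Dx; apply: (le_trans (enorm_le_normr x)).
rewrite (@le_trans _ _ (n%:R * (`|M| + 1)))// ?lerDl//.
by rewrite ler_wpM2l//; apply: hM => //; rewrite ltr_pwDr// ler_norm.
Qed.

Definition convex_set D := forall x u (t : R),
  D x -> D u -> 0 <= t <= 1 -> D (x + t *: (u - x)).

(* For gam < 0 this is weak convexity. *)
Definition sconv (gam : R) g := exists G : 'cV[R]_n -> 'cV[R]_n, forall x u,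
  g x + dotp (G x) (u - x) + gam / 2 * dotp (u - x) (u - x) <= g u.

Lemma sconvD gam gam' g g' : sconv gam g -> sconv gam' g' -> sconv (gam + gam') (g \+ g').
Proof.
move=> [G hG] [G' hG']; exists (G \+ G') => x u /=; rewrite dotpDl.
by have := hG x u; have := hG' x u; lra.
Qed.

Lemma sconv_sqr k z : sconv k (fun u => k / 2 * dotp (u - z) (u - z)).
Proof.
exists (fun x => k *: (x - z)) => x u.
have -> : u - z = (u - x) + (x - z) by rewrite addrA subrK.
move: (u - x) (x - z) => a b; rewrite !dotpE (dotpC b a); lra.
Qed.

Lemma sconv_smooth L g : smooth L g -> sconv (- L) g.
Proof.
move=> sg; exists (grad g) => x u; have := smooth_lower x u sg.
by rewrite mulNr mulNr.
Qed.

(** The inequality at w = x + t (u - x), applied towards x and towards u with weights 1 - t and t,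
    loses its gradient term. Minimality g x <= g w then leaves gam/2 (1 - t) |u - x|^2 <= g u - g x,
    and t tends to 0. *)
Lemma sconv_min gam g D x u : convex_set D -> sconv gam g -> D x ->
  (forall v, D v -> g x <= g v) -> D u -> g x + gam / 2 * dotp (u - x) (u - x) <= g u.
Proof.
move=> cD [G hG] Dx mx Du; set q := dotp (u - x) (u - x).
have key (t : R) : 0 < t <= 1 -> gam / 2 * (1 - t) * q <= g u - g x.
  move=> /andP[t0 t1]; set w := x + t *: (u - x).
  have := mx w (cD _ _ _ Dx Du _); rewrite (ltW t0) t1 => /(_ isT) hw.
  have := hG w x; have := hG w u.
  have -> : x - w = - t *: (u - x) by rewrite /w opprD addrA subrr add0r scaleNr.
  have -> : u - w = (1 - t) *: (u - x) by rewrite /w opprD addrA scalerBl scale1r.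
  rewrite /q; move: (u - x) => d; rewrite !dotpE => h1 h2.
  have t1' : 0 <= 1 - t by lra.
  have {}h1 := ler_wpM2l (ltW t0) h1; have {}h2 := ler_wpM2l t1' h2.
  rewrite -(ler_pM2l t0); nra.
rewrite -lerBrDl leNgt; apply/negP => hlt.
set c := gam / 2 * q in hlt; set r := g u - g x in hlt key.
have key' (t : R) : 0 < t <= 1 -> c - t * c <= r by move=> /key; rewrite /c; lra.
have [c0|c0] := leP c 0; first by have := key' 1; rewrite ltr01 lexx => /(_ isT); lra.
have [r0|r0] := leP r 0.
  by have := key' (1/2); rewrite (_ : 0 < 1/2 <= 1) => [/(_ isT)|]; [lra|apply/andP; lra].
have c2 : 0 < 2 * c by lra.
(* This replaces the limit: for this t, c - t c = (c + r) / 2, which exceeds r since r < c. *)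
have := key' ((c - r) / (2 * c)).
have -> : (c - r) / (2 * c) * c = (c - r) / 2 by field; rewrite gt_eqF.
have -> : 0 < (c - r) / (2 * c) <= 1.
  by rewrite divr_gt0 ?subr_gt0//= ler_pdivrMr// mul1r; lra.
by move=> /(_ isT); lra.
Qed.

(** [argmin] is a choice with an arbitrary default; compactness and continuity make the chosen point
    a minimizer. *)
Lemma argminP D g : D !=set0 -> compact D -> continuous g ->
  D (argmin D g) /\ forall u, D u -> g (argmin D g) <= g u.
Proof.
move=> D0 cD cg.
have [|x xD hx] := @compact_EVT_min _ _ g D D0 cD; first exact: continuous_subspaceT.
apply: (@getPex _ [set x | D x /\ forall u, D u -> g x <= g u]).
by exists x; split; [exact: set_mem|move=> u /mem_set; exact: hx].
Qed.

Lemma inf_image_min D g x : D x -> (forall u, D u -> g x <= g u) ->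
  inf [set g u | u in D] = g x.
Proof.
move=> Dx mx; apply/eqP; rewrite eq_le; apply/andP; split.
  by apply: ge_inf; [exists (g x) => _ [u Du <-]; exact: mx|exists x].
by apply: lb_le_inf; [exists (g x), x|move=> _ [u Du <-]; exact: mx].
Qed.

(** Adding the growth inequalities at the two minimizers, each tested at the other, cancels g. With
    g = 0 this yields nonexpansive projections, with g = f the dependence of [xbar] on its
    centre. *)
Lemma prox_monotone D g k gam (z z' x x' : 'cV[R]_n) : convex_set D ->
  (forall z, sconv gam (fun u => g u + k / 2 * dotp (u - z) (u - z))) ->
  D x -> (forall u, D u -> g x + k / 2 * dotp (x - z) (x - z) <= g u + k / 2 * dotp (u - z) (u - z)) ->
  D x' -> (forall u, D u -> g x' + k / 2 * dotp (x' - z') (x' - z') <= g u + k / 2 * dotp (u - z') (u - z')) ->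
  gam * dotp (x - x') (x - x') <= k * dotp (x - x') (z - z').
Proof.
move=> cD sg Dx mx Dx' mx'.
have h1 := sconv_min cD (sg z) Dx mx Dx'.
have := sconv_min cD (sg z') Dx' mx' Dx.
have -> : dotp (x - x') (x - x') = dotp (x' - x) (x' - x) by rewrite !dotpE; ring.
have -> : dotp (x - x') (z - z') = (dotp (x' - z) (x' - z) - dotp (x - z) (x - z)
   + dotp (x - z') (x - z') - dotp (x' - z') (x' - z')) / 2.
  by rewrite !dotpE (dotpC z x) (dotpC z' x) (dotpC z x') (dotpC z' x'); field.
lra.
Qed.

Lemma proj_spec D v : D !=set0 -> compact D ->
  D (proj D v) /\ forall u, D u -> dotp (proj D v - v) (proj D v - v) <= dotp (u - v) (u - v).
Proof.
move=> D0 cD; have [|Dp hp] := @argminP D (fun u => enorm (v - u)) D0 cD.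
  apply: continuous_of_bound => x; exists 1 => u; rewrite mul1r.
  rewrite (@le_trans _ _ (enorm (u - x)))// ?lerDl ?dotp_ge0//.
  by rewrite (le_trans (ler_dist_enorm _ _))// opprB addrC subrKA enormB.
split=> // u Du; rewrite -!enorm_sqr ler_pXn2r ?nnegrE ?enorm_ge0//.
by rewrite enormB (enormB u); exact: hp.
Qed.

(** Quadratic growth of the squared distance away from its minimizer gives the Pythagorean
    inequality, of which only one term is kept. *)
Lemma proj_pythagoras D v u : convex_set D -> D !=set0 -> compact D -> D u ->
  dotp (u - proj D v) (u - proj D v) <= dotp (u - v) (u - v).
Proof.
move=> cD D0 kD Du; have [Dp hp] := proj_spec v D0 kD.
have mp w : D w -> 1 / 2 * dotp (proj D v - v) (proj D v - v) <= 1 / 2 * dotp (w - v) (w - v).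
  by move=> /hp; lra.
have := sconv_min cD (sconv_sqr 1 v) Dp mp Du.
by have := dotp_ge0 (proj D v - v); lra.
Qed.

Lemma proj_lipschitz D v w : convex_set D -> D !=set0 -> compact D ->
  dotp (proj D v - proj D w) (proj D v - proj D w) <= dotp (v - w) (v - w).
Proof.
move=> cD D0 kD; have [Dv hv] := proj_spec v D0 kD; have [Dw hw] := proj_spec w D0 kD.
have s z : sconv 1 (fun u : 'cV[R]_n => 0 + 1 / 2 * dotp (u - z) (u - z)).
  by have [G h] := sconv_sqr 1 z; exists G => x u; rewrite !add0r; exact: h.
have mE z : (forall u, D u -> dotp (proj D z - z) (proj D z - z) <= dotp (u - z) (u - z)) ->
    forall u, D u -> 0 + 1 / 2 * dotp (proj D z - z) (proj D z - z) <= 0 + 1 / 2 * dotp (u - z) (u - z).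
  by move=> h u /h; lra.
have := @prox_monotone D (fun=> 0) 1 1 v w _ _ cD s Dv (mE _ hv) Dw (mE _ hw).
by have := dotp_young1 (proj D v - proj D w) (v - w); lra.
Qed.

End Minimizers.

Lemma polyhedron_convex (R : realType) p n (H : 'M[R]_(p, n)) h : convex_set (polyhedron H h).
Proof.
move=> x u t /= hx hu /andP[t0 t1] i.
rewrite mulmxDr -scalemxAr mulmxBr !mxE; have := hx i; have := hu i; rewrite !mxE; nra.
Qed.

Lemma continuous_scale (R : realType) n (k : R) (g : 'cV[R]_n -> R) :
  continuous g -> continuous (fun u : 'cV[R]_n => k * g u).
Proof. by move=> cg u; exact: cvgM (cvg_cst k) (cg u). Qed.

Lemma affine_sqr_continuous (R : realType) m n (B : 'M[R]_(m, n)) c :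
  continuous (fun u : 'cV[R]_n => dotp (B *m u - c) (B *m u - c)).
Proof.
apply: continuous_of_bound => x.
exists (2 * enorm (B *m x - c) * opnorm B + opnorm B ^+ 2) => u.
have -> : B *m u - c = B *m (u - x) + (B *m x - c).
  by rewrite mulmxBr addrA subrK.
move: (u - x) (B *m x - c) => d a.
have -> : dotp (B *m d + a) (B *m d + a) - dotp a a = 2 * dotp a (B *m d) + dotp (B *m d) (B *m d).
  by rewrite !dotpE (dotpC (B *m d) a); ring.
rewrite (le_trans (ler_normD _ _))// (ger0_norm (dotp_ge0 _)) normrM (@ger0_norm _ 2)//.
have h1 := ler_abs_dotp a (B *m d).
have h2 := ler_wpM2l (enorm_ge0 a) (enorm_mulmx B d).
have h3 := dotp_mulmx B d.
have p1 : 0 <= enorm a * opnorm B * dotp d d by rewrite !mulr_ge0 ?enorm_ge0 ?opnorm_ge0 ?dotp_ge0.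
have p2 : 0 <= opnorm B ^+ 2 * enorm d by rewrite mulr_ge0 ?sqr_ge0 ?enorm_ge0.
by lra.
Qed.

Lemma enorm_affine_continuous (R : realType) m n (k : R) (B : 'M[R]_(m, n)) c :
  continuous (fun u : 'cV[R]_n => k * enorm (B *m u - c) ^+ 2).
Proof.
have -> : (fun u : 'cV[R]_n => k * enorm (B *m u - c) ^+ 2) =
    (fun u => k * dotp (B *m u - c) (B *m u - c)).
  by apply/funext => u; rewrite enorm_sqr.
by apply: continuous_scale; exact: affine_sqr_continuous.
Qed.

Lemma enorm_dist_continuous (R : realType) n (k : R) (c : 'cV[R]_n) :
  continuous (fun u : 'cV[R]_n => k * enorm (u - c) ^+ 2).
Proof.
have -> : (fun u : 'cV[R]_n => k * enorm (u - c) ^+ 2) =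
    (fun u => k * enorm (1%:M *m u - c) ^+ 2).
  by apply/funext => u; rewrite mul1mx.
exact: enorm_affine_continuous.
Qed.

(** Here v = x - uhat, e = uhat - xstar, q = xstar - xbar, w = z - xbar, a = A xstar - b, As = A e
    and Av = A v. Three negative squares are available: eta |a|^2 from the dual step, mu beta |w|^2
    from the motion of z, and lam tau (lam + gam) |v|^2 from the primal descent. The error bound
    turns |q|^2 into |a|^2, the proximal estimate turns |e|^2 into |v|^2, and the step-size ratios
    keep the cross terms small enough to leave half of the |w|^2 term. *)
Lemma drift_algebra (R : realType) m n (tau eta beta sbar lam mu gam nA : R)
    (v e q w : 'cV[R]_n) (a As Av : 'cV[R]_m) :
  2 <= mu -> 3 / 4 * mu <= gam -> mu <= lam ->
  0 <= tau -> 0 <= eta -> 0 <= beta -> eta * nA ^+ 2 <= tau / 200 ->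
  beta <= tau / 100 -> beta * (36 * mu * sbar ^+ 2) <= eta ->
  dotp q q <= sbar ^+ 2 * dotp a a ->
  gam ^+ 2 * dotp e e <= lam ^+ 2 * dotp v v ->
  dotp Av Av <= nA ^+ 2 * dotp v v -> dotp As As <= nA ^+ 2 * dotp e e ->
  eta * dotp (As - a) (a + As + Av) + mu * (beta * dotp (w + q - e) (v + e + q - w))
  - lam * tau * ((lam + gam) * dotp v v)
  <= - (mu * beta / 2 * dotp w w).
Proof.
move=> mu2 gmu mul t0 e0 be0 eA bt be hq hs AV AS.
have v0 := dotp_ge0 v; have s0 := dotp_ge0 e; have a0 := dotp_ge0 a.
have l0 : 0 <= lam by lra.
(* Since mu >= 2 and gam >= 3/4 mu, gam^2 is at least 9/4 and at least 9/8 mu. *)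
have S1 : dotp e e <= 4 / 9 * lam ^+ 2 * dotp v v.
  have : 9 / 4 * dotp e e <= gam ^+ 2 * dotp e e by rewrite ler_wpM2r//; nra.
  by lra.
have S2 : mu * dotp e e <= 8 / 9 * lam ^+ 2 * dotp v v.
  have : 9 / 8 * mu * dotp e e <= gam ^+ 2 * dotp e e by rewrite ler_wpM2r//; nra.
  by lra.
have L1 : dotp v v <= lam ^+ 2 / 4 * dotp v v by rewrite ler_peMl//; nra.
have L2 : 4 * mu * dotp v v <= 2 * lam ^+ 2 * dotp v v by rewrite ler_wpM2r//; nra.
(* The products <a, As> cancel; splitting <a, Av> through |a + 2 Av|^2 >= 0 costs a quarter of
   |a|^2. *)
have Y : eta * dotp (As - a) (a + As + Av) <=
    - (3 / 4) * (eta * dotp a a) + 3 / 400 * (lam ^+ 2 * (tau * dotp v v)).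
  have h : dotp (As - a) (a + As + Av) <= - (3 / 4) * dotp a a + 3 / 2 * (nA ^+ 2 * (dotp v v + dotp e e)).
    have := dotp_ge0 (a + 2 *: Av); have := dotp_young1 As Av.
    by rewrite !dotpE (dotpC Av a) (dotpC As a); lra.
  have {}h := ler_wpM2l e0 h.
  have : eta * nA ^+ 2 * (dotp v v + dotp e e) <= tau / 200 * (lam ^+ 2 * dotp v v).
    by apply: ler_pM => //; [rewrite mulr_ge0 ?sqr_ge0|rewrite addr_ge0|have := mulr_ge0 (sqr_ge0 lam) v0; lra].
  by lra.
have Z : mu * (beta * dotp (w + q - e) (v + e + q - w)) <=
    - (mu * beta / 2 * dotp w w) + eta / 18 * dotp a a + 3 / 40 * (lam ^+ 2 * (tau * dotp v v)).
  have h : dotp (w + q - e) (v + e + q - w) <= - (1 / 2 * dotp w w) + 2 * dotp q q + 4 * dotp v v + 6 * dotp e e.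
    have := dotp_ge0 (w - 2 *: (v + e)); have := dotp_ge0 (w - 2 *: e).
    have := dotp_young1 q (v + e); have := dotp_ge0 (e + q); have := dotp_ge0 (e + (v + e)).
    have := dotp_ge0 (v - e).
    rewrite !dotpE (dotpC e v) (dotpC e w) (dotpC v w) (dotpC q w) (dotpC e q) ?(dotpC v q).
    by lra.
  have mb : 0 <= mu * beta by rewrite mulr_ge0//; lra.
  have {}h := ler_wpM2l mb h.
  have hq1 : mu * beta * dotp q q <= eta / 36 * dotp a a.
    have := ler_wpM2l mb hq; have := ler_wpM2r a0 be; lra.
  have he : beta * (4 * mu * dotp v v + 6 * (mu * dotp e e)) <= tau / 100 * (22 / 3 * (lam ^+ 2 * dotp v v)).
    by apply: ler_pM => //; [rewrite addr_ge0// !mulr_ge0//; lra|lra].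
  have : 0 <= lam ^+ 2 * (tau * dotp v v) by rewrite !mulr_ge0.
  by lra.
have p1 : 0 <= eta * dotp a a by exact: mulr_ge0.
have p2 : 0 <= lam * tau * gam * dotp v v by rewrite !mulr_ge0//; lra.
have p3 : 0 <= lam ^+ 2 * (tau * dotp v v) by rewrite !mulr_ge0.
move: Y Z; lra.
Qed.

(** * The potential *)

Section Potential.
Variables (R : realType) (m n : nat).
Variables (f : 'cV[R]_n -> R) (A : 'M[R]_(m, n)) (b : 'cV[R]_m).
Variables (X : set 'cV[R]_n) (rho mu Lf lam : R).
Hypotheses (sf : smooth Lf f) (cX : convex_set X) (kX : compact X).
Hypothesis (F0 : feasible A b X !=set0).
Hypotheses (rho0 : 0 <= rho) (mu0 : 0 < mu) (lam0 : 0 < lam) (gam0 : 0 < mu - Lf).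
Implicit Types (x z u : 'cV[R]_n) (y : 'cV[R]_m).

Local Notation K := (Kfun f A b rho mu).
Local Notation d := (dfun f A b X rho mu).
Local Notation xs := (xstar f A b X rho mu).
Local Notation xb := (xbar f A b X mu).
Local Notation PsiX := (Psi f A b X mu).
Local Notation nA := (opnorm A).
Local Notation gam := (mu - Lf).

Lemma X_nonempty : X !=set0.
Proof. by case: F0 => c [Xc _]; exists c. Qed.

Lemma feasible_compact : compact (feasible A b X).
Proof.
have -> : feasible A b X = X `&` (fun u => dotp (A *m u - b) (A *m u - b)) @^-1` [set 0].
  apply/seteqP; split => u /= [Xu h]; split => //.
    by rewrite h subrr dotp0l.
  by apply/eqP; rewrite -subr_eq0; apply/eqP/dotp_eq0.
apply: compact_closedI => //; apply: closed_comp; last exact: closed_eq.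
by move=> u _; exact: affine_sqr_continuous.
Qed.

Lemma feasible_convex : convex_set (feasible A b X).
Proof.
move=> x u t [Xx hx] [Xu hu] t01; split; first exact: cX.
by rewrite mulmxDr -scalemxAr mulmxBr hx hu subrr scaler0 addr0.
Qed.

(** Written out term by term to match the sampled direction [gradK_est], whose mean it is. *)
Definition gradK x y z : 'cV[R]_n :=
  grad f x + A^T *m y + rho *: (A^T *m (A *m x - b)) + mu *: (x - z).

(** The multiplier and penalty terms are convex, so only f reduces the modulus mu of the proximal
    term, by Lf. *)
Lemma gradK_lower x y z u :
  K x y z + dotp (gradK x y z) (u - x) + gam / 2 * dotp (u - x) (u - x) <= K u y z.
Proof.
have := smooth_lower x u sf.
rewrite /Kfun /Lrho /gradK !enorm_sqr.
have -> : A *m u - b = A *m (u - x) + (A *m x - b) by rewrite mulmxBr addrA subrK.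
have -> : u - z = (u - x) + (x - z) by rewrite addrA subrK.
move: (u - x) (x - z) (A *m x - b) => e c a.
have := mulr_ge0 rho0 (dotp_ge0 (A *m e)).
rewrite !(dotpDl, dotpDr, dotpZl, dotpZr) !dotp_trmx.
rewrite (dotpC c e) (dotpC a (A *m e)) (dotpC y (A *m e)).
by lra.
Qed.

Lemma K_sconv y z : sconv gam (fun x => K x y z).
Proof. by exists (fun x => gradK x y z) => x u; exact: gradK_lower. Qed.

Lemma K_continuous y z : continuous (fun x : 'cV[R]_n => K x y z).
Proof.
move=> x; rewrite /Kfun /Lrho.
apply: (@continuousD _ _ _ (fun x => f x + dotp (A *m x - b) y + rho / 2 * enorm (A *m x - b) ^+ 2)
   (fun x => mu / 2 * enorm (x - z) ^+ 2)).
  apply: (@continuousD _ _ _ (fun x => f x + dotp (A *m x - b) y)).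
    apply: (@continuousD _ _ _ f); first exact: smooth_continuous sf _.
    have -> : (fun x => dotp (A *m x - b) y) = (fun x => dotp (A^T *m y) x - dotp b y).
      by apply/funext => u; rewrite dotpDl dotpNl dotp_trmx (dotpC y).
    by apply: continuousB; [exact: dotp_continuous|exact: cst_continuous].
  exact: enorm_affine_continuous.
exact: enorm_dist_continuous.
Qed.

Lemma xstarP y z : X (xs y z) /\ forall u, X u -> K (xs y z) y z <= K u y z.
Proof. exact: argminP X_nonempty kX (@K_continuous y z). Qed.

Lemma dfunE y z : d y z = K (xs y z) y z.
Proof. by have [? ?] := xstarP y z; exact: inf_image_min. Qed.

Lemma dfun_lower y z u : X u ->
  d y z + gam / 2 * dotp (u - xs y z) (u - xs y z) <= K u y z.
Proof.
have [Xs ms] := xstarP y z.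
by rewrite dfunE; exact: sconv_min cX (K_sconv y z) Xs ms.
Qed.

Lemma xbarP z : feasible A b X (xb z) /\ forall u, feasible A b X u ->
  f (xb z) + mu / 2 * enorm (xb z - z) ^+ 2 <= f u + mu / 2 * enorm (u - z) ^+ 2.
Proof.
apply: (argminP F0 feasible_compact) => x.
apply: (@continuousD _ _ _ f (fun u => mu / 2 * enorm (u - z) ^+ 2)); first exact: smooth_continuous sf _.
exact: enorm_dist_continuous.
Qed.

Lemma PsiE z : PsiX z = f (xb z) + mu / 2 * enorm (xb z - z) ^+ 2.
Proof. by have [Fz mz] := xbarP z; exact: (inf_image_min (g := fun x => _) Fz mz). Qed.

Lemma xbar_X z : X (xb z).
Proof. by have [[]] := xbarP z. Qed.

Lemma xbar_feas z : A *m xb z = b.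
Proof. by have [[]] := xbarP z. Qed.

Lemma xbar_monotone z z' :
  gam * dotp (xb z - xb z') (xb z - xb z') <= mu * dotp (xb z - xb z') (z - z').
Proof.
have [Fz mz] := xbarP z; have [Fz' mz'] := xbarP z'.
apply: (prox_monotone feasible_convex _ Fz _ Fz') => [w|u Fu|u Fu].
- rewrite [gam]addrC; exact: sconvD (sconv_smooth sf) (sconv_sqr mu w).
- by rewrite -!enorm_sqr; exact: mz.
- by rewrite -!enorm_sqr; exact: mz'.
Qed.

Lemma xbar_lipschitz z z' :
  gam ^+ 2 * dotp (xb z - xb z') (xb z - xb z') <= mu ^+ 2 * dotp (z - z') (z - z').
Proof.
have h := xbar_monotone z z'; move: (xb z - xb z') (z - z') h => p q h.
have := dotp_ge0 (gam *: p - mu *: q).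
have := ler_wpM2l (ltW gam0) h.
by rewrite !dotpE (dotpC q p); lra.
Qed.

Lemma Psi_upper z z2 :
  PsiX z2 <= PsiX z + mu * dotp (z - xb z) (z2 - z) + mu / 2 * dotp (z2 - z) (z2 - z).
Proof.
have [_ mz2] := xbarP z2; have [Fz _] := xbarP z.
rewrite !PsiE; apply: (le_trans (mz2 _ Fz)); rewrite !enorm_sqr.
have -> : xb z - z2 = - (z - xb z) - (z2 - z).
  by rewrite opprB opprB addrA subrK.
have -> : xb z - z = - (z - xb z) by rewrite opprB.
by move: (z - xb z) (z2 - z) => p q; rewrite !dotpE (dotpC q p); lra.
Qed.

(** [Psi_upper] bounds Psi from above to second order. Exchanging z and u gives the other side with
    the gradient at u, and the dependence of [xbar] on its centre moves it back to z. *)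
Lemma Psi_diff z : differentiable PsiX z /\ grad PsiX z = mu *: (z - xb z).
Proof.
apply: (@diff_of_quadratic _ _ _ _ _ (mu / 2 + mu ^+ 2 / gam)) => u.
rewrite dotpZl ler_norml; apply/andP; split; last first.
  have := Psi_upper z u; have := dotp_ge0 (u - z).
  have : 0 <= mu ^+ 2 / gam by rewrite divr_ge0 ?sqr_ge0 ?ltW.
  move=> h1 h2; have := mulr_ge0 h1 h2; lra.
have := Psi_upper u z.
have h : mu * dotp (xb u - xb z) (u - z) <= mu ^+ 2 / gam * dotp (u - z) (u - z).
  (* The weight gam / mu produces gam |xbar u - xbar z|^2, which [xbar_monotone] absorbs; hence the
     constant mu^2 / gam. *)
  have := dotp_young (xb u - xb z) (u - z) (_ : 0 < gam / mu).
  rewrite divr_gt0// => /(_ isT) hy; have := xbar_monotone u z => hm.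
  have {}hy := ler_wpM2l (ltW mu0) hy.
  rewrite mulrDr !mulrA in hy.
  have e1 : mu * gam / mu = gam by field; rewrite gt_eqF.
  have e2 : mu * (gam / mu)^-1 = mu ^+ 2 / gam by field; rewrite !gt_eqF.
  by rewrite e1 e2 in hy; lra.
have -> : u - xb u = (z - xb z) - (xb u - xb z) + (u - z).
  by apply/matrixP => i j; rewrite !mxE; ring.
have -> : z - u = - (u - z) by rewrite opprB.
move: (z - xb z) (xb u - xb z) (u - z) h => p q e h.
by have := mulr_ge0 (ltW mu0) (dotp_ge0 e); rewrite !dotpE; lra.
Qed.

Definition Ephi x y z u : R := K u y z + lam / 2 * enorm (u - x) ^+ 2.
(** The proximal point of K(., y, z) on X. It depends on the old state only, so it is fixed when the
    samples of a step are averaged. *)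
Definition uhat x y z : 'cV[R]_n := argmin X (Ephi x y z).
Definition Efun x y z : R := Ephi x y z (uhat x y z).
Definition Vfun x y z : R := Efun x y z - 2 * d y z + 2 * PsiX z.

Lemma uhatP x y z : X (uhat x y z) /\ forall u, X u -> Efun x y z <= Ephi x y z u.
Proof.
apply: (argminP X_nonempty kX) => u.
apply: (@continuousD _ _ _ (fun u => K u y z) (fun u => lam / 2 * enorm (u - x) ^+ 2)); first exact: K_continuous.
exact: enorm_dist_continuous.
Qed.

Lemma Efun_lower x y z u : X u ->
  Efun x y z + (gam + lam) / 2 * dotp (u - uhat x y z) (u - uhat x y z) <= Ephi x y z u.
Proof.
have [Xs ms] := uhatP x y z.
have sE : sconv (gam + lam) (Ephi x y z).
  have -> : Ephi x y z = (fun u => K u y z) \+ (fun u => lam / 2 * dotp (u - x) (u - x)).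
    by apply/funext => v; rewrite /Ephi enorm_sqr.
  exact: sconvD (K_sconv y z) (sconv_sqr lam x).
exact: sconv_min cX sE Xs ms.
Qed.

Lemma Efun_le_K x y z : X x -> Efun x y z <= K x y z.
Proof.
move=> Xx; have [_ /(_ _ Xx)] := uhatP x y z.
by rewrite /Ephi subrr enorm0 expr0n mulr0 addr0.
Qed.

Lemma dfun_le_Efun x y z : d y z <= Efun x y z.
Proof.
have [Xu _] := uhatP x y z; have [_ ms] := xstarP y z.
rewrite dfunE (le_trans (ms _ Xu))// /Efun /Ephi lerDl mulr_ge0 ?sqr_ge0//.
by rewrite divr_ge0 ?ltW.
Qed.

Lemma dfun_le_Psi y z : d y z <= PsiX z.
Proof.
have [_ ms] := xstarP y z; rewrite dfunE PsiE (le_trans (ms _ (xbar_X z)))//.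
by rewrite /Kfun /Lrho xbar_feas subrr dotp0l enorm0 expr0n mulr0 !addr0.
Qed.

(** V - Psi = (E - d) + (Psi - d), a sum of two nonnegative gaps. *)
Lemma Psi_le_Vfun x y z : PsiX z <= Vfun x y z.
Proof. by rewrite /Vfun; have := dfun_le_Efun x y z; have := dfun_le_Psi y z; lra. Qed.

Lemma Efun_upper x y z x2 y2 z2 (u := uhat x y z) :
  Efun x2 y2 z2 <= Efun x y z + dotp (A *m u - b) (y2 - y)
    + mu * dotp (z - u) (z2 - z) + mu / 2 * dotp (z2 - z) (z2 - z)
    + lam / 2 * (dotp (u - x2) (u - x2) - dotp (u - x) (u - x)).
Proof.
have [Xu _] := uhatP x y z; have [_ m2] := uhatP x2 y2 z2.
apply: (le_trans (m2 _ Xu)).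
rewrite /Efun -/u /Ephi /Kfun /Lrho dotpDr dotpNr !enorm_sqr.
have -> : u - z2 = - (z - u) - (z2 - z) by rewrite !opprB addrA subrK.
have -> : u - z = - (z - u) by rewrite opprB.
move: (z - u) (z2 - z) (u - x2) (u - x) => p q r s.
by rewrite !dotpE (dotpC q p); lra.
Qed.

(** Since d enters V with a minus sign, it has to be bounded from below at the new point, where the
    new minimizer v is not under control. The quadratic growth gam/2 |v - u|^2 of the old problem
    absorbs the terms linear in v - u; completing the square leaves the error with factor 1 /
    gam. *)
Lemma dfun_upper_dev y z y2 z2 (u := xs y z) :
  d y z + dotp (A *m u - b) (y2 - y) + mu * dotp (z - u) (z2 - z)
    + mu / 2 * dotp (z2 - z) (z2 - z)
    - gam^-1 * (nA ^+ 2 * dotp (y2 - y) (y2 - y) + mu ^+ 2 * dotp (z2 - z) (z2 - z))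
  <= d y2 z2.
Proof.
have [Xu2 _] := xstarP y2 z2; set v := xs y2 z2 in Xu2.
have hv := dfun_lower y z Xu2; rewrite [d y2 z2]dfunE -/v -/u in hv *.
set e := v - u in hv.
have -> : K v y2 z2 = K v y z + dotp (A *m u - b) (y2 - y) + dotp (A *m e) (y2 - y)
    + mu * dotp (z - u) (z2 - z) - mu * dotp e (z2 - z) + mu / 2 * dotp (z2 - z) (z2 - z).
  rewrite /Kfun /Lrho !enorm_sqr /e.
  have -> : v - z2 = (v - u) - (z - u) - (z2 - z).
    by rewrite opprB [_ + (u - z)]addrA subrK opprB addrA subrK.
  have -> : v - z = (v - u) - (z - u) by rewrite opprB addrA subrK.
  have -> : A *m u - b = (A *m v - b) - A *m (v - u).
    by rewrite mulmxBr; move: (A *m v) (A *m u) => ? ?; apply/matrixP => i j; rewrite !mxE; ring.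
  move: (v - u) (z - u) (z2 - z) (A *m v - b) => k p q a.
  by rewrite !dotpE (dotpC q p) (dotpC p k) (dotpC q k); field.
clearbody e.
have hy : nA ^+ 2 * dotp (y2 - y) (y2 - y) >= dotp (A^T *m (y2 - y)) (A^T *m (y2 - y)).
  rewrite -!enorm_sqr -exprMn ler_pXn2r ?nnegrE ?mulr_ge0 ?enorm_ge0 ?opnorm_ge0//.
  exact: enorm_tr_mulmx.
have := dotp_ge0 (gam *: e + (A^T *m (y2 - y) - mu *: (z2 - z))).
have := dotp_sqrD (A^T *m (y2 - y)) (- (mu *: (z2 - z))).
have -> : dotp (A *m e) (y2 - y) = dotp (A^T *m (y2 - y)) e by rewrite dotp_trmx dotpC.
move: (A^T *m (y2 - y)) hy => q hy.
have gi : 0 < gam^-1 by rewrite invr_gt0.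
set G := gam^-1 in gi *.
have Gg : G * gam = 1 by rewrite mulVf// gt_eqF.
move: (z2 - z) (y2 - y) hy => p Y hy h1 h2.
have {}hy := ler_wpM2l (ltW gi) hy.
have {}h1 : G * (dotp q q - 2 * mu * dotp q p + mu ^+ 2 * dotp p p)
    <= 2 * (G * dotp q q) + 2 * (G * (mu ^+ 2 * dotp p p)).
  by have := ler_wpM2l (ltW gi) h1; rewrite !dotpE (dotpC p q); lra.
have {}h2 : 0 <= gam * dotp e e + 2 * (dotp q e - mu * dotp e p)
    + G * (dotp q q - 2 * mu * dotp q p + mu ^+ 2 * dotp p p).
  have := mulr_ge0 (ltW gi) h2; congr (_ <= _).
  rewrite !dotpE (dotpC p q) (dotpC e q) (dotpC p e).
  transitivity ((G * gam) * (gam * dotp e e + 2 * (dotp q e - mu * dotp e p))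
    + G * (dotp q q - 2 * mu * dotp q p + mu ^+ 2 * dotp p p)); first by ring.
  by rewrite Gg mul1r.
lra.
Qed.

(** All first-order coefficients involve the old point only. Besides the step estimate this serves,
    with the two points exchanged, to prove that V is continuous. *)
Lemma Vfun_upper x y z x2 y2 z2 (u := uhat x y z) (s := xs y z) :
  Vfun x2 y2 z2 <= Vfun x y z + dotp (A *m u - b - 2 *: (A *m s - b)) (y2 - y)
    + mu * dotp (z - u - 2 *: (z - s) + 2 *: (z - xb z)) (z2 - z)
    + lam / 2 * (dotp (u - x2) (u - x2) - dotp (u - x) (u - x))
    + 2 * gam^-1 * nA ^+ 2 * dotp (y2 - y) (y2 - y)
    + (mu / 2 + 2 * gam^-1 * mu ^+ 2) * dotp (z2 - z) (z2 - z).
Proof.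
have := Efun_upper x y z x2 y2 z2; have := dfun_upper_dev y z y2 z2.
have := Psi_upper z z2; rewrite /Vfun -/u -/s.
move: (Efun x y z) (d y z) (PsiX z) (Efun x2 y2 z2) (d y2 z2) (PsiX z2) gam^-1
  (dotp (y2 - y) (y2 - y)) (dotp (z2 - z) (z2 - z))
  (dotp (u - x2) (u - x2)) (dotp (u - x) (u - x)) => E D P E2 D2 P2 G Y Z q1 q2.
move: (A *m u - b) (A *m s - b) (z - u) (z - s) (z - xb z) => p q r t w.
rewrite !(dotpDl, dotpNl, dotpZl); lra.
Qed.

(** The strong convexity of K at x is added to the growth of the proximal problem tested at x; the
    values of K cancel. *)
Lemma gradK_uhat x y z (u := uhat x y z) : X x ->
  dotp (u - x) (gradK x y z) <= - (lam + gam) * dotp (x - u) (x - u).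
Proof.
move=> Xx; have := gradK_lower x y z u; have := Efun_lower x y z Xx.
rewrite /Efun /Ephi -/u !enorm_sqr subrr dotp0l dotpC.
have -> : dotp (u - x) (u - x) = dotp (x - u) (x - u).
  by rewrite -(opprB x u) dotpNl dotpNr opprK.
by move: (K x y z) (K u y z) (dotp (u - x) (gradK x y z)) (dotp (x - u) (x - u)) => ? ? ? ?; lra.
Qed.

(** The growth inequalities of the two problems, each tested at the minimizer of the other, add up
    to gam |u - s|^2 <= lam <x - u, u - s>. *)
Lemma uhat_xstar x y z (u := uhat x y z) (s := xs y z) :
  gam ^+ 2 * dotp (u - s) (u - s) <= lam ^+ 2 * dotp (x - u) (x - u).
Proof.
have [Xu _] := uhatP x y z; have [Xs _] := xstarP y z.
move: (Efun_lower x y z Xs) (dfun_lower y z Xu).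
rewrite dfunE /Efun /Ephi /u /s {Xu Xs u s}.
move: (uhat x y z) (xs y z) => u s; rewrite !enorm_sqr.
have -> : s - x = - ((x - u) + (u - s)) by rewrite addrA subrK opprB.
rewrite -(opprB u s) -(opprB x u).
move: (x - u) (u - s) (K u y z) (K s y z) => v e k k' h2 h1.
have h : gam * dotp e e <= lam * dotp v e.
  by move: h2; rewrite !(dotpDl, dotpDr, dotpNl, dotpNr) (dotpC e v); lra.
have := dotp_ge0 (gam *: e - lam *: v); have := ler_wpM2l (ltW gam0) h.
by rewrite !dotpE (dotpC v e); lra.
Qed.

(** These are the first-order changes of V with the dual increment replaced by its mean eta (A x -
    b) and the sampled gradient by [gradK] at the old y. The substitutions in the proof bring them
    into the variables of [drift_algebra]. *)
Lemma drift tau eta beta sbar x y z (u := uhat x y z) (s := xs y z) :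
  X x -> 2 <= mu -> 3 / 4 * mu <= gam -> mu <= lam ->
  0 <= tau -> 0 <= eta -> 0 <= beta -> eta * nA ^+ 2 <= tau / 200 ->
  beta <= tau / 100 -> beta * (36 * mu * sbar ^+ 2) <= eta ->
  dotp (s - xb z) (s - xb z) <= sbar ^+ 2 * dotp (A *m s - b) (A *m s - b) ->
  eta * dotp (A *m u - b - 2 *: (A *m s - b)) (A *m x - b)
  + mu * (beta * dotp (z - u - 2 *: (z - s) + 2 *: (z - xb z)) (x - z))
  + lam * tau * dotp (u - x) (gradK x y z)
  <= - (mu * beta / 2 * dotp (z - xb z) (z - xb z)).
Proof.
move=> Xx mu2 gmu mul t0 e0 be0 eA bt be.
move: (gradK_uhat y z Xx) (uhat_xstar x y z).
rewrite /u /s {u s}; move: (uhat x y z) (xs y z) (xb z) (gradK x y z) => u s w0 gK hg hs hq.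
have -> : z - u - 2 *: (z - s) + 2 *: (z - w0) = (z - w0) + (s - w0) - (u - s).
  by apply/matrixP => i j; rewrite !mxE; ring.
have -> : x - z = (x - u) + (u - s) + (s - w0) - (z - w0).
  by apply/matrixP => i j; rewrite !mxE; ring.
have -> : A *m u - b - 2 *: (A *m s - b) = A *m (u - s) - (A *m s - b).
  by rewrite mulmxBr; move: (A *m u) (A *m s) => p q; apply/matrixP => i j; rewrite !mxE; ring.
have -> : A *m x - b = (A *m s - b) + A *m (u - s) + A *m (x - u).
  rewrite !mulmxBr; move: (A *m u) (A *m s) (A *m x) => p q k.
  by apply/matrixP => i j; rewrite !mxE; ring.
have := drift_algebra (z - w0) mu2 gmu mul t0 e0 be0 eA bt be hq hs (dotp_mulmx A (x - u)) (dotp_mulmx A (u - s)).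
have := ler_wpM2l (mulr_ge0 (ltW lam0) t0) hg.
move: (dotp (u - x) gK) (dotp (x - u) (x - u)) => ? ?.
move: (dotp (A *m (u - s) - _) _) (dotp (z - w0 + _ - _) _) (dotp (z - w0) _) => ? ? ?.
lra.
Qed.
End Potential.

(** * The constants M and M_V, the gain of a reset, and the projected step *)

Section PotentialBounds.
Variables (R : realType) (m n : nat).
Variables (f : 'cV[R]_n -> R) (A : 'M[R]_(m, n)) (b : 'cV[R]_m).
Variables (X : set 'cV[R]_n) (rho mu Lf lam : R).
Hypotheses (sf : smooth Lf f) (cX : convex_set X) (kX : compact X).
Hypothesis (F0 : feasible A b X !=set0).
Hypotheses (rho0 : 0 <= rho) (mu0 : 0 < mu) (lam0 : 0 < lam) (gam0 : 0 < mu - Lf).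
Implicit Types (x z u : 'cV[R]_n) (y : 'cV[R]_m).

Local Notation K := (Kfun f A b rho mu).
Local Notation d := (dfun f A b X rho mu).
Local Notation xs := (xstar f A b X rho mu).
Local Notation xb := (xbar f A b X mu).
Local Notation PsiX := (Psi f A b X mu).
Local Notation V := (Vfun f A b X rho mu lam).
Local Notation uh := (uhat f A b X rho mu lam).
Local Notation nA := (opnorm A).
Local Notation gam := (mu - Lf).
Local Notation M := (Mconst f A b X rho mu).
Local Notation MV := (MVconst f A b X rho mu).

Let VU := Vfun_upper lam sf cX kX F0 rho0 gam0.
Let uhatX x y z : X (uh x y z) := (uhatP rho mu lam sf kX F0 x y z).1.
Let xstarX y z : X (xs y z) := (xstarP rho mu sf kX F0 y z).1.
Let xbarX z : X (xb z) := xbar_X mu sf kX F0 z.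

Lemma Mconst_ub x z : X x -> X z ->
  `|f x| + mu / 2 * enorm (x - z) ^+ 2 + rho / 2 * enorm (A *m x - b) ^+ 2 <= M.
Proof.
move=> Xx Xz; apply: ub_le_sup; last by exists (x, z).
have [B _ hB] := compact_enorm_bounded kX.
have [c _ hc] : exists2 c, c \in X & forall t, t \in X -> `|f t| <= `|f c|.
  apply: (@compact_EVT_max _ _ (fun t => `|f t|) X (X_nonempty F0) kX).
  apply: continuous_subspaceT => t.
  by apply: continuous_comp; [exact: smooth_continuous sf _|exact: norm_continuous].
exists (`|f c| + mu / 2 * (2 * B) ^+ 2 + rho / 2 * (nA * B + enorm b) ^+ 2).
move=> _ [[u w] /= [Xu Xw] <-]; apply: lerD; first apply: lerD.
- by apply: hc; rewrite inE.
- have m20 : 0 <= mu / 2 by rewrite divr_ge0// ltW.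
  rewrite (ler_wpM2l m20)// ler_pXn2r ?nnegrE ?enorm_ge0//; last first.
    by rewrite mulr_ge0// (le_trans (enorm_ge0 u))// hB.
  by rewrite (le_trans (enormD _ _))// enormN mulr2n mulrDl !mul1r lerD// hB.
- have h : enorm (A *m u - b) <= nA * B + enorm b.
    rewrite (le_trans (enormD _ _))// enormN lerD2r (le_trans (enorm_mulmx _ _))//.
    by rewrite ler_wpM2l ?opnorm_ge0// hB.
  rewrite ler_wpM2l ?divr_ge0// ler_pXn2r ?nnegrE ?enorm_ge0//.
  exact: le_trans (enorm_ge0 _) h.
Qed.

Let rho2 x : 0 <= rho / 2 * enorm (A *m x - b) ^+ 2.
Proof. by rewrite mulr_ge0 ?sqr_ge0// divr_ge0. Qed.

Let mu2 x z : 0 <= mu / 2 * enorm (x - z) ^+ 2.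
Proof. by rewrite mulr_ge0 ?sqr_ge0// divr_ge0// ltW. Qed.

Lemma Psi_ge x z : X x -> - M <= PsiX z.
Proof.
move=> Xx; rewrite (PsiE mu sf kX F0).
have := Mconst_ub (xbarX z) Xx; have := mu2 (xb z) z; have := mu2 (xb z) x; have := rho2 (xb z).
by have := ler_norm (- f (xb z)); rewrite normrN; lra.
Qed.

Lemma MVconst_ub x z : X x -> X z -> K x 0 z - 2 * d 0 z + 2 * PsiX z <= MV.
Proof.
move=> Xx Xz; apply: ub_le_sup; last by exists (x, z).
(* K contributes at most M, and -2 d and 2 Psi at most 2 M each. *)
exists (5 * M) => _ [[u w] /= [Xu Xw] <-].
have hK v : Kfun f A b rho mu v 0 w = f v + mu / 2 * enorm (v - w) ^+ 2 + rho / 2 * enorm (A *m v - b) ^+ 2.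
  by rewrite /Kfun /Lrho dotp0r; ring.
have k1 : Kfun f A b rho mu u 0 w <= M.
  by rewrite hK; have := Mconst_ub Xu Xw; have := ler_norm (f u); lra.
have k2 : - M <= d 0 w.
  rewrite (dfunE rho mu sf kX F0) hK; set s := xs 0 w.
  have := Mconst_ub (xstarX 0 w) Xw; have := mu2 s w; have := rho2 s.
  by have := ler_norm (- f s); rewrite normrN -/s; lra.
have k3 : PsiX w <= M.
  rewrite (PsiE mu sf kX F0).
  have := Mconst_ub (xbarX w) Xw; have := rho2 (xb w).
  by have := ler_norm (f (xb w)); lra.
lra.
Qed.

(** The minimum is tested at a point of X whose residual has length r and direction -y, where the
    multiplier term equals -r |y|. The case y = 0 is separate, as it provides no direction. *)
Lemma dfun_reach r y z : row_free A -> 0 < r -> reach_radius A b X r -> X z ->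
  d y z <= M - r * enorm y.
Proof.
move=> rA r0 hr Xz.
have [y0|y0] := eqVneq y 0.
  have [x Xx] := X_nonempty F0.
  have [_ /(_ _ Xx)] := xstarP rho mu sf kX F0 y z.
  rewrite (dfunE rho mu sf kX F0) y0 enorm0 mulr0 subr0 => /le_trans; apply.
  rewrite /Kfun /Lrho dotp0r; have := Mconst_ub Xx Xz; have := ler_norm (f x); lra.
(* Full row rank puts -y in the range of A. *)
have Av : A *m (pinvmx A *m - y) = - y by rewrite mulmxA mulmxVp// mul1mx.
have [x [Xx nx [c c0 hc]]] : exists x, [/\ X x, enorm (A *m x - b) = r
    & exists2 c : R, 0 < c & A *m x - b = c *: - y].
  by have := hr (pinvmx A *m - y); rewrite Av oppr_eq0; exact.
have [_ /(_ _ Xx)] := xstarP rho mu sf kX F0 y z.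
rewrite (dfunE rho mu sf kX F0) => /le_trans; apply.
have -> : r * enorm y = - dotp (A *m x - b) y.
  rewrite -nx hc enormZ enormN (gtr0_norm c0) dotpZl dotpNl -enorm_sqr; ring.
rewrite /Kfun /Lrho; have := Mconst_ub Xx Xz; have := ler_norm (f x); lra.
Qed.

(** E >= d gives V(x,y,z) >= 2 Psi - d(y,z) >= 2 Psi + r |y| - M, and one copy of Psi is bounded
    below by M_Psi, the other by -M. At y = 0, V is at most M_V because E <= K. *)
Lemma Vfun_reset r MPsi x y z : row_free A -> 0 < r -> reach_radius A b X r ->
  MPsi <= PsiX z -> X x -> X z ->
  V x 0 z + (r * enorm y - (MV - MPsi + 2 * M)) <= V x y z.
Proof.
move=> rA r0 hr hM Xx Xz.
have := dfun_reach y rA r0 hr Xz; have := Psi_ge z Xx.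
have := MVconst_ub Xx Xz; have := Efun_le_K rho mu lam sf kX F0 0 z Xx.
have := dfun_le_Efun rho mu sf kX F0 lam0 x y z.
rewrite /Vfun; move: (Efun f A b X rho mu lam x y z) (Efun f A b X rho mu lam x 0 z).
move: (d y z) (d 0 z) (K x 0 z) (PsiX z) hM => D D0 K0 P hM E E0; lra.
Qed.

(** The new x enters the bound only through its distance to the proximal point, and projecting onto
    X cannot increase a distance to a point of X. *)
Lemma step_upper x y z y2 tau beta (G : 'cV[R]_n) (u := uh x y z) (s := xs y z) : 0 <= tau ->
  V (proj X (x - tau *: G)) y2 (z + beta *: (x - z)) <= V x y z
   + dotp (A *m u - b - 2 *: (A *m s - b)) (y2 - y)
   + mu * (beta * dotp (z - u - 2 *: (z - s) + 2 *: (z - xb z)) (x - z))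
   + lam * tau * dotp (u - x) G + lam * tau ^+ 2 / 2 * dotp G G
   + 2 * gam^-1 * nA ^+ 2 * dotp (y2 - y) (y2 - y)
   + (mu / 2 + 2 * gam^-1 * mu ^+ 2) * (beta ^+ 2 * dotp (x - z) (x - z)).
Proof.
move=> t0; have := VU x y z (proj X (x - tau *: G)) y2 (z + beta *: (x - z)).
have := proj_pythagoras (x - tau *: G) cX (X_nonempty F0) kX (uhatX x y z).
rewrite /u /s {u s}; move: (uh x y z) (xs y z) (xb z) => u s w.
have -> : z + beta *: (x - z) - z = beta *: (x - z) by rewrite addrC addKr.
have -> : u - (x - tau *: G) = (u - x) + tau *: G by rewrite opprB addrA addrAC.
move: (proj _ _) => p hp; rewrite !(dotpZl _ (x - z)) !(dotpZr _ (x - z)).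
have : lam / 2 * (dotp (u - p) (u - p) - dotp (u - x) (u - x)) <=
    lam * tau * dotp (u - x) G + lam * tau ^+ 2 / 2 * dotp G G.
  have l0 : 0 <= lam / 2 by rewrite divr_ge0// ltW.
  have := ler_wpM2l l0 hp; move: (u - x) (u - p) => k l.
  rewrite !(dotpDl, dotpDr, dotpZl, dotpZr) (dotpC G k); lra.
move: (V _ _ _) (V _ _ _) gam^-1 (dotp (y2 - y) (y2 - y)) (dotp _ (y2 - y)).
move: (dotp (z - u - _ + _) _) (dotp (u - p) _) (dotp (x - z) _) (dotp (u - x) (u - x)) (dotp (u - x) G) (dotp G G).
move=> ? ? ? ? ? ? ? ? ? ? ?; lra.
Qed.

End PotentialBounds.

(** * One step for frozen samples *)

Section DualStep.
Variables (R : realType) (m n : nat).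
Variables (f : 'cV[R]_n -> R) (A : 'M[R]_(m, n)) (b : 'cV[R]_m).
Variables (X : set 'cV[R]_n) (rho mu Lf lam : R).
Hypotheses (sf : smooth Lf f) (cX : convex_set X) (kX : compact X).
Hypothesis (F0 : feasible A b X !=set0).
Hypotheses (rho0 : 0 <= rho) (mu2 : 2 <= mu) (lam0 : 0 < lam) (gam0 : 0 < mu - Lf).
Implicit Types (x z u : 'cV[R]_n) (y g : 'cV[R]_m) (tau eta beta : R).

Local Notation xs := (xstar f A b X rho mu).
Local Notation xb := (xbar f A b X mu).
Local Notation PsiX := (Psi f A b X mu).
Local Notation V := (Vfun f A b X rho mu lam).
Local Notation uh := (uhat f A b X rho mu lam).
Local Notation nA := (opnorm A).
Local Notation gam := (mu - Lf).
Local Notation M := (Mconst f A b X rho mu).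
Local Notation MV := (MVconst f A b X rho mu).

Let uhatX x y z : X (uh x y z) := (uhatP rho mu lam sf kX F0 x y z).1.
Let xstarX y z : X (xs y z) := (xstarP rho mu sf kX F0 y z).1.
Let xbarX z : X (xb z) := xbar_X mu sf kX F0 z.

Let mu0 : 0 < mu. Proof. by apply: lt_le_trans mu2. Qed.

(** The coefficient of the dual increment in the first-order change of V: one residual from E, minus
    twice the residual from d. *)
Definition dual_dir x y z : 'cV[R]_m :=
  (A *m uh x y z - b) - 2 *: (A *m xs y z - b).

(* Everything in the bound of [step_upper] that does not involve the sampled gradient. *)
Definition step_base x y z y2 beta : R :=
  V x y z + dotp (dual_dir x y z) (y2 - y)
  + mu * (beta * dotp (z - uh x y z - 2 *: (z - xs y z) + 2 *: (z - xb z)) (x - z))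
  + 2 * gam^-1 * nA ^+ 2 * dotp (y2 - y) (y2 - y)
  + (mu / 2 + 2 * gam^-1 * mu ^+ 2) * (beta ^+ 2 * dotp (x - z) (x - z)).

Lemma step_base_upper x y z y2 tau beta (G : 'cV[R]_n) : 0 <= tau ->
  V (proj X (x - tau *: G)) y2 (z + beta *: (x - z)) <=
  step_base x y z y2 beta + lam * tau * dotp (uh x y z - x) G + lam * tau ^+ 2 / 2 * dotp G G.
Proof.
move=> t0; have := step_upper sf cX kX F0 rho0 lam0 gam0 x y z y2 beta G t0.
rewrite /step_base /dual_dir; move/le_trans; apply.
by rewrite le_eqVlt; apply/orP; left; apply/eqP; ring.
Qed.

Variables (D2 D3 BG ce sbar : R).
Hypothesis hD2 : forall u v : 'cV[R]_n, X u -> X v -> dotp (u - v) (u - v) <= D2.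
Hypothesis hD3 : forall u : 'cV[R]_n, X u -> dotp (A *m u - b) (A *m u - b) <= D3.
Hypotheses (BG0 : 0 <= BG) (gmu : 3 / 4 * mu <= gam) (mul : mu <= lam).
Hypothesis heb : error_bound f A b X rho mu sbar.

(** Here tau, eta and beta stay free, subject only to these consequences of the step-size formulas;
    the constant [ce] controls the ratio of eta to tau. *)
Definition step_params tau eta beta : Prop :=
  [/\ 0 <= tau, 0 <= eta, 0 <= beta & eta <= ce * tau] /\
  [/\ eta * nA ^+ 2 <= tau / 200, beta <= tau / 100
    & beta * (36 * mu * sbar ^+ 2) <= eta].

(** In order: moving the gradient to the new dual variable, the second moment of the sampled
    gradient, and the second-order terms of V in the dual variable and in the centre. *)
Definition step_const : R := lam * ce * (nA ^+ 2 * D2 + 1) / 2 + lam * BG / 2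
  + 2 * gam^-1 * nA ^+ 2 * ce ^+ 2 + (mu / 2 + 2 * gam^-1 * mu ^+ 2) * D2.

(** The common majorant of both branches of the dual step. The noise g - (A x - b) appears linearly
    with a coefficient fixed by the old state, so its mean vanishes. *)
Definition step_target x y z g tau eta beta : R :=
  V x y z + eta * dotp (dual_dir x y z) (g - (A *m x - b))
  - mu * beta / 2 * dotp (z - xb z) (z - xb z)
  + step_const * (tau ^+ 2 * (1 + dotp g g)).

(* A reset lowers the potential by a fixed amount; this threshold times tau is
   the increase it has to outweigh. *)
Definition reset_threshold : R := 6 * ce * D3 + mu * D2 / 10.

Lemma gradK_shift x y z y' : gradK f A b rho mu x (y + y') z = gradK f A b rho mu x y z + A^T *m y'.
Proof.
rewrite /gradK (mulmxDr _ y); move: (grad f x) (A^T *m y) (A^T *m y') (rho *: _) (mu *: _) => p q r s t.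
by apply/matrixP => i j; rewrite !mxE; ring.
Qed.

(** [drift] treats the mean terms with the gradient at y; the residual splits into its mean and the
    noise kept in the target. Moving the gradient to y + eta g changes it by eta A^T g, which is
    multiplied by tau and so is of second order. *)
Lemma no_reset_bound x y z g tau eta beta : X x -> X z -> step_params tau eta beta ->
  step_base x y z (y + eta *: g) beta
  + lam * tau * dotp (uh x y z - x) (gradK f A b rho mu x (y + eta *: g) z)
  + lam * tau ^+ 2 / 2 * BG <= step_target x y z g tau eta beta.
Proof.
move=> Xx Xz [[t0 e0 b0 ec] [eA bt be]].
have D20 : 0 <= D2 by have := hD2 Xx Xx; rewrite subrr dotp0l.
have hq : dotp (xs y z - xb z) (xs y z - xb z) <=
    sbar ^+ 2 * dotp (A *m xs y z - b) (A *m xs y z - b).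
  have h := heb y z; rewrite -!enorm_sqr -exprMn.
  by rewrite ler_pXn2r ?nnegrE ?enorm_ge0// (le_trans (enorm_ge0 _) h).
have := drift sf cX kX F0 rho0 lam0 gam0 Xx mu2 gmu mul t0 e0 b0 eA bt be hq; cbv zeta.
have dxz := hD2 Xx Xz; have dxz0 := dotp_ge0 (x - z).
rewrite /step_base /step_target /dual_dir gradK_shift.
have -> : y + eta *: g - y = eta *: g by rewrite addrC addKr.
have hu : 2 * dotp (uh x y z - x) (A^T *m (eta *: g)) <= eta * (nA ^+ 2 * D2 + dotp g g).
  rewrite -scalemxAr dotpZr mulrCA ler_wpM2l// dotpC dotp_trmx dotpC.
  apply: (le_trans (dotp_young1 _ _)); rewrite lerD2r.
  apply: (le_trans (dotp_mulmx _ _)); rewrite ler_wpM2l ?sqr_ge0//; exact: hD2.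
have c20 : 0 <= mu / 2 + 2 * gam^-1 * mu ^+ 2.
  by rewrite addr_ge0 ?mulr_ge0 ?invr_ge0 ?sqr_ge0// ltW.
have c10 : 0 <= 2 * gam^-1 * nA ^+ 2 by rewrite mulr_ge0 ?sqr_ge0// mulr_ge0// invr_ge0 ltW.
have g0 := dotp_ge0 g.
rewrite /step_const; move: (nA ^+ 2 * D2) (mulr_ge0 (sqr_ge0 nA) D20) hu => N N0 hu.
move: c20 c10; move: (_ + 2 * gam^-1 * mu ^+ 2) (2 * gam^-1 * nA ^+ 2) => c2 c1 c20 c10.
rewrite (dotpDr (gradK f A b rho mu x y z)) (dotpDr g) dotpNr !(dotpZr eta) !(dotpZl eta).
set Q := dotp (uh x y z - x) (A^T *m (eta *: g)) in hu *.
set gK := dotp (uh x y z - x) (gradK _ _ _ _ _ _ _ _); clearbody Q gK.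
move: (V x y z) (dotp (_ - _ - _) (A *m x - b)) (dotp (_ - _ - _) g) => v a2 a1.
move: (dotp (_ - _ + _) (x - z)) (dotp (x - z) _) dxz dxz0 => T dx dx1 dx0.
move: (dotp (z - _) _) (dotp g g) g0 hu => w gg g0 hu hd.
have lt0 : 0 <= lam * tau by rewrite mulr_ge0// ltW.
have s1 : lam * tau * Q <= lam * ce * (N + 1) / 2 * (tau ^+ 2 * (1 + gg)).
  have : lam * tau * (2 * Q) <= lam * tau * (ce * tau * ((N + 1) * (1 + gg))).
    apply: ler_wpM2l => //; apply: (le_trans hu); apply: ler_pM => //; first by rewrite addr_ge0.
    by have := mulr_ge0 N0 g0; lra.
  by lra.
have ce2 : eta ^+ 2 <= ce ^+ 2 * tau ^+ 2 by rewrite -exprMn ler_pXn2r ?nnegrE// (le_trans e0).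
have s2 : c1 * (eta * (eta * gg)) <= c1 * ce ^+ 2 * (tau ^+ 2 * (1 + gg)).
  have : c1 * (eta ^+ 2 * gg) <= c1 * (ce ^+ 2 * tau ^+ 2 * (1 + gg)).
    by rewrite ler_wpM2l// ler_pM ?sqr_ge0//; lra.
  by lra.
have s3 : c2 * (beta ^+ 2 * dx) <= c2 * D2 * (tau ^+ 2 * (1 + gg)).
  have : c2 * (beta ^+ 2 * dx) <= c2 * (tau ^+ 2 * (D2 * (1 + gg))).
    rewrite ler_wpM2l// ler_pM ?sqr_ge0// ?ler_pXn2r ?nnegrE//; first by lra.
    by have := mulr_ge0 D20 g0; lra.
  by lra.
have s4 : lam * tau ^+ 2 / 2 * BG <= lam * BG / 2 * (tau ^+ 2 * (1 + gg)).
  by have := mulr_ge0 (mulr_ge0 (mulr_ge0 (ltW lam0) BG0) (sqr_ge0 tau)) g0; lra.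
lra.
Qed.

(** The step starts from (x, 0, z), where the dual variable does not move and the gradient term is
    nonpositive. [Vfun_reset], applied at the discarded value y + eta g, whose norm is at least M_y,
    relates V(x, 0, z) to V there; [Vfun_upper] then leads back to y and brings in exactly the
    linear term of the target. *)
Lemma reset_bound x y z g tau eta beta r MPsi My : X x -> X z -> step_params tau eta beta ->
  row_free A -> 0 < r -> reach_radius A b X r -> MPsi <= PsiX z ->
  reset_threshold * tau <= r * My - (MV - MPsi + 2 * M) ->
  My <= enorm (y + eta *: g) ->
  step_base x 0 z 0 beta + lam * tau * dotp (uh x 0 z - x) (gradK f A b rho mu x 0 z)
  + lam * tau ^+ 2 / 2 * BG <= step_target x y z g tau eta beta.
Proof.
move=> Xx Xz [[t0 e0 b0 ec] [eA bt be]] rA r0 hr hM hth hy.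
have D20 : 0 <= D2 by have := hD2 Xx Xx; rewrite subrr dotp0l.
have D30 : 0 <= D3 := le_trans (dotp_ge0 _) (hD3 Xx).
have hg : dotp (uh x 0 z - x) (gradK f A b rho mu x 0 z) <= 0.
  apply: (le_trans (gradK_uhat mu lam sf cX kX F0 rho0 0 z Xx)).
  by rewrite mulNr oppr_le0 mulr_ge0 ?dotp_ge0// addr_ge0// ltW.
have hV := Vfun_reset sf kX F0 rho0 mu0 lam0 (y + eta *: g) rA r0 hr hM Xx Xz.
have hu := Vfun_upper lam sf cX kX F0 rho0 gam0 x y z x (y + eta *: g) z; cbv zeta in hu.
have e1 : y + eta *: g - y = eta *: g by rewrite addrC addKr.
rewrite e1 !subrr !mulr0 !dotp0r !mulr0 !addr0 in hu.
have hT : dotp (z - uh x 0 z - 2 *: (z - xs 0 z) + 2 *: (z - xb z)) (x - z) <= 6 * D2.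
  have -> : z - uh x 0 z - 2 *: (z - xs 0 z) + 2 *: (z - xb z) = (z - uh x 0 z) + 2 *: (xs 0 z - xb z).
    by apply/matrixP => i j; rewrite !mxE; ring.
  have := hD2 Xz (uhatX x 0 z); have := hD2 (xstarX 0 z) (xbarX z); have := hD2 Xx Xz.
  move: (x - z) (z - uh x 0 z) (xs 0 z - xb z) => p q k h1 h2 h3.
  have := dotp_young1 (q + 2 *: k) p; have := dotp_sqrD q (2 *: k).
  by rewrite !dotpE; lra.
have hc : dotp (dual_dir x y z) (A *m x - b) <= 6 * D3.
  rewrite /dual_dir; have := hD3 Xx; have := hD3 (uhatX x y z); have := hD3 (xstarX y z).
  move: (A *m x - b) (A *m uh x y z - b) (A *m xs y z - b) => p q k h1 h2 h3.
  have := dotp_young1 (q - 2 *: k) p; have := dotp_sqrD q (- (2 *: k)).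
  by rewrite !dotpE; lra.
have hw := hD2 Xz (xbarX z); have w0 := dotp_ge0 (z - xb z).
have dxz := hD2 Xx Xz; have dxz0 := dotp_ge0 (x - z).
rewrite /step_base /step_target /step_const subrr !dotp0r !mulr0 !addr0.
rewrite (dotpDr g) dotpNr.
have c20 : 0 <= mu / 2 + 2 * gam^-1 * mu ^+ 2.
  by rewrite addr_ge0 ?mulr_ge0 ?invr_ge0 ?sqr_ge0// ltW.
have c10 : 0 <= 2 * gam^-1 * nA ^+ 2 by rewrite mulr_ge0 ?sqr_ge0// mulr_ge0// invr_ge0 ltW.
have g0 := dotp_ge0 g; have N0 := mulr_ge0 (sqr_ge0 nA) D20.
rewrite -/(dual_dir x y z) !(dotpZr eta) !(dotpZl eta) in hu.
move: (_ + 2 * gam^-1 * mu ^+ 2) (2 * gam^-1 * nA ^+ 2) c20 c10 hu => c2 c1 c20 c10.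
move: hV hy; move: (V x y z) (V x 0 z) (V x _ z) (nA ^+ 2 * D2) N0 => v v0 v1 N N0.
move: (enorm _) => ny hV hy; move: (dotp (dual_dir x y z) (A *m x - b)) (dotp (dual_dir x y z) g) hc => a2 a1 hc hu.
move: (dotp (_ - _ + _) (x - z)) (dotp (x - z) _) dxz dxz0 hT => T dx dx1 dx0 hT.
move: (dotp (z - _) _) (dotp g g) hw w0 g0 hu => w gg hw w0 g0 hu.
move: (dotp (uh x 0 z - x) _) hg => gK hg.
have lt0 : 0 <= lam * tau by rewrite mulr_ge0// ltW.
have s0 : lam * tau * gK <= 0 by rewrite mulr_ge0_le0.
have s1 : 0 <= lam * ce * (N + 1) / 2 * (tau ^+ 2 * (1 + gg)).
  have h ct : 0 <= ct -> 0 <= lam * ct * tau * (N + 1) * (1 + gg).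
    by move=> ct0; rewrite !mulr_ge0 ?addr_ge0// ltW.
  by have := h _ (le_trans e0 ec); lra.
have ce2 : eta ^+ 2 <= ce ^+ 2 * tau ^+ 2 by rewrite -exprMn ler_pXn2r ?nnegrE// (le_trans e0).
have s2 : c1 * (eta * (eta * gg)) <= c1 * ce ^+ 2 * (tau ^+ 2 * (1 + gg)).
  have : c1 * (eta ^+ 2 * gg) <= c1 * (ce ^+ 2 * tau ^+ 2 * (1 + gg)).
    by rewrite ler_wpM2l// ler_pM ?sqr_ge0//; lra.
  by lra.
have s3 : c2 * (beta ^+ 2 * dx) <= c2 * D2 * (tau ^+ 2 * (1 + gg)).
  have : c2 * (beta ^+ 2 * dx) <= c2 * (tau ^+ 2 * (D2 * (1 + gg))).
    rewrite ler_wpM2l// ler_pM ?sqr_ge0// ?ler_pXn2r ?nnegrE//; first by lra.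
    by have := mulr_ge0 D20 g0; lra.
  by lra.
have s4 : lam * tau ^+ 2 / 2 * BG <= lam * BG / 2 * (tau ^+ 2 * (1 + gg)).
  by have := mulr_ge0 (mulr_ge0 (mulr_ge0 (ltW lam0) BG0) (sqr_ge0 tau)) g0; lra.
(* The three bounds [s5] to [s7] collect what a reset has to pay for at first order in tau; 6/100 +
   1/200 fits into the 1/10 of [reset_threshold]. *)
have s5 : mu * (beta * T) <= 6 / 100 * (mu * (tau * D2)).
  have h1 : beta * T <= beta * (6 * D2) by rewrite ler_wpM2l.
  have h2 : beta * (6 * D2) <= tau / 100 * (6 * D2) by rewrite ler_wpM2r// mulr_ge0.
  by have := ler_wpM2l (ltW mu0) (le_trans h1 h2); lra.
have s6 : eta * a2 <= 6 * ce * D3 * tau.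
  have : eta * a2 <= eta * (6 * D3) by rewrite ler_wpM2l.
  have : eta * (6 * D3) <= ce * tau * (6 * D3) by rewrite ler_wpM2r// mulr_ge0.
  by lra.
have s7 : mu * beta / 2 * w <= 1 / 200 * (mu * (tau * D2)).
  have : beta * w <= tau / 100 * D2 by rewrite ler_pM.
  by move/(ler_wpM2l (ltW mu0)); lra.
have s8 := mulr_ge0 (ltW mu0) (mulr_ge0 t0 D20).
have s9 : r * My <= r * ny by rewrite ler_wpM2l// ltW.
by rewrite /reset_threshold in hth; lra.
Qed.

End DualStep.

(** * Measurability of vector-valued maps *)

Section MeasurableMatrices.
Variables (R : realType) (d : measure_display) (Om : measurableType d).

Definition mxmeas m n (U : Om -> 'M[R]_(m, n)) : Prop :=
  forall i j, measurable_fun [set: Om] (fun w => U w i j).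

Lemma mxmeas_cst m n (U : 'M[R]_(m, n)) : mxmeas (fun=> U).
Proof. by move=> i j; exact: measurable_cst. Qed.

Lemma mxmeasD m n (U W : Om -> 'M[R]_(m, n)) :
  mxmeas U -> mxmeas W -> mxmeas (fun w => U w + W w).
Proof.
move=> hU hW i j; under eq_fun do rewrite mxE.
exact: measurable_funD (hU i j) (hW i j).
Qed.

Lemma mxmeasZ m n (c : R) (U : Om -> 'M[R]_(m, n)) : mxmeas U -> mxmeas (fun w => c *: U w).
Proof.
move=> hU i j; under eq_fun do rewrite mxE.
exact: measurable_funM (measurable_cst _) (hU i j).
Qed.

Lemma mxmeasB m n (U W : Om -> 'M[R]_(m, n)) :
  mxmeas U -> mxmeas W -> mxmeas (fun w => U w - W w).
Proof.
move=> hU hW i j; under eq_fun do rewrite !mxE.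
exact: measurable_funB (hU i j) (hW i j).
Qed.

Lemma mxmeasM m n p (U : Om -> 'M[R]_(m, n)) (W : Om -> 'M[R]_(n, p)) :
  mxmeas U -> mxmeas W -> mxmeas (fun w => U w *m W w).
Proof.
move=> hU hW i j; under eq_fun do rewrite mxE.
by apply: measurable_sum => k; exact: measurable_funM (hU i k) (hW k j).
Qed.

Lemma mxmeas_tr m n (U : Om -> 'M[R]_(m, n)) : mxmeas U -> mxmeas (fun w => (U w)^T).
Proof. by move=> hU i j; under eq_fun do rewrite mxE; exact: hU. Qed.

Lemma measurable_dotp n (u v : Om -> 'cV[R]_n) : mxmeas u -> mxmeas v ->
  measurable_fun [set: Om] (fun w => dotp (u w) (v w)).
Proof.
by move=> hu hv; apply: measurable_sum => k; exact: measurable_funM (hu k 0) (hv k 0).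
Qed.

Lemma mxmeas_if m n (c : Om -> bool) (U W : Om -> 'M[R]_(m, n)) :
  measurable_fun [set: Om] c -> mxmeas U -> mxmeas W ->
  mxmeas (fun w => if c w then U w else W w).
Proof.
move=> hc hU hW i j.
have -> : (fun w => (if c w then U w else W w) i j) = (fun w => if c w then U w i j else W w i j).
  by apply/funext => w; case: ifP.
exact: measurable_fun_ifT.
Qed.

(* A Caratheodory function is the pointwise limit of its compositions with
   dyadic-type roundings of the vector argument, which take countably many values. *)
Lemma measurable_caratheodory n (u : Om -> 'cV[R]_n) (psi : 'cV[R]_n -> Om -> R) :
  mxmeas u -> (forall x, measurable_fun [set: Om] (psi x)) ->
  (forall w, continuous (psi ^~ w)) -> measurable_fun [set: Om] (fun w => psi (u w) w).
Proof.
move=> hu mpsi cpsi.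
pose a (k : nat) w : 'cV[int]_n := \col_i Num.floor (k.+1%:R * u w i 0).
pose q (k : nat) (c : 'cV[int]_n) : 'cV[R]_n := \col_i ((c i 0)%:~R / k.+1%:R).
apply: (@measurable_fun_cvg _ _ _ _ (fun k w => psi (q k (a k w)) w)).
- move=> k _ B mB; rewrite setTI.
  have -> : (fun w => psi (q k (a k w)) w) @^-1` B =
      \bigcup_(c in [set: 'cV[int]_n]) ((a k @^-1` [set c]) `&` (psi (q k c) @^-1` B)).
    apply/seteqP; split => [w /= Bw|w [c _ [/= <-]]//].
    by exists (a k w).
  apply: countable_bigcupT_measurable => [|c]; first exact: countableP.
  apply: measurableI; last first.
    by rewrite -[X in measurable X]setTI; exact: mpsi.
  have -> : a k @^-1` [set c] = \big[setI/setT]_(i < n)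
      ((fun w => k.+1%:R * u w i 0) @^-1` `[(c i 0)%:~R, (c i 0 + 1)%:~R[%classic).
    rewrite -bigcap_seq; apply/seteqP; split => [w /= <- i _ /=|w /= hw].
      by rewrite mxE in_itv/= floor_itv.
    apply/matrixP => i j; rewrite (ord1 j) mxE.
    have := hw i (mem_index_enum i); rewrite /= in_itv/= => /andP[h1 h2].
    by apply/eqP; rewrite floor_eq; apply/andP.
  apply: bigsetI_measurable => i _; rewrite -[X in measurable X]setTI.
  by apply: (measurable_funM (measurable_cst _) (hu i 0)) => //; exact: measurable_itv.
- move=> w _; apply: (@continuous_cvg _ _ _ _ _ _ (psi ^~ w)); first exact: cpsi.
  apply/cvgrPdist_le => e e0; near=> k.
  rewrite /Num.Def.normr/= mx_normrE; apply: bigmax_le; first exact: ltW.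
  move=> [i j] _ /=; rewrite (ord1 j) !mxE.
  have k0 : (0 : R) < k.+1%:R by rewrite ltr0n.
  have /andP[h1 h2] := floor_itv (k.+1%:R * u w i 0).
  have -> : u w i 0 - (Num.floor (k.+1%:R * u w i 0))%:~R / k.+1%:R =
      (k.+1%:R * u w i 0 - (Num.floor (k.+1%:R * u w i 0))%:~R) / k.+1%:R.
    by field; rewrite gt_eqF.
  rewrite ger0_norm ?divr_ge0 ?subr_ge0//.
  apply: (@le_trans _ _ (k.+1%:R^-1)).
    by rewrite ler_pdivrMr// mulVf ?gt_eqF// lerBlDr addrC -intrD1 ltW.
  near: k; have := @cvg_harmonic R; move/cvgr0_norm_le => /(_ _ e0).
  by apply: filterS => k; rewrite /harmonic/= ger0_norm// invr_ge0.
Unshelve. all: by end_near. Qed.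

(** The projection is nonexpansive, hence continuous. *)
Lemma mxmeas_proj n (X : set 'cV[R]_n) (u : Om -> 'cV[R]_n) :
  convex_set X -> X !=set0 -> compact X -> mxmeas u -> mxmeas (fun w => proj X (u w)).
Proof.
move=> cX X0 kX hu i j; apply: (measurable_caratheodory (psi := fun x _ => proj X x i j) hu).
  by move=> x; exact: measurable_cst.
move=> _; apply: continuous_of_bound => x; exists 1 => v; rewrite mul1r (ord1 j).
apply: (@le_trans _ _ (enorm (v - x))); last by rewrite lerDl dotp_ge0.
have -> : proj X v i 0 - proj X x i 0 = (proj X v - proj X x) i 0 by rewrite !mxE.
apply: (le_trans (coord_le_enorm _ _)); rewrite enorm_le; exact: proj_lipschitz.
Qed.

(** Along a sequence of increments the derivative becomes a countable limit, which preserves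
    measurability. *)
Lemma derivative_seq n (g : 'cV[R]_n -> R) x v : differentiable g x ->
  (fun k : nat => k.+1%:R * (g (x + k.+1%:R^-1 *: v) - g x)) @ \oo --> 'D_v g x.
Proof.
move=> /diff_derivable dg; have := dg v.
rewrite /derivable -/('D_v g x) => /cvg_ex [l hl]; rewrite /derive.
rewrite (cvg_lim _ hl)//.
have h : (fun k : nat => k.+1%:R^-1 : R) @ \oo --> (0 : R)^'.
  move=> P /= /nbhs_ballP[e /= e0 he]; have := @cvg_harmonic R.
  move/cvgr0_norm_lt => /(_ _ e0); apply: filterS => k hk; apply: he; last by rewrite /= invr_neq0.
  by rewrite /ball/= sub0r normrN.
have -> : (fun k : nat => k.+1%:R * (g (x + k.+1%:R^-1 *: v) - g x)) =
    (fun h : R => h^-1 *: ((g \o shift x) (h *: v) - g x)) \o (fun k => k.+1%:R^-1).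
  by apply/funext => k /=; rewrite invrK [_ *: v + x]addrC.
exact: cvg_comp h hl.
Qed.

(** The point and the sample are both random. Each difference quotient is measurable, as F is
    continuous in the point and measurable in the sample; the gradient is their limit. *)
Lemma mxmeas_grad n dS (S : measurableType dS) (F : 'cV[R]_n -> S -> R)
    (u : Om -> 'cV[R]_n) (Y : Om -> S) :
  (forall x, measurable_fun [set: S] (F x)) -> (forall s x, differentiable (F ^~ s) x) ->
  mxmeas u -> measurable_fun [set: Om] Y -> mxmeas (fun w => grad (F ^~ (Y w)) (u w)).
Proof.
move=> mF dF hu hY i j; under eq_fun do rewrite mxE.
apply: (@measurable_fun_cvg _ _ _ _ (fun k w => k.+1%:R *
  (F (u w + k.+1%:R^-1 *: delta_mx i 0) (Y w) - F (u w) (Y w)))); last first.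
  by move=> w _; exact: derivative_seq (dF _ _).
have mFu (U : Om -> 'cV[R]_n) : mxmeas U -> measurable_fun [set: Om] (fun w => F (U w) (Y w)).
  move=> hU; apply: (measurable_caratheodory (psi := fun x w => F x (Y w)) hU).
    by move=> x; exact: measurableT_comp (mF x) hY.
  by move=> w x; exact: differentiable_continuous (dF _ _).
move=> k; apply: measurable_funM; first exact: measurable_cst.
apply: measurable_funB; apply: mFu => //.
by apply: mxmeasD => //; exact: mxmeas_cst.
Qed.

End MeasurableMatrices.

(** * Independence and freezing *)

Section Independence.
Variables (R : realType) (d : measure_display) (Om : measurableType d).
Variables (Pr : probability Om R) (I : finType) (G : I -> set (set Om)).
Hypothesis G_measurable : forall i E, G i E -> measurable E.
Hypothesis G_setT : forall i, G i setT.

(** This single product formula says that U is independent of the families in J and that these are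
    mutually independent. It can therefore be passed on while the families are used up one at a
    time. *)
Definition indep_of dS (S : measurableType dS) (J : {set I}) (U : Om -> S) : Prop :=
  forall B (E : I -> set Om), measurable B -> (forall i, i \in J -> G i (E i)) ->
  (Pr (U @^-1` B `&` \bigcap_(i in [set` J]) E i) =
    Pr (U @^-1` B) * \prod_(i in J) Pr (E i))%E.

Lemma indep_of_cst dS (S : measurableType dS) (J : {set I}) (c : S) :
  mutually_independent Pr G -> indep_of J (fun=> c).
Proof.
move=> mi B E mB hE; rewrite preimage_cst; case: ifPn => _.
  by rewrite setTI probability_setT mul1e; exact: mi.
by rewrite set0I measure0 mul0e.
Qed.

Lemma indep_of_comp dS dT (S : measurableType dS) (T : measurableType dT)
    (J : {set I}) (U : Om -> S) (phi : S -> T) :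
  measurable_fun setT phi -> indep_of J U -> indep_of J (phi \o U).
Proof.
move=> mphi hU B E mB hE; rewrite comp_preimage; apply: hU => //.
by rewrite -[X in measurable X]setTI; exact: mphi.
Qed.

(** The sure event is chosen in every family that is dropped. *)
Lemma indep_of_subset dS (S : measurableType dS) (J J' : {set I}) (U : Om -> S) :
  J' \subset J -> indep_of J U -> indep_of J' U.
Proof.
move=> sJ hU B E mB hE; pose E' i := if i \in J' then E i else setT.
have := hU B E' mB; rewrite /E'.
have -> : \bigcap_(i in [set` J]) (if i \in J' then E i else setT) = \bigcap_(i in [set` J']) E i.
  apply/seteqP; split=> w /= h i; first by move=> iJ'; have := h i (fintype.subsetP sJ _ iJ'); rewrite iJ'.
  by move=> _; case: ifPn => // /h.
have -> : (\prod_(i in J) Pr (if i \in J' then E i else setT) = \prod_(i in J') Pr (E i))%E.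
  rewrite (bigID (mem J'))/= [X in (_ * X)%E]big1 ?mule1; last first.
    by move=> i /andP[_ /negbTE->]; exact: probability_setT.
  apply: eq_big => [i|i /andP[_ ->]//].
  by have [/(fintype.subsetP sJ)->//|] := boolP (i \in J'); rewrite andbF.
by apply=> i _; case: ifPn => // /hE.
Qed.

Lemma indep_of_pair_event dS dT (S : measurableType dS) (T : measurableType dT)
    (J : {set I}) (i : I) (U : Om -> S) (Y : Om -> T) B D (E : I -> set Om) :
  (forall D, measurable D -> G i (Y @^-1` D)) -> i \in J -> indep_of J U ->
  measurable B -> measurable D -> (forall j, j \in J :\ i -> G j (E j)) ->
  (Pr (U @^-1` B `&` Y @^-1` D `&` \bigcap_(j in [set` J :\ i]) E j) =
    Pr (U @^-1` B) * Pr (Y @^-1` D) * \prod_(j in J :\ i) Pr (E j))%E.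
Proof.
move=> hY iJ hU mB mD hE; pose E' j := if j == i then Y @^-1` D else E j.
have := hU B E' mB; rewrite (bigD1 i)//= /E' eqxx muleA.
have -> : (\prod_(j in J | j != i) Pr (if j == i then Y @^-1` D else E j) =
    \prod_(j in J :\ i) Pr (E j))%E.
  apply: eq_big => [j|j /andP[_ /negbTE->]//].
  by rewrite !inE andbC.
have -> : \bigcap_(j in [set` J]) (if j == i then Y @^-1` D else E j) =
    Y @^-1` D `&` \bigcap_(j in [set` J :\ i]) E j.
  apply/seteqP; split=> w /=.
    move=> h; split; first by have := h i iJ; rewrite eqxx.
    by move=> j /=; rewrite !inE => /andP[/negbTE ji jJ]; have := h j jJ; rewrite ji.
  by move=> [h1 h2] j jJ; case: eqVneq => // ji; apply: h2; rewrite /= !inE ji.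
rewrite -setIA; apply=> j jJ; case: eqVneq => [->|ji]; first exact: hY.
by apply: hE; rewrite !inE ji.
Qed.

Lemma indep_of_pair_law dS dT (S : measurableType dS) (T : measurableType dT)
    (J : {set I}) (i : I) (U : Om -> S) (Y : Om -> T) B D :
  (forall D, measurable D -> G i (Y @^-1` D)) -> i \in J -> indep_of J U ->
  measurable B -> measurable D ->
  (Pr (U @^-1` B `&` Y @^-1` D) = Pr (U @^-1` B) * Pr (Y @^-1` D))%E.
Proof.
move=> hY iJ hU mB mD.
have := indep_of_pair_event hY iJ hU mB mD (fun j _ => G_setT j).
rewrite (_ : \bigcap_(_ in _) setT = setT) ?setIT; last first.
  by apply/seteqP; split.
move=> ->; rewrite [X in (_ * X)%E]big1 ?mule1// => j _.
exact: probability_setT.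
Qed.

(** Once the remaining events are fixed, both sides are finite measures in B. They agree on
    rectangles, a generating family stable under intersection, and hence everywhere. *)
Lemma indep_of_pair dS dT (S : measurableType dS) (T : measurableType dT)
    (J : {set I}) (i : I) (U : Om -> S) (Y : Om -> T) :
  measurable_fun setT U -> measurable_fun setT Y ->
  (forall D, measurable D -> G i (Y @^-1` D)) -> i \in J -> indep_of J U ->
  indep_of (J :\ i) (fun w => (U w, Y w)).
Proof.
move=> mU mY hY iJ hU B E mB hE.
pose F := \bigcap_(j in [set` J :\ i]) E j.
have mF : measurable F.
  by apply: fin_bigcap_measurable => // j jJ; apply: G_measurable (hE j jJ).
pose UY : {mfun Om >-> (S * T)%type} := mfun_Sub (mem_set (measurable_fun_pair mU mY)).
have c0 : (0 <= fine (\prod_(j in J :\ i) Pr (E j))%E)%R.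
  by apply: fine_ge0; apply: prode_ge0 => j _.
have cE : ((fine (\prod_(j in J :\ i) Pr (E j))%E)%:E = \prod_(j in J :\ i) Pr (E j))%E.
  rewrite fineK//; apply: prode_fin_num => j jJ; rewrite fin_num_measure//.
  exact: G_measurable (hE j jJ).
have preimage_UY A0 B0 : (fun w => (U w, Y w)) @^-1` (A0 `*` B0) = U @^-1` A0 `&` Y @^-1` B0 by [].
pose m1 := pushforward (mrestr Pr mF) UY.
pose m2 := mscale (NngNum c0) (distribution Pr UY).
suff : m1 B = m2 B.
  rewrite /m1 /m2 /pushforward /mrestr /mscale /= => ->.
  by rewrite cE muleC.
apply: (measure_unique [set A `*` B | A in measurable & B in measurable] (fun=> setT)) => //.
- by rewrite measurable_prod_measurableType.
- move=> _ _ [A1 mA1 [B1 mB1 <-]] [A2 mA2 [B2 mB2 <-]].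
  exists (A1 `&` A2); first exact: measurableI.
  by exists (B1 `&` B2); [exact: measurableI|rewrite setXI].
- by move=> _; exists setT => //; exists setT => //; rewrite setXTT.
- by rewrite bigcup_const//; exists 0%N.
- move=> _ [A0 mA0 [B0 mB0 <-]].
  rewrite /= /distribution /pushforward /mrestr /mscale /= /pushforward cE !preimage_UY.
  rewrite (indep_of_pair_event hY iJ hU mA0 mB0 hE) muleC.
  by rewrite -(indep_of_pair_law hY iJ hU mA0 mB0).
- move=> _; apply: (@le_lt_trans _ _ 1%E); last exact: ltry.
  rewrite /= /pushforward /mrestr; apply: probability_le1.
  by apply: measurableI => //; rewrite preimage_setT.
Qed.

(** Independence makes the joint law a product measure, and Tonelli's theorem integrates Y out with
    U frozen. *)
Lemma indep_of_law dS dT (S : measurableType dS) (T : measurableType dT)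
    (J : {set I}) (i : I) (U : Om -> S) (Y : {RV Pr >-> T}) (Q : probability T R)
    (phi : S * T -> \bar R) :
  measurable_fun setT U -> (forall D, measurable D -> G i (Y @^-1` D)) -> i \in J ->
  indep_of J U -> has_law Y Q -> measurable_fun setT phi -> (forall p, 0 <= phi p)%E ->
  (\int[Pr]_w phi (U w, Y w) = \int[Pr]_w \int[Q]_s phi (U w, s))%E.
Proof.
move=> mU hY iJ hU lY mphi phi0.
pose U' : {mfun Om >-> S} := mfun_Sub (mem_set mU).
have mUY : measurable_fun setT (fun w => (U w, Y w)) by exact: measurable_fun_pair.
pose UY : {mfun Om >-> (S * T)%type} := mfun_Sub (mem_set mUY).
have -> : (\int[Pr]_w phi (U w, Y w) = \int[distribution Pr UY]_p phi p)%E.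
  by rewrite ge0_integral_distribution.
rewrite (eq_measure_integral (distribution Pr U' \x Q)%E); last first.
  move=> C mC _; apply/esym/product_measure_unique => // B D mB mD.
  transitivity (distribution Pr U' B * distribution Pr Y D)%E; last by rewrite lY.
  exact: (indep_of_pair_law hY iJ hU mB mD).
rewrite fubini_tonelli1// ge0_integral_distribution//.
- exact: measurable_fun_fubini_tonelli_F.
- by move=> s; exact: integral_ge0.
Qed.

End Independence.

(** * Means of the sampled quantities *)

Section Means.
Variables (R : realType) (d : measure_display) (S : measurableType d) (Q : probability S R).
Implicit Types (g : S -> R).

Lemma has_meanP g v :
  has_mean Q g v <-> Q.-integrable [set: S] (EFin \o g) /\ (\int[Q]_s (g s)%:E = v%:E)%E.
Proof.
have -> : (\int[Q]_s (g s)%:E = 'E_Q[g])%E by rewrite unlock.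
by [].
Qed.

Lemma has_mean_cst c : has_mean Q (fun=> c) c.
Proof.
split; last by rewrite expectation_cst.
exact: finite_measure_integrable_cst.
Qed.

Lemma has_meanD g g' v v' : has_mean Q g v -> has_mean Q g' v' ->
  has_mean Q (fun s => g s + g' s) (v + v').
Proof.
move=> /has_meanP[ig eg] /has_meanP[ig' eg']; apply/has_meanP.
have e : EFin \o (fun s => g s + g' s) = ((EFin \o g) \+ (EFin \o g'))%E.
  by apply/funext => s; rewrite /= EFinD.
split; first by rewrite e; exact: integrableD.
by rewrite -[X in integral _ _ X]/(EFin \o _) e integralD// eg eg'.
Qed.

Lemma has_meanZ c g v : has_mean Q g v -> has_mean Q (fun s => c * g s) (c * v).
Proof.
move=> /has_meanP[ig eg]; apply/has_meanP.
have e : EFin \o (fun s => c * g s) = (fun s => c%:E * (EFin \o g) s)%E.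
  by apply/funext => s; rewrite /= EFinM.
split; first by rewrite e; exact: integrableZl.
by rewrite -[X in integral _ _ X]/(EFin \o _) e integralZl// eg.
Qed.

Lemma has_meanB g g' v v' : has_mean Q g v -> has_mean Q g' v' ->
  has_mean Q (fun s => g s - g' s) (v - v').
Proof.
move=> h /(has_meanZ (-1)) h'; have := has_meanD h h'; rewrite mulN1r.
by congr (has_mean _ _ _); apply/funext => s; rewrite mulN1r.
Qed.

Lemma has_mean_sum (J : finType) (g : J -> S -> R) (v : J -> R) :
  (forall j, has_mean Q (g j) (v j)) -> has_mean Q (fun s => \sum_j g j s) (\sum_j v j).
Proof.
move=> h; elim: (index_enum J) => [|j r IH].
  under eq_fun do rewrite big_nil; rewrite big_nil; exact: has_mean_cst.
under eq_fun do rewrite big_cons; rewrite big_cons; exact: has_meanD.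
Qed.

Lemma has_mean_dotp n (k : 'cV[R]_n) (u : S -> 'cV[R]_n) (v : 'cV[R]_n) :
  (forall i, has_mean Q (fun s => u s i 0) (v i 0)) ->
  has_mean Q (fun s => dotp k (u s)) (dotp k v).
Proof. by move=> h; apply: has_mean_sum => i; exact: has_meanZ. Qed.

Lemma has_mean_mulmx m n (U : S -> 'M[R]_(m, n)) (B : 'M[R]_(m, n)) (x : 'cV[R]_n) i :
  (forall i j, has_mean Q (fun s => U s i j) (B i j)) ->
  has_mean Q (fun s => (U s *m x) i 0) ((B *m x) i 0).
Proof.
move=> h; rewrite mxE; under eq_fun do rewrite mxE.
apply: has_mean_sum => j; rewrite mulrC; under eq_fun do rewrite mulrC.
exact: has_meanZ.
Qed.

(** This integrates out one sample at a time: the integrand only has to be nonnegative, measurable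
    and dominated by a function of known mean. *)
Lemma integral_le_has_mean (phi : S -> \bar R) g v : measurable_fun setT phi ->
  (forall s, 0 <= phi s)%E -> (forall s, phi s <= (g s)%:E)%E -> has_mean Q g v ->
  (\int[Q]_s phi s <= v%:E)%E.
Proof.
move=> mphi phi0 le /has_meanP[ig <-]; apply: ge0_le_integral => //.
exact: measurable_int ig.
Qed.

Lemma has_mean_sqr g : g \in Lfun Q 2%:E -> exists v, has_mean Q (fun s => g s ^+ 2) v.
Proof.
move=> /Lfun2_integrable_sqr ig.
have fin : (\int[Q]_s (g s ^+ 2)%:E \is a fin_num)%E by exact: integrable_fin_num.
by exists (fine (\int[Q]_s (g s ^+ 2)%:E)%E); apply/has_meanP; split=> //; rewrite fineK.
Qed.

Lemma has_mean_ge0 g c : measurable_fun setT g -> (forall s, 0 <= g s) ->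
  ('E_Q[g] <= c%:E)%E -> exists2 v, v <= c & has_mean Q g v.
Proof.
rewrite unlock => mg g0 le.
have fin : (\int[Q]_s (g s)%:E \is a fin_num)%E.
  rewrite ge0_fin_numE; first exact: le_lt_trans le (ltry _).
  by apply: integral_ge0 => s _; rewrite lee_fin.
exists (fine (\int[Q]_s (g s)%:E)%E); first by rewrite -lee_fin fineK.
apply/has_meanP; split; last by rewrite fineK.
apply/integrableP; split; first exact/measurable_EFinP.
under eq_integral do rewrite /= ger0_norm//.
exact: le_lt_trans le (ltry _).
Qed.

End Means.

Lemma frob_tr (R : realType) m n (B : 'M[R]_(m, n)) : frob B^T = frob B.
Proof.
by rewrite /frob exchange_big; apply: eq_bigr => i _; apply: eq_bigr => j _; rewrite mxE.
Qed.

(** * First and second moments of the sampled gradient *)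

Section SampledGradient.
Variables (R : realType) (m n : nat) (dz dx : measure_display).
Variables (Sz : measurableType dz) (Sx : measurableType dx).
Variables (Pz : probability Sz R) (Px : probability Sx R).
Variables (F : 'cV[R]_n -> Sx -> R) (f : 'cV[R]_n -> R).
Variables (Az : Sz -> 'M[R]_(m, n)) (bz : Sz -> 'cV[R]_m).
Variables (A : 'M[R]_(m, n)) (b : 'cV[R]_m).
Hypothesis hA : forall i j, has_mean Pz (fun s => Az s i j) (A i j).
Hypothesis hb : forall i, has_mean Pz (fun s => bz s i 0) (b i 0).
Hypothesis hA2 : forall i j, (fun s => Az s i j) \in Lfun Pz 2%:E.
Hypothesis hb2 : forall i, (fun s => bz s i 0) \in Lfun Pz 2%:E.
Hypothesis hf : forall x, has_mean Px (F x) (f x).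
Hypothesis hF : forall s x, differentiable (F ^~ s) x.
Hypothesis hgrad : forall x i, has_mean Px (fun s => grad (F ^~ s) x i 0) (grad f x i 0).
Variable sigma : R.
Hypothesis hvar : forall x,
  ('E_Px[fun s => (enorm (grad (F ^~ s) x - grad f x) ^+ 2)%R] <= (sigma ^+ 2)%:E)%E.
Variables (rho mu : R).
Implicit Types (x z : 'cV[R]_n) (y : 'cV[R]_m).

Lemma sampled_frob_mean : exists v, has_mean Pz (fun s => frob (Az s)) v.
Proof.
have /choice[v hv] : forall ij : 'I_m * 'I_n, exists v, has_mean Pz (fun s => Az s ij.1 ij.2 ^+ 2) v.
  by move=> ij; exact: has_mean_sqr.
exists (\sum_i \sum_j v (i, j)); rewrite /frob.
by apply: has_mean_sum => i; apply: has_mean_sum => j; exact: hv (i, j).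
Qed.

Lemma sampled_rhs_mean : exists v, has_mean Pz (fun s => dotp (bz s) (bz s)) v.
Proof.
have /choice[v hv] : forall i : 'I_m, exists v, has_mean Pz (fun s => bz s i 0 ^+ 2) v.
  by move=> i; exact: has_mean_sqr.
exists (\sum_i v i); rewrite /dotp; apply: has_mean_sum => i.
by under eq_fun do rewrite -expr2.
Qed.

Lemma residual_mean (k : 'cV[R]_m) x :
  has_mean Pz (fun s => dotp k (Az s *m x - bz s)) (dotp k (A *m x - b)).
Proof.
apply: has_mean_dotp => i; rewrite mxE [X in _ + X]mxE.
under eq_fun do rewrite mxE [X in _ + X]mxE.
by apply: has_meanB => //; exact: has_mean_mulmx.
Qed.

Lemma mulmx_mean (v : 'cV[R]_n) (k : 'cV[R]_m) :
  has_mean Pz (fun s => dotp (Az s *m v) k) (dotp (A *m v) k).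
Proof.
rewrite dotpC; under eq_fun do rewrite dotpC.
by apply: has_mean_dotp => i; exact: has_mean_mulmx.
Qed.

Lemma residual_sqr_le s x :
  dotp (Az s *m x - bz s) (Az s *m x - bz s) <=
  2 * (dotp x x * frob (Az s)) + 2 * dotp (bz s) (bz s).
Proof.
have := dotp_sqrD (Az s *m x) (- bz s); have := dotp_mulmx_frob (Az s) x.
by rewrite dotpNl dotpNr; lra.
Qed.

Local Notation G := (gradK_est F Az bz rho mu).

Lemma gradK_est_dotp x y z xi s1 s2 v :
  dotp v (G x y z xi s1 s2) = dotp v (grad (F ^~ xi) x) + mu * dotp v (x - z)
  + dotp (Az s1 *m v) y + rho * dotp (Az s1 *m v) (Az s2 *m x - bz s2).
Proof.
rewrite /gradK_est; move: (x - z) (Az s2 *m x - bz s2) => p q.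
have e (k : 'cV[R]_m) : dotp v ((Az s1)^T *m k) = dotp (Az s1 *m v) k.
  by rewrite dotpC dotp_trmx dotpC.
rewrite !dotpDr !dotpZr !e; ring.
Qed.

(** Splitting four summands in two rounds gives the factor 4. In the last term the two matrix
    samples appear as a product of separate factors, so that they can be averaged one after the
    other. *)
Lemma gradK_est_sqr x y z xi s1 s2 :
  dotp (G x y z xi s1 s2) (G x y z xi s1 s2) <=
  4 * dotp (grad (F ^~ xi) x) (grad (F ^~ xi) x) + 4 * mu ^+ 2 * dotp (x - z) (x - z)
  + 4 * dotp y y * frob (Az s1)
  + 4 * rho ^+ 2 * frob (Az s1) * (2 * (dotp x x * frob (Az s2)) + 2 * dotp (bz s2) (bz s2)).
Proof.
have := residual_sqr_le s2 x; rewrite /gradK_est.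
move: (Az s2 *m x - bz s2) (2 * _ + 2 * _) => k N hk.
have h1 := dotp_mulmx_frob (Az s1)^T y; have h2 := dotp_mulmx_frob (Az s1)^T k.
rewrite frob_tr in h1 h2.
have h3 := ler_wpM2l (mulr_ge0 (sqr_ge0 rho) (frob_ge0 (Az s1))) hk.
have h4 := ler_wpM2l (sqr_ge0 rho) h2.
move: ((Az s1)^T *m y) ((Az s1)^T *m k) (grad _ _) (x - z) h1 h2 h3 h4 => p q g w h1 h2 h3 h4.
have := dotp_sqrD (g + p + rho *: q) (mu *: w).
have := dotp_sqrD (g + p) (rho *: q + mu *: w); rewrite addrA.
have := dotp_sqrD g p; have := dotp_sqrD (rho *: q) (mu *: w).
rewrite !(dotpZl, dotpZr).
move: (dotp (g + p + _ + _) _) (dotp (g + p) _) (dotp (rho *: q + _) _) => t1 t2 t3.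
by move: (frob _) (dotp y y) (dotp k k) h1 h2 h3 h4 => *; lra.
Qed.

Lemma sampled_grad_sqr x : exists2 v, v <= 2 * sigma ^+ 2 + 2 * dotp (grad f x) (grad f x) &
  has_mean Px (fun s => 2 * dotp (grad (F ^~ s) x - grad f x) (grad (F ^~ s) x - grad f x)
    + 2 * dotp (grad f x) (grad f x)) v.
Proof.
have mF u : measurable_fun setT (F u).
  by have [/measurable_int/measurable_EFinP] := hf u.
have mg : mxmeas (fun s => grad (F ^~ s) x - grad f x).
  apply: mxmeasB; last exact: mxmeas_cst.
  exact: (mxmeas_grad mF hF (mxmeas_cst x) (@measurable_id _ _ setT)).
have hE : ('E_Px[fun s => dotp (grad (F ^~ s) x - grad f x) (grad (F ^~ s) x - grad f x)]
    <= (sigma ^+ 2)%:E)%E.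
  by have := hvar x; under eq_fun do rewrite enorm_sqr.
have [v vs hv] := has_mean_ge0 (measurable_dotp mg mg) (fun s => dotp_ge0 _) hE.
exists (2 * v + 2 * dotp (grad f x) (grad f x)); first by lra.
by apply: has_meanD; [exact: has_meanZ|exact: has_mean_cst].
Qed.

Variables (a2 b2 : R).
Hypothesis ha2 : has_mean Pz (fun s => frob (Az s)) a2.
Hypothesis hb2' : has_mean Pz (fun s => dotp (bz s) (bz s)) b2.

(** The bound of [gradK_est_sqr] with each random factor replaced by its mean or by a bound on its
    mean. *)
Definition grad_sqr_bound x y z : R :=
  4 * (2 * sigma ^+ 2 + 2 * dotp (grad f x) (grad f x)) + 4 * mu ^+ 2 * dotp (x - z) (x - z)
  + 4 * dotp y y * a2 + 4 * rho ^+ 2 * a2 * (2 * (dotp x x * a2) + 2 * b2).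

(** The samples are integrated out in the order s2, s1, xi, each time through a majorant of known
    mean. The linear term has the exact mean c1 <v, gradK>, whatever the sign of c1; the square is
    only bounded above, hence c2 >= 0. [Phi] stays abstract: it will be the potential at the next
    state, of which only measurability and this domination are used. *)
Lemma sampled_gradient_integral x y z v c0 c1 c2 (Phi : Sx -> Sz -> Sz -> \bar R) : 0 <= c2 ->
  (forall xi s1 s2, 0 <= Phi xi s1 s2)%E ->
  (forall xi s1, measurable_fun setT (Phi xi s1)) ->
  (forall xi, measurable_fun setT (fun s1 => \int[Pz]_s2 Phi xi s1 s2))%E ->
  measurable_fun setT (fun xi => \int[Pz]_s1 \int[Pz]_s2 Phi xi s1 s2)%E ->
  (forall xi s1 s2, Phi xi s1 s2 <=
    (c0 + c1 * dotp v (G x y z xi s1 s2) + c2 * dotp (G x y z xi s1 s2) (G x y z xi s1 s2))%:E)%E ->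
  (\int[Px]_xi \int[Pz]_s1 \int[Pz]_s2 Phi xi s1 s2 <=
    (c0 + c1 * dotp v (gradK f A b rho mu x y z) + c2 * grad_sqr_bound x y z)%:E)%E.
Proof.
move=> c20 Phi0 m1 m2 m3 le.
pose E0 xi := c0 + c1 * (dotp v (grad (F ^~ xi) x) + mu * dotp v (x - z))
  + c2 * (4 * dotp (grad (F ^~ xi) x) (grad (F ^~ xi) x) + 4 * mu ^+ 2 * dotp (x - z) (x - z)).
have I2 xi s1 : (\int[Pz]_s2 Phi xi s1 s2 <= (E0 xi + c1 * dotp (Az s1 *m v) y
    + c1 * rho * dotp (Az s1 *m v) (A *m x - b) + c2 * 4 * dotp y y * frob (Az s1)
    + c2 * 4 * rho ^+ 2 * (2 * dotp x x * a2 + 2 * b2) * frob (Az s1))%:E)%E.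
  pose g s2 := (E0 xi + c1 * dotp (Az s1 *m v) y + c2 * 4 * dotp y y * frob (Az s1))
    + (c1 * rho * dotp (Az s1 *m v) (Az s2 *m x - bz s2)
      + (c2 * 4 * rho ^+ 2 * frob (Az s1) * 2 * dotp x x * frob (Az s2)
        + c2 * 4 * rho ^+ 2 * frob (Az s1) * 2 * dotp (bz s2) (bz s2))).
  have hg := has_meanD (has_mean_cst Pz (E0 xi + c1 * dotp (Az s1 *m v) y + c2 * 4 * dotp y y * frob (Az s1)))
    (has_meanD (has_meanZ (c1 * rho) (residual_mean (Az s1 *m v) x))
      (has_meanD (has_meanZ (c2 * 4 * rho ^+ 2 * frob (Az s1) * 2 * dotp x x) ha2)
                 (has_meanZ (c2 * 4 * rho ^+ 2 * frob (Az s1) * 2) hb2'))).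
  apply: (le_trans (integral_le_has_mean (m1 xi s1) (Phi0 xi s1) _ hg)).
    move=> s2; apply: (le_trans (le xi s1 s2)); rewrite lee_fin gradK_est_dotp.
    have := ler_wpM2l c20 (gradK_est_sqr x y z xi s1 s2); rewrite /E0.
    by move: (dotp (G _ _ _ _ _ _) _) (dotp (Az s1 *m v) _) (dotp (Az s1 *m v) _) => *; lra.
  rewrite lee_fin le_eqVlt; apply/orP; left; apply/eqP; ring.
have I1 xi : (\int[Pz]_s1 \int[Pz]_s2 Phi xi s1 s2 <= (E0 xi + c1 * dotp (A *m v) y
    + c1 * rho * dotp (A *m v) (A *m x - b) + c2 * 4 * dotp y y * a2
    + c2 * 4 * rho ^+ 2 * (2 * dotp x x * a2 + 2 * b2) * a2)%:E)%E.
  have hg := has_meanD (has_meanD (has_meanD (has_meanD (has_mean_cst Pz (E0 xi))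
    (has_meanZ c1 (mulmx_mean v y))) (has_meanZ (c1 * rho) (mulmx_mean v (A *m x - b))))
    (has_meanZ (c2 * 4 * dotp y y) ha2)) (has_meanZ (c2 * 4 * rho ^+ 2 * (2 * dotp x x * a2 + 2 * b2)) ha2).
  apply: (integral_le_has_mean (m2 xi) _ (I2 xi) hg).
  by move=> s1; exact: integral_ge0.
have [gv gvle hgv] := sampled_grad_sqr x.
have hlin : has_mean Px (fun xi => dotp v (grad (F ^~ xi) x)) (dotp v (grad f x)).
  by apply: has_mean_dotp.
pose c3 := c0 + c1 * (mu * dotp v (x - z)) + c2 * (4 * mu ^+ 2 * dotp (x - z) (x - z))
  + c1 * dotp (A *m v) y + c1 * rho * dotp (A *m v) (A *m x - b) + c2 * 4 * dotp y y * a2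
    + c2 * 4 * rho ^+ 2 * (2 * dotp x x * a2 + 2 * b2) * a2.
have hg := has_meanD (has_mean_cst Px c3) (has_meanD (has_meanZ c1 hlin) (has_meanZ (c2 * 4) hgv)).
apply: (le_trans (integral_le_has_mean m3 _ _ hg)).
- by move=> xi; apply: integral_ge0 => s1 _; exact: integral_ge0.
- move=> xi; apply: (le_trans (I1 xi)); rewrite lee_fin /E0 /c3.
  have := dotp_sqrD (grad (F ^~ xi) x - grad f x) (grad f x); rewrite subrK => h.
  by have := ler_wpM2l c20 h; lra.
have e (k : 'cV[R]_m) : dotp v (A^T *m k) = dotp (A *m v) k by rewrite dotpC dotp_trmx dotpC.
rewrite lee_fin /c3 /gradK /grad_sqr_bound.
move: (x - z) (A *m x - b) => p q; rewrite !(dotpDr _ _ v) !(dotpZr _ _ v) !e.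
by have := ler_wpM2l c20 gvle; lra.
Qed.

End SampledGradient.

(** * Continuity and measurability of the potential *)

Section PotentialMeasurability.
Variables (R : realType) (m n : nat).
Variables (f : 'cV[R]_n -> R) (A : 'M[R]_(m, n)) (b : 'cV[R]_m).
Variables (X : set 'cV[R]_n) (rho mu Lf lam : R).
Hypotheses (sf : smooth Lf f) (cX : convex_set X) (kX : compact X).
Hypothesis (F0 : feasible A b X !=set0).
Hypotheses (rho0 : 0 <= rho) (mu0 : 0 < mu) (lam0 : 0 < lam) (gam0 : 0 < mu - Lf).
Implicit Types (x z u : 'cV[R]_n) (y : 'cV[R]_m).

Local Notation xs := (xstar f A b X rho mu).
Local Notation xb := (xbar f A b X mu).
Local Notation V := (Vfun f A b X rho mu lam).
Local Notation uh := (uhat f A b X rho mu lam).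
Local Notation nA := (opnorm A).
Local Notation gam := (mu - Lf).

Let VU := Vfun_upper lam sf cX kX F0 rho0 gam0.
Let uhatX x y z : X (uh x y z) := (uhatP rho mu lam sf kX F0 x y z).1.
Let xstarX y z : X (xs y z) := (xstarP rho mu sf kX F0 y z).1.
Let xbarX z : X (xb z) := xbar_X mu sf kX F0 z.

Let c10 : 0 <= 2 * gam^-1 * nA ^+ 2.
Proof. by rewrite mulr_ge0 ?sqr_ge0// mulr_ge0// invr_ge0 ltW. Qed.

Let c20 : 0 <= mu / 2 + 2 * gam^-1 * mu ^+ 2.
Proof. by rewrite addr_ge0 ?mulr_ge0 ?invr_ge0 ?sqr_ge0// ltW. Qed.

(** [Vfun_upper] is used in both directions; its coefficients are uniformly bounded because all
    minimizers lie in the compact X. The other two arguments are treated in the same way. *)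
Lemma Vfun_continuous_dual x z : continuous (fun y => V x y z).
Proof.
have [B B0 hB] := compact_enorm_bounded kX.
pose D := nA * B + enorm b.
have hD u : X u -> enorm (A *m u - b) <= D.
  move=> Xu; rewrite (le_trans (enormD _ _))// enormN lerD2r (le_trans (enorm_mulmx _ _))//.
  by rewrite ler_wpM2l ?opnorm_ge0// hB.
have hd u s : X u -> X s -> enorm (A *m u - b - 2 *: (A *m s - b)) <= 3 * D.
  move=> /hD hu /hD hs; rewrite (le_trans (enormD _ _))// enormN enormZ (@ger0_norm _ 2)//.
  by move: (enorm _) (enorm _) hu hs => ? ? ? ?; lra.
have key y y2 : V x y2 z - V x y z <= 3 * D * enorm (y2 - y) + 2 * gam^-1 * nA ^+ 2 * dotp (y2 - y) (y2 - y).
  move: (VU x y z x y2 z) (hd _ _ (uhatX x y z) (xstarX y z)); cbv zeta.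
  move: (uh x y z) (xs y z) (xb z) (V x y z) (V x y2 z) => u s w v v2.
  rewrite !(subrr, dotp0r, mulr0, addr0) => h {}hd.
  have h2 := ler_dotp (A *m u - b - 2 *: (A *m s - b)) (y2 - y).
  have h3 := ler_wpM2r (enorm_ge0 (y2 - y)) hd.
  have := le_trans h2 h3; move: h.
  by move: (dotp (_ - _) (y2 - y)) (dotp (y2 - y) _) => ? ? ? ?; lra.
apply: continuous_of_bound => y; exists (3 * D + 2 * gam^-1 * nA ^+ 2) => y2.
have k1 := key y y2; have := key y2 y.
have e : dotp (y - y2) (y - y2) = dotp (y2 - y) (y2 - y) by rewrite -(opprB y2) dotpNl dotpNr opprK.
rewrite e (enormB y) => k2.
have D0 : 0 <= D by rewrite addr_ge0 ?enorm_ge0// mulr_ge0 ?opnorm_ge0// ltW.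
have p1 := mulr_ge0 D0 (dotp_ge0 (y2 - y)); have p2 := mulr_ge0 c10 (enorm_ge0 (y2 - y)).
move: (2 * gam^-1 * nA ^+ 2) (V x y2 z) (V x y z) (enorm (y2 - y)) (dotp (y2 - y) _) k1 k2 p1 p2
  => c v v2 q1 q2 k1 k2 p1 p2.
by rewrite ler_norml; apply/andP; split; lra.
Qed.

Lemma Vfun_continuous_primal y z : continuous (fun x => V x y z).
Proof.
have [B B0 hB] := compact_enorm_bounded kX.
apply: continuous_of_bound => x; exists (lam * (B + enorm x) + lam) => x2.
have hx u : X u -> `|dotp (u - x) (x2 - x)| <= (B + enorm x) * enorm (x2 - x).
  move=> Xu; apply: (le_trans (ler_abs_dotp _ _)); rewrite ler_wpM2r ?enorm_ge0//.
  by rewrite (le_trans (enormD _ _))// enormN lerD2r hB.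
move: (VU x y z x2 y z) (VU x2 y z x y z) (hx _ (uhatX x y z)) (hx _ (uhatX x2 y z)); cbv zeta.
have e u : u - x2 = (u - x) - (x2 - x) by rewrite opprB addrA subrK.
move: (uh x y z) (xs y z) (xb z) (uh x2 y z) (V x y z) (V x2 y z) => u s w u2 v v2.
rewrite !(subrr, dotp0r, mulr0, addr0) !e.
move: (u - x) (u2 - x) (x2 - x) => k k2 D.
rewrite !(dotpDl, dotpDr, dotpNl, dotpNr) (dotpC D k) (dotpC D k2).
rewrite !ler_norml => h1 h2 /andP[n1 n2] /andP[n3 n4].
have n1' := ler_wpM2l (ltW lam0) n1; have n2' := ler_wpM2l (ltW lam0) n2.
have n3' := ler_wpM2l (ltW lam0) n3; have n4' := ler_wpM2l (ltW lam0) n4.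
have p1 := mulr_ge0 (ltW lam0) (dotp_ge0 D).
have p2 := mulr_ge0 (ltW lam0) (enorm_ge0 D).
have p3 : 0 <= lam * (B + enorm x) * dotp D D.
  by rewrite !mulr_ge0 ?addr_ge0 ?enorm_ge0 ?dotp_ge0// ltW.
by apply/andP; split; lra.
Qed.

Lemma Vfun_continuous_center x y : continuous (fun z => V x y z).
Proof.
have [B B0 hB] := compact_enorm_bounded kX.
apply: continuous_of_bound => z; exists (mu * (enorm z + 5 * B) + (mu / 2 + 2 * gam^-1 * mu ^+ 2)) => z2.
have hd u s w : X u -> X s -> X w ->
    `|dotp (z - u + 2 *: s - 2 *: w) (z2 - z)| <= (enorm z + 5 * B) * enorm (z2 - z).
  move=> Xu Xs Xw; apply: (le_trans (ler_abs_dotp _ _)); rewrite ler_wpM2r ?enorm_ge0//.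
  have := enormD (z - u + 2 *: s) (- (2 *: w)); have := enormD (z - u) (2 *: s).
  have := enormD z (- u); rewrite !enormN !enormZ (@ger0_norm _ 2)//.
  by have := hB _ Xu; have := hB _ Xs; have := hB _ Xw; lra.
move: (VU x y z x y z2) (VU x y z2 x y z); cbv zeta.
move: (hd _ _ _ (uhatX x y z) (xstarX y z) (xbarX z)).
move: (hd _ _ _ (uhatX x y z2) (xstarX y z2) (xbarX z2)).
move: (uh x y z) (xs y z) (xb z) (uh x y z2) (xs y z2) (xb z2) (V x y z) (V x y z2).
move=> u s w u2 s2 w2 v v2.
have e1 : z - u - 2 *: (z - s) + 2 *: (z - w) = z - u + 2 *: s - 2 *: w.
  by apply/matrixP => i j; rewrite !mxE; ring.
have e2 : z2 - u2 - 2 *: (z2 - s2) + 2 *: (z2 - w2) =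
    (z - u2 + 2 *: s2 - 2 *: w2) + (z2 - z).
  by apply/matrixP => i j; rewrite !mxE; ring.
rewrite !(subrr, dotp0r, mulr0, addr0) e1 e2 -(opprB z2 z).
move: (z - u + _ - _) (z - u2 + _ - _) (z2 - z) => p1 p2 D.
rewrite !dotpDl !dotpNr !dotpNl.
have q1 := mulr_ge0 (ltW mu0) (dotp_ge0 D).
have q2 : 0 <= mu * (enorm z + 5 * B) * dotp D D.
  by rewrite !mulr_ge0 ?addr_ge0 ?enorm_ge0 ?dotp_ge0 ?mulr_ge0// ltW.
have q3 := mulr_ge0 c20 (enorm_ge0 D).
rewrite !ler_norml => /andP[n1 n2] /andP[n3 n4] h1 h2.
have n1' := ler_wpM2l (ltW mu0) n1; have n2' := ler_wpM2l (ltW mu0) n2.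
have n3' := ler_wpM2l (ltW mu0) n3; have n4' := ler_wpM2l (ltW mu0) n4.
move: (mu / 2 + _) h1 h2 q1 q2 q3 => c h1 h2 q1 q2 q3.
by apply/andP; split; lra.
Qed.

(** Continuity in each argument separately is enough, since the random arguments are inserted one
    after another. *)
Lemma Vfun_measurable d (Om : measurableType d) (u : Om -> 'cV[R]_n) (v : Om -> 'cV[R]_m)
    (w : Om -> 'cV[R]_n) :
  mxmeas u -> mxmeas v -> mxmeas w -> measurable_fun setT (fun t => V (u t) (v t) (w t)).
Proof.
move=> hu hv hw.
apply: (measurable_caratheodory (psi := fun x t => V x (v t) (w t)) hu) => [x|t]; last first.
  exact: Vfun_continuous_primal.
apply: (measurable_caratheodory (psi := fun y t => V x y (w t)) hv) => [y|t]; last first.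
  exact: Vfun_continuous_dual.
apply: (measurable_caratheodory (psi := fun z t => V x y z) hw) => [z|t]; last first.
  exact: Vfun_continuous_center.
exact: measurable_cst.
Qed.

Lemma xbar_measurable d (Om : measurableType d) (w : Om -> 'cV[R]_n) :
  mxmeas w -> mxmeas (fun t => xb (w t)).
Proof.
move=> hw i j; apply: (measurable_caratheodory (psi := fun z t => xb z i j) hw) => [z|_].
  exact: measurable_cst.
apply: continuous_of_bound => z; exists (mu / gam) => z2; rewrite (ord1 j).
have -> : xb z2 i 0 - xb z i 0 = (xb z2 - xb z) i 0 by rewrite !mxE.
apply: (le_trans (coord_le_enorm _ _)).
have h : enorm (xb z2 - xb z) <= mu / gam * enorm (z2 - z).
  rewrite mulrAC ler_pdivlMr// mulrC.
  rewrite -(@ler_pXn2r _ 2)// ?nnegrE ?mulr_ge0 ?enorm_ge0//; try exact: ltW.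
  by rewrite !exprMn !enorm_sqr; exact: xbar_lipschitz.
apply: (le_trans h); rewrite ler_wpM2l ?lerDl ?dotp_ge0//.
by rewrite divr_ge0 ?ltW.
Qed.

End PotentialMeasurability.

Local Ltac nonneg :=
  repeat first [ assumption | rewrite invr_ge0 | exact: sqr_ge0 | exact: ler0n
               | exact: ler01 | apply: addr_ge0 | apply: mulr_ge0 | by [] ].

(** * The expected decrease of the potential in one step *)

Section StepExpectation.
Variables (R : realType) (m n : nat) (dz dx : measure_display).
Variables (Sz : measurableType dz) (Sx : measurableType dx).
Variables (Pz : probability Sz R) (Px : probability Sx R).
Variables (F : 'cV[R]_n -> Sx -> R) (f : 'cV[R]_n -> R).
Variables (Az : Sz -> 'M[R]_(m, n)) (bz : Sz -> 'cV[R]_m).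
Variables (A : 'M[R]_(m, n)) (b : 'cV[R]_m).
Hypothesis hA : forall i j, has_mean Pz (fun s => Az s i j) (A i j).
Hypothesis hb : forall i, has_mean Pz (fun s => bz s i 0) (b i 0).
Hypothesis hA2 : forall i j, (fun s => Az s i j) \in Lfun Pz 2%:E.
Hypothesis hb2 : forall i, (fun s => bz s i 0) \in Lfun Pz 2%:E.
Hypothesis hf : forall x, has_mean Px (F x) (f x).
Hypothesis hF : forall s x, differentiable (F ^~ s) x.
Hypothesis hgrad : forall x i, has_mean Px (fun s => grad (F ^~ s) x i 0) (grad f x i 0).
Variable sigma : R.
Hypothesis hvar : forall x,
  ('E_Px[fun s => (enorm (grad (F ^~ s) x - grad f x) ^+ 2)%R] <= (sigma ^+ 2)%:E)%E.
Variables (X : set 'cV[R]_n) (rho mu Lf lam : R).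
Hypotheses (sf : smooth Lf f) (cX : convex_set X) (kX : compact X).
Hypothesis (F0 : feasible A b X !=set0).
Hypotheses (rho0 : 0 <= rho) (mu2 : 2 <= mu) (lam0 : 0 < lam) (gam0 : 0 < mu - Lf).
Hypotheses (gmu : 3 / 4 * mu <= mu - Lf) (mul : mu <= lam).
Variables (ce sbar MPsi r My : R).
Hypothesis ce0 : 0 <= ce.
Hypothesis heb : error_bound f A b X rho mu sbar.
Hypothesis hMPsi : forall z, MPsi <= Psi f A b X mu z.
Hypotheses (rA : row_free A) (r0 : 0 < r) (hreach : reach_radius A b X r).
Hypothesis hMy : (MVconst f A b X rho mu - MPsi + 2 * Mconst f A b X rho mu) / r < My.

Local Notation V := (Vfun f A b X rho mu lam).
Local Notation xb := (xbar f A b X mu).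

Definition Vstate (s : state R m n) : R := V s.1.1 s.1.2 s.2.

Lemma compact_bounds : exists D2 D3 Gf Dx : R, [/\
  forall u v, X u -> X v -> dotp (u - v) (u - v) <= D2,
  forall u, X u -> dotp (A *m u - b) (A *m u - b) <= D3,
  forall u, X u -> dotp (grad f u) (grad f u) <= Gf
  & forall u, X u -> dotp u u <= Dx].
Proof.
have [B B0 hB] := compact_enorm_bounded kX.
exists ((2 * B) ^+ 2), ((opnorm A * B + enorm b) ^+ 2),
  ((enorm (grad f 0) + `|Lf| * B) ^+ 2), (B ^+ 2); split=> u.
- move=> v Xu Xv; rewrite -enorm_leP ?mulr_ge0 ?(ltW B0)//.
  by rewrite (le_trans (enormD _ _))// enormN mulr2n mulrDl !mul1r lerD// hB.
- move=> Xu; rewrite -enorm_leP ?addr_ge0 ?mulr_ge0 ?opnorm_ge0 ?enorm_ge0 ?(ltW B0)//.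
  rewrite (le_trans (enormD _ _))// enormN lerD2r (le_trans (enorm_mulmx _ _))//.
  by rewrite ler_wpM2l ?opnorm_ge0// hB.
- move=> Xu; rewrite -enorm_leP ?addr_ge0 ?mulr_ge0 ?enorm_ge0 ?(ltW B0)//.
  have -> : grad f u = grad f 0 + (grad f u - grad f 0) by rewrite addrC subrK.
  rewrite (le_trans (enormD _ _))// lerD2l (le_trans (sf.2 _ _))// subr0.
  by rewrite (le_trans (ler_wpM2r (enorm_ge0 _) (ler_norm _)))// ler_wpM2l// hB.
- by move=> Xu; rewrite -enorm_leP ?(ltW B0)// hB.
Qed.

(** C and the threshold on tau are chosen before the step sizes, hence uniformly in T. For each dual
    sample the applicable branch is bounded by [step_target]; averaging over that sample then
    removes the noise and bounds |g|^2 by second moments. *)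
Lemma step_expectation : exists C tau0 : R, [/\ 0 <= C, 0 < tau0 &
  forall tau eta beta, step_params A mu ce sbar tau eta beta -> tau <= tau0 ->
  forall x y z (Phi : Sz -> Sx -> Sz -> Sz -> \bar R), X x -> X z ->
  (forall s0 xi s1 s2, 0 <= Phi s0 xi s1 s2)%E ->
  (forall s0 xi s1, measurable_fun setT (Phi s0 xi s1)) ->
  (forall s0 xi, measurable_fun setT (fun s1 => \int[Pz]_s2 Phi s0 xi s1 s2))%E ->
  (forall s0, measurable_fun setT (fun xi => \int[Pz]_s1 \int[Pz]_s2 Phi s0 xi s1 s2))%E ->
  measurable_fun setT (fun s0 => \int[Px]_xi \int[Pz]_s1 \int[Pz]_s2 Phi s0 xi s1 s2)%E ->
  (forall s0 xi s1 s2, Phi s0 xi s1 s2 <=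
    (Vstate (step F Az bz X rho mu My tau eta beta (x, y, z) s0 xi s1 s2) - MPsi)%:E)%E ->
  (\int[Pz]_s0 \int[Px]_xi \int[Pz]_s1 \int[Pz]_s2 Phi s0 xi s1 s2 <=
    (V x y z - MPsi - mu * beta / 2 * dotp (z - xb z) (z - xb z) + C * tau ^+ 2)%:E)%E].
Proof.
have [D2 [D3 [Gf [Dx [hD2 hD3 hGf hDx]]]]] := compact_bounds.
have [a2 ha2] := sampled_frob_mean hA2; have [b2 hb2'] := sampled_rhs_mean hb2.
have [c [Xc _]] := F0.
have D20 : 0 <= D2 by have := hD2 c c Xc Xc; rewrite subrr dotp0l.
have D30 : 0 <= D3 := le_trans (dotp_ge0 _) (hD3 c Xc).
have Gf0 : 0 <= Gf := le_trans (dotp_ge0 _) (hGf c Xc).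
have Dx0 : 0 <= Dx := le_trans (dotp_ge0 _) (hDx c Xc).
have mean_ge0 (g : Sz -> R) v : (forall s, 0 <= g s) -> has_mean Pz g v -> 0 <= v.
  move=> g0 /has_meanP[_ e]; rewrite -lee_fin -e; apply: integral_ge0 => s _.
  by rewrite lee_fin.
have a20 : 0 <= a2 by apply: mean_ge0 ha2 => s; exact: frob_ge0.
have b20 : 0 <= b2 by apply: mean_ge0 hb2' => s; exact: dotp_ge0.
(* The gradient is sampled after the reset test, when the dual norm is at most My even if that of y
   is larger; so this bound is uniform along the run. *)
pose BG := 4 * (2 * sigma ^+ 2 + 2 * Gf) + 4 * mu ^+ 2 * D2
  + 4 * My ^+ 2 * a2 + 4 * rho ^+ 2 * a2 * (2 * (Dx * a2) + 2 * b2).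
have BG0 : 0 <= BG by rewrite /BG; nonneg.
have hBG x (y : 'cV[R]_m) z : X x -> X z -> dotp y y <= My ^+ 2 ->
    grad_sqr_bound f sigma rho mu a2 b2 x y z <= BG.
  move=> Xx Xz hy; rewrite /grad_sqr_bound /BG.
  have h1 := hGf _ Xx; have h2 := ler_wpM2l (sqr_ge0 mu) (hD2 _ _ Xx Xz).
  have h3 := ler_wpM2r a20 hy.
  have h4 : rho ^+ 2 * a2 * (2 * (dotp x x * a2) + 2 * b2) <= rho ^+ 2 * a2 * (2 * (Dx * a2) + 2 * b2).
    rewrite ler_wpM2l ?mulr_ge0 ?sqr_ge0// lerD2r ler_wpM2l// ler_wpM2r//; exact: hDx.
  by move: (dotp (grad f x) _) (dotp (x - z) _) (dotp y y) (dotp x x) h1 h2 h3 h4 => *; lra.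
pose Cs := step_const A mu Lf lam D2 BG ce.
have mu0 : 0 < mu by apply: lt_le_trans mu2.
have Cs0 : 0 <= Cs.
  have gi : 0 <= (mu - Lf)^-1 by rewrite invr_ge0 ltW.
  have l0 := ltW lam0; have m0 := ltW mu0.
  rewrite /Cs /step_const; nonneg.
pose del := r * My - (MVconst f A b X rho mu - MPsi + 2 * Mconst f A b X rho mu).
have del0 : 0 < del by rewrite subr_gt0 [r * My]mulrC -ltr_pdivrMr.
pose th := reset_threshold mu D2 D3 ce.
have th0 : 0 <= th.
  have m0 := ltW mu0; rewrite /th /reset_threshold; nonneg.
(* The bracket bounds the mean of 1 + |g|^2 for x in X. The threshold compares the gain [del] of a
   reset, positive by the strict inequality for My, with its cost; [th + 1] is positive even if [th]
   vanishes. *)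
exists (Cs * (1 + (2 * (Dx * a2) + 2 * b2))), (del / (th + 1)); split.
- nonneg.
- by rewrite divr_gt0// ltr_wpDl.
move=> tau eta beta hp htau x y z Phi Xx Xz Phi0 m1 m2 m3 m4 le.
have [[t0 e0 be0 ec] _] := hp.
have hth : th * tau <= del.
  apply: (@le_trans _ _ (tau * (th + 1))); first by rewrite mulrC ler_wpM2l// lerDl.
  by rewrite -ler_pdivlMr// ltr_wpDl.
have lt0 : 0 <= lam * tau ^+ 2 / 2.
  have l0 := ltW lam0; nonneg.
have J s0 : (\int[Px]_xi \int[Pz]_s1 \int[Pz]_s2 Phi s0 xi s1 s2 <=
    (step_target f A b X rho mu Lf lam D2 BG ce x y z (Az s0 *m x - bz s0) tau eta beta - MPsi)%:E)%E.
  set g := Az s0 *m x - bz s0; set y' := y + eta *: g.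
  pose y2 : 'cV[R]_m := if My <= enorm y' then 0 else y'.
  have hy2 : dotp y2 y2 <= My ^+ 2.
    rewrite /y2; case: ifPn => [_|]; first by rewrite dotp0l sqr_ge0.
    rewrite -ltNge => lt; rewrite -enorm_leP; first exact: ltW.
    by rewrite ltW// (le_lt_trans (enorm_ge0 _) lt).
  (* The expansion may start from any dual value [yb]: the reset branch takes 0, the other one y. *)
  have key yb : (\int[Px]_xi \int[Pz]_s1 \int[Pz]_s2 Phi s0 xi s1 s2 <=
      (step_base f A b X rho mu Lf lam x yb z y2 beta
       + lam * tau * dotp (uhat f A b X rho mu lam x yb z - x) (gradK f A b rho mu x y2 z)
       + lam * tau ^+ 2 / 2 * BG - MPsi)%:E)%E.
    have := @sampled_gradient_integral _ _ _ _ _ _ _ Pz Px F f Az bz A b hA hb hf hF hgrad sigma hvar rho mu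
      a2 b2 ha2 hb2' x y2 z (uhat f A b X rho mu lam x yb z - x)
      (step_base f A b X rho mu Lf lam x yb z y2 beta - MPsi) (lam * tau) (lam * tau ^+ 2 / 2)
      (Phi s0) lt0 (Phi0 s0) (m1 s0) (m2 s0) (m3 s0) _.
    move=> h; apply: (le_trans (h _)).
      move=> xi s1 s2; apply: (le_trans (le s0 xi s1 s2)); rewrite lee_fin.
      have := step_base_upper sf cX kX F0 rho0 lam0 gam0 x yb z y2 beta
        (gradK_est F Az bz rho mu x y2 z xi s1 s2) t0.
      rewrite /Vstate /step /dual_step -/g -/y' -/y2 /=.
      move: (V _ _ _) (step_base _ _ _ _ _ _ _ _ _ _ _ _ _) => v w hv.
      by rewrite -lerBrDr opprK; move: hv; congr (_ <= _); ring.
    have := ler_wpM2l lt0 (hBG x y2 z Xx Xz hy2).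
    move: (step_base _ _ _ _ _ _ _ _ _ _ _ _ _) (dotp _ (gradK _ _ _ _ _ _ _ _))
      (grad_sqr_bound _ _ _ _ _ _ _ _ _) => *.
    by rewrite lee_fin; lra.
  case: (boolP (My <= enorm y')) => hM.
    apply: (le_trans (key 0)); rewrite lee_fin lerD2r /y2 hM.
    exact: (reset_bound sf cX kX F0 rho0 mu2 lam0 gam0 hD2 hD3 BG0 Xx Xz hp rA r0 hreach (hMPsi z) hth hM).
  apply: (le_trans (key y)); rewrite lee_fin lerD2r /y2 (negbTE hM).
  exact: (no_reset_bound sf cX kX F0 rho0 mu2 lam0 gam0 hD2 BG0 gmu mul heb y g Xx Xz hp).
(* The dual noise has mean zero; the mean is kept as a difference of equal terms until the end. *)
have hlin := has_meanB (residual_mean hA hb (dual_dir f A b X rho mu lam x y z) x)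
  (has_mean_cst Pz (dotp (dual_dir f A b X rho mu lam x y z) (A *m x - b))).
pose k0 := V x y z - MPsi - mu * beta / 2 * dotp (z - xb z) (z - xb z) + Cs * tau ^+ 2.
have hg := has_meanD (has_mean_cst Pz k0) (has_meanD (has_meanZ eta hlin)
  (has_meanZ (Cs * tau ^+ 2) (has_meanD (has_meanZ (2 * Dx) ha2) (has_meanZ 2 hb2')))).
apply: (le_trans (integral_le_has_mean m4 _ _ hg)).
- by move=> s0; apply: integral_ge0 => xi _; apply: integral_ge0 => s1 _; exact: integral_ge0.
- move=> s0; apply: (le_trans (J s0)); rewrite lee_fin /step_target -/Cs /k0.
  have h1 : dotp (Az s0 *m x - bz s0) (Az s0 *m x - bz s0) <= 2 * Dx * frob (Az s0) + 2 * dotp (bz s0) (bz s0).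
    apply: (le_trans (residual_sqr_le Az bz s0 x)); rewrite lerD2r -mulrA ler_wpM2l// ler_wpM2r ?frob_ge0//.
    exact: hDx.
  have := ler_wpM2l (mulr_ge0 Cs0 (sqr_ge0 tau)) h1.
  rewrite (dotpDr (Az s0 *m x - bz s0)) dotpNr.
  move: (dotp (Az s0 *m x - bz s0) _) (dotp (dual_dir _ _ _ _ _ _ _ _ _ _) _)
    (dotp (dual_dir _ _ _ _ _ _ _ _ _ _) _).
  move: (V x y z) (dotp (z - xb z) _) (frob _) (dotp (bz s0) _) => ? ? ? ? ? ? ?; lra.
rewrite lee_fin /k0 subrr mulr0.
by move: (V x y z) (dotp (z - xb z) _) => ? ?; lra.
Qed.

End StepExpectation.

(** * Random vectors as coordinate tuples *)

Section TupleVectors.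
Variable R : realType.

Definition vec_tuple k (v : 'cV[R]_k) : k.-tuple R := [tuple v i 0 | i < k].
Definition tuple_vec k (t : k.-tuple R) : 'cV[R]_k := \col_i tnth t i.

Lemma vec_tupleK k (v : 'cV[R]_k) : tuple_vec (vec_tuple v) = v.
Proof. by apply/matrixP => i j; rewrite (ord1 j) mxE tnth_mktuple. Qed.

Lemma measurable_vec_tuple d (Om : measurableType d) k (v : Om -> 'cV[R]_k) :
  mxmeas v -> measurable_fun setT (fun w => vec_tuple (v w)).
Proof.
move=> hv; apply/measurable_fun_tnthP => i.
have -> : (fun t : k.-tuple R => tnth t i) \o (fun w => vec_tuple (v w)) = (fun w => v w i 0).
  by apply/funext => w /=; rewrite tnth_mktuple.
exact: hv.
Qed.

Lemma mxmeas_tuple_vec d (Om : measurableType d) k (t : Om -> k.-tuple R) :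
  measurable_fun setT t -> mxmeas (fun w => tuple_vec (t w)).
Proof.
move=> ht i j; under eq_fun do rewrite mxE.
exact: measurableT_comp (measurable_tnth i) ht.
Qed.

End TupleVectors.

(** * The iterates as a Markov chain *)

Section Chain.
Variables (R : realType) (m n : nat) (dz dx : measure_display).
Variables (Sz : measurableType dz) (Sx : measurableType dx).
Variables (F : 'cV[R]_n -> Sx -> R).
Variables (Az : Sz -> 'M[R]_(m, n)) (bz : Sz -> 'cV[R]_m).
Variables (X : set 'cV[R]_n) (rho mu My tau eta beta : R).
Hypothesis mF : forall x, measurable_fun setT (F x).
Hypothesis hF : forall s x, differentiable (F ^~ s) x.
Hypotheses (mA : mxmeas Az) (mb : mxmeas bz).
Hypotheses (cX : convex_set X) (X0 : X !=set0) (kX : compact X).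

Definition stmeas d (Om : measurableType d) (s : Om -> state R m n) : Prop :=
  [/\ mxmeas (fun w => (s w).1.1), mxmeas (fun w => (s w).1.2) & mxmeas (fun w => (s w).2)].

Local Notation stp := (step F Az bz X rho mu My tau eta beta).

Lemma stmeas_step d (Om : measurableType d) (s : Om -> state R m n)
    (z0 z1 z2 : Om -> Sz) (xi : Om -> Sx) :
  stmeas s -> measurable_fun setT z0 -> measurable_fun setT xi ->
  measurable_fun setT z1 -> measurable_fun setT z2 ->
  stmeas (fun w => stp (s w) (z0 w) (xi w) (z1 w) (z2 w)).
Proof.
move=> [hx hy hz] h0 hxi h1 h2.
have stE w : stp (s w) (z0 w) (xi w) (z1 w) (z2 w) =
   let y' := dual_step Az bz My eta (s w).1.2 (s w).1.1 (z0 w) in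
   (proj X ((s w).1.1 - tau *: gradK_est F Az bz rho mu (s w).1.1 y' (s w).2 (xi w) (z1 w) (z2 w)),
    y', (s w).2 + beta *: ((s w).1.1 - (s w).2)).
  by case: (s w) => [[]].
have hA (z : Om -> Sz) : measurable_fun setT z -> mxmeas (fun w => Az (z w)).
  by move=> mz i j; exact: measurableT_comp (mA i j) mz.
have hb (z : Om -> Sz) : measurable_fun setT z -> mxmeas (fun w => bz (z w)).
  by move=> mz i j; exact: measurableT_comp (mb i j) mz.
have hyd : mxmeas (fun w => dual_step Az bz My eta (s w).1.2 (s w).1.1 (z0 w)).
  rewrite /dual_step; cbv zeta.
  have hy' : mxmeas (fun w => (s w).1.2 + eta *: (Az (z0 w) *m (s w).1.1 - bz (z0 w))).
    by apply: mxmeasD => //; apply: mxmeasZ; apply: mxmeasB; [apply: mxmeasM => //; exact: hA|exact: hb].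
  apply: mxmeas_if => //.
  have mn : measurable_fun setT (fun w => enorm ((s w).1.2 + eta *: (Az (z0 w) *m (s w).1.1 - bz (z0 w)))).
    apply: (measurable_caratheodory (psi := fun x _ => enorm x) hy') => [x|_].
      exact: measurable_cst.
    apply: continuous_of_bound => x; exists 1 => u; rewrite mul1r.
    by rewrite (le_trans (ler_dist_enorm _ _))// lerDl dotp_ge0.
  apply: (measurable_fun_bool true).
  rewrite (_ : _ @^-1` _ =
    (fun w => enorm ((s w).1.2 + eta *: (Az (z0 w) *m (s w).1.1 - bz (z0 w)))) @^-1` `[My, +oo[%classic).
    exact: mn.
  by apply/seteqP; split=> w /=; rewrite in_itv/= andbT.
split; under eq_fun do rewrite stE /=; last 2 first.
- exact: hyd.
- by apply: mxmeasD => //; apply: mxmeasZ; exact: mxmeasB.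
apply: mxmeas_proj => //; apply: mxmeasB => //; apply: mxmeasZ.
apply: mxmeasD; last by apply: mxmeasZ; exact: mxmeasB.
apply: mxmeasD; last first.
  apply: mxmeasZ; apply: mxmeasM; first by apply: mxmeas_tr; exact: hA.
  by apply: mxmeasB; [apply: mxmeasM => //; exact: hA|exact: hb].
apply: mxmeasD; first exact: mxmeas_grad.
by apply: mxmeasM => //; apply: mxmeas_tr; exact: hA.
Qed.

(* States are recorded as tuples of coordinates, whose product sigma-algebra is the library's. *)
Definition enc (s : state R m n) : n.-tuple R * m.-tuple R * n.-tuple R :=
  (vec_tuple s.1.1, vec_tuple s.1.2, vec_tuple s.2).

Definition dec (p : n.-tuple R * m.-tuple R * n.-tuple R) : state R m n :=
  (tuple_vec p.1.1, tuple_vec p.1.2, tuple_vec p.2).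

Lemma encK s : dec (enc s) = s.
Proof. by case: s => [[x y] z]; rewrite /dec /enc /= !vec_tupleK. Qed.

Lemma measurable_enc d (Om : measurableType d) (s : Om -> state R m n) :
  stmeas s -> measurable_fun setT (fun w => enc (s w)).
Proof.
by move=> [hx hy hz]; apply: measurable_fun_pair; [apply: measurable_fun_pair|]; exact: measurable_vec_tuple.
Qed.

Lemma stmeas_dec d (Om : measurableType d) (p : Om -> n.-tuple R * m.-tuple R * n.-tuple R) :
  measurable_fun setT p -> stmeas (fun w => dec (p w)).
Proof.
move=> hp; have h1 := measurableT_comp measurable_fst hp.
split; apply: mxmeas_tuple_vec.
- exact: measurableT_comp measurable_fst h1.
- exact: measurableT_comp measurable_snd h1.
- exact: measurableT_comp measurable_snd hp.
Qed.

Variables (d : measure_display) (Om : measurableType d) (Pr : probability Om R).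
Variables (Pz : probability Sz R) (Px : probability Sx R).
Variables (zeta zeta1 zeta2 : nat -> {RV Pr >-> Sz}) (xi : nat -> {RV Pr >-> Sx}).
Variables (tstar : {RV Pr >-> nat}) (T : nat).
Hypothesis samp : sampling Pz Px zeta zeta1 zeta2 xi tstar T.
Variables (x0 : 'cV[R]_n) (y0 : 'cV[R]_m).

Definition runw (t : nat) (w : Om) : state R m n :=
  run F Az bz X rho mu My tau eta beta x0 y0 (zeta ^~ w) (xi ^~ w) (zeta1 ^~ w) (zeta2 ^~ w) t.

Lemma stmeas_run t : stmeas (runw t).
Proof.
elim: t => [|t IH]; first by split; exact: mxmeas_cst.
exact: stmeas_step.
Qed.

Let G (i : option (sample_index T)) : set (set Om) :=
  if i is Some j then sample_events zeta zeta1 zeta2 xi j else events_of tstar.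

Let G_measurable i E : G i E -> measurable E.
Proof.
have h d' (S : measurableType d') (Y : {RV Pr >-> S}) : events_of Y E -> measurable E.
  by move=> [B mB <-]; exact: measurable_funPTI.
case: i => [[t c]|]; last exact: h.
by rewrite /G /sample_events; case: (val (t, c).2) => [|[|[|k]]]; exact: h.
Qed.

Let events_pre d' (S : measurableType d') (Y : {RV Pr >-> S}) D : measurable D -> events_of Y (Y @^-1` D).
Proof. by move=> mD; exists D. Qed.

Let G_setT i : G i setT.
Proof.
have h d' (S : measurableType d') (Y : {RV Pr >-> S}) : events_of Y setT.
  by exists setT => //; rewrite preimage_setT.
case: i => [[t c]|]; last exact: h.
by rewrite /G /sample_events; case: (val (t, c).2) => [|[|[|k]]]; exact: h.
Qed.

(** The samples of iteration t and later, together with the random output time, whose index is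
    [None]. *)
Definition future (t : nat) : {set option (sample_index T)} :=
  [set i : option ('I_T * 'I_4) | if i is Some j then (t <= j.1)%N else true]%SET.

(** * Freezing the four samples of one iteration *)

Section OneStep.
Variables (t : nat) (tT : (t < T)%N).

Definition samp_idx (c : 'I_4) : option (sample_index T) := Some (Ordinal tT, c).
Let i0 := samp_idx (@Ordinal 4 0 isT).
Let i1 := samp_idx (@Ordinal 4 1 isT).
Let i2 := samp_idx (@Ordinal 4 2 isT).
Let i3 := samp_idx (@Ordinal 4 3 isT).

Let samp_idx_inj : injective samp_idx. Proof. by move=> c c' []. Qed.
Let in_future c : samp_idx c \in future t. Proof. by rewrite inE /= leqnn. Qed.

Let in0 : i0 \in future t. Proof. exact: in_future. Qed.
Let in1 : i1 \in future t :\ i0.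
Proof. by rewrite in_setD1 in_future (inj_eq samp_idx_inj). Qed.
Let in2 : i2 \in future t :\ i0 :\ i1.
Proof. by rewrite !in_setD1 in_future !(inj_eq samp_idx_inj). Qed.
Let in3 : i3 \in future t :\ i0 :\ i1 :\ i2.
Proof. by rewrite !in_setD1 in_future !(inj_eq samp_idx_inj). Qed.

Let g0 D (mD : measurable D) : G i0 (zeta t @^-1` D) := events_pre (zeta t) mD.
Let g1 D (mD : measurable D) : G i1 (xi t @^-1` D) := events_pre (xi t) mD.
Let g2 D (mD : measurable D) : G i2 (zeta1 t @^-1` D) := events_pre (zeta1 t) mD.
Let g3 D (mD : measurable D) : G i3 (zeta2 t @^-1` D) := events_pre (zeta2 t) mD.

(** The samples of the iteration are attached to the state one at a time, in the order in which they
    are drawn; each attachment removes one index from the set of which the tuple is independent. *)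
Let U0 w := enc (runw t w).
Let U1 w := (U0 w, zeta t w).
Let U2 w := (U1 w, xi t w).
Let U3 w := (U2 w, zeta1 t w).
Let U4 w := (U3 w, zeta2 t w).

Let mU0 : measurable_fun setT U0. Proof. exact: measurable_enc (stmeas_run t). Qed.
Let mU1 : measurable_fun setT U1. Proof. exact: measurable_fun_pair. Qed.
Let mU2 : measurable_fun setT U2. Proof. exact: measurable_fun_pair. Qed.
Let mU3 : measurable_fun setT U3. Proof. exact: measurable_fun_pair. Qed.

Hypothesis ind : indep_of Pr G (future t) U0.

Let ind1 : indep_of Pr G (future t :\ i0) U1.
Proof. exact: (indep_of_pair G_measurable G_setT mU0 _ g0 in0 ind). Qed.
Let ind2 : indep_of Pr G (future t :\ i0 :\ i1) U2.
Proof. exact: (indep_of_pair G_measurable G_setT mU1 _ g1 in1 ind1). Qed.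
Let ind3 : indep_of Pr G (future t :\ i0 :\ i1 :\ i2) U3.
Proof. exact: (indep_of_pair G_measurable G_setT mU2 _ g2 in2 ind2). Qed.
Let ind4 : indep_of Pr G (future t :\ i0 :\ i1 :\ i2 :\ i3) U4.
Proof. exact: (indep_of_pair G_measurable G_setT mU3 _ g3 in3 ind3). Qed.

(** The next state is a measurable function of the present state and its four samples, and none of
    these samples belongs to the next future. *)
Lemma indep_of_run_next : indep_of Pr G (future t.+1) (fun w => enc (runw t.+1 w)).
Proof.
pose estep (q : n.-tuple R * m.-tuple R * n.-tuple R * Sz * Sx * Sz * Sz) :=
  enc (stp (dec q.1.1.1.1) q.1.1.1.2 q.1.1.2 q.1.2 q.2).
have me : measurable_fun setT estep.
  apply: measurable_enc; apply: stmeas_step.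
  - by apply: stmeas_dec; do 4 (apply: measurableT_comp => //).
  - by do 4 (apply: measurableT_comp => //).
  - by do 3 (apply: measurableT_comp => //).
  - by do 2 (apply: measurableT_comp => //).
  - by [].
have -> : (fun w => enc (runw t.+1 w)) = estep \o U4.
  apply/funext => w.
  have -> : (estep \o U4) w = enc (stp (dec (U0 w)) (zeta t w) (xi t w) (zeta1 t w) (zeta2 t w)) by [].
  by rewrite encK.
apply: (indep_of_comp me); apply: (indep_of_subset G_setT) ind4.
apply/fintype.subsetP => -[[s c]|]; rewrite !inE//= => st.
have ne k : (Some (s, c) == samp_idx k) = false.
  by apply/eqP => -[e _]; move: st; rewrite e ltnn.
by rewrite !ne (ltnW st).
Qed.

(** The samples are frozen from the last to the first, so that each partial integral is again a
    measurable function of a shorter tuple. *)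
Lemma integral_next (phi : n.-tuple R * m.-tuple R * n.-tuple R * Sz * Sx * Sz * Sz -> \bar R) :
  measurable_fun setT phi -> (forall q, 0 <= phi q)%E ->
  (\int[Pr]_w phi (U0 w, zeta t w, xi t w, zeta1 t w, zeta2 t w) =
   \int[Pr]_w \int[Pz]_s0 \int[Px]_e \int[Pz]_s1 \int[Pz]_s2 phi (U0 w, s0, e, s1, s2))%E.
Proof.
move=> mphi phi0; have [hl _ _] := samp; have [l0 l1 l2 l3] := hl t tT.
rewrite (indep_of_law G_setT mU3 g3 in3 ind3 l2 mphi phi0).
pose p3 q := (\int[Pz]_s2 phi (q, s2))%E.
have mp3 : measurable_fun setT p3 by exact: (measurable_fun_fubini_tonelli_F phi).
have p30 q : (0 <= p3 q)%E by exact: integral_ge0.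
rewrite -[LHS]/(\int[Pr]_w p3 (U2 w, zeta1 t w))%E.
rewrite (indep_of_law G_setT mU2 g2 in2 ind2 l1 mp3 p30).
pose p2 q := (\int[Pz]_s1 p3 (q, s1))%E.
have mp2 : measurable_fun setT p2 by exact: (measurable_fun_fubini_tonelli_F p3).
have p20 q : (0 <= p2 q)%E by exact: integral_ge0.
rewrite -[LHS]/(\int[Pr]_w p2 (U1 w, xi t w))%E.
rewrite (indep_of_law G_setT mU1 g1 in1 ind1 l3 mp2 p20).
pose p1 q := (\int[Px]_e p2 (q, e))%E.
have mp1 : measurable_fun setT p1 by exact: (measurable_fun_fubini_tonelli_F p2).
have p10 q : (0 <= p1 q)%E by exact: integral_ge0.
rewrite -[LHS]/(\int[Pr]_w p1 (U0 w, zeta t w))%E.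
by rewrite (indep_of_law G_setT mU0 g0 in0 ind l0 mp1 p10).
Qed.

End OneStep.

Lemma indep_of_run t : (t <= T)%N -> indep_of Pr G (future t) (fun w => enc (runw t w)).
Proof.
elim: t => [_|t IH tT]; last by apply: (indep_of_run_next tT); exact: IH (ltnW tT).
have [_ _ mi] := samp.
exact: (indep_of_cst (enc (x0, y0, x0)) mi).
Qed.

Lemma run_in t w : X x0 -> 0 <= beta <= 1 -> X (runw t w).1.1 /\ X (runw t w).2.
Proof.
move=> Xx0 b01; elim: t => [|t [IHx IHz]]; first by [].
rewrite /runw /= -/(runw t w); case: (runw t w) IHx IHz => [[x y] z] /= Xx Xz.
by split; [have [] := proj_spec (x - tau *: gradK_est F Az bz rho mu x
  (dual_step Az bz My eta y x (zeta t w)) z (xi t w) (zeta1 t w) (zeta2 t w)) X0 kX|exact: cX].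
Qed.

(** Quantifying over all measurable spaces allows the same fact to be used along the run and on the
    product space of encoded states and samples. *)
Definition state_measurable (g : state R m n -> R) : Prop :=
  forall d' (Om' : measurableType d') (s : Om' -> state R m n),
    stmeas s -> measurable_fun setT (fun w => g (s w)).

(** The last premise is the inequality conditional on the current state; integrating it over the
    state gives the one for expectations. [Phi] comes with the measurability facts that
    [step_expectation] asks for. Keeping h on the left avoids subtracting possibly infinite
    integrals. *)
Lemma one_step_integral (g h : state R m n -> R) (c : R) t : (t < T)%N -> 0 <= c ->
  state_measurable g -> state_measurable h -> (forall s, 0 <= g s) -> (forall s, 0 <= h s) ->
  (forall w (Phi : Sz -> Sx -> Sz -> Sz -> \bar R),
    (Phi = fun s0 e s1 s2 => (g (stp (runw t w) s0 e s1 s2))%:E) ->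
    (forall s0 e s1, measurable_fun setT (Phi s0 e s1)) ->
    (forall s0 e, measurable_fun setT (fun s1 => \int[Pz]_s2 Phi s0 e s1 s2))%E ->
    (forall s0, measurable_fun setT (fun e => \int[Pz]_s1 \int[Pz]_s2 Phi s0 e s1 s2))%E ->
    measurable_fun setT (fun s0 => \int[Px]_e \int[Pz]_s1 \int[Pz]_s2 Phi s0 e s1 s2)%E ->
    (\int[Pz]_s0 \int[Px]_e \int[Pz]_s1 \int[Pz]_s2 Phi s0 e s1 s2 + (h (runw t w))%:E <=
      (g (runw t w))%:E + c%:E)%E) ->
  (\int[Pr]_w (g (runw t.+1 w))%:E + \int[Pr]_w (h (runw t w))%:E <=
    \int[Pr]_w (g (runw t w))%:E + c%:E)%E.
Proof.
move=> tT c0 mg mh g0 h0 key.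
pose phi (q : n.-tuple R * m.-tuple R * n.-tuple R * Sz * Sx * Sz * Sz) : \bar R :=
  (g (stp (dec q.1.1.1.1) q.1.1.1.2 q.1.1.2 q.1.2 q.2))%:E.
have mphi : measurable_fun setT phi.
  apply/measurable_EFinP; apply: mg; apply: stmeas_step.
  - by apply: stmeas_dec; do 4 (apply: measurableT_comp => //).
  - by do 4 (apply: measurableT_comp => //).
  - by do 3 (apply: measurableT_comp => //).
  - by do 2 (apply: measurableT_comp => //).
  - by [].
have phi0 q : (0 <= phi q)%E by rewrite lee_fin.
pose p3 q := (\int[Pz]_s2 phi (q, s2))%E.
have mp3 : measurable_fun setT p3 by exact: (measurable_fun_fubini_tonelli_F phi).
have p30 q : (0 <= p3 q)%E by exact: integral_ge0.
pose p2 q := (\int[Pz]_s1 p3 (q, s1))%E.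
have mp2 : measurable_fun setT p2 by exact: (measurable_fun_fubini_tonelli_F p3).
have p20 q : (0 <= p2 q)%E by exact: integral_ge0.
pose p1 q := (\int[Px]_e p2 (q, e))%E.
have mp1 : measurable_fun setT p1 by exact: (measurable_fun_fubini_tonelli_F p2).
have p10 q : (0 <= p1 q)%E by exact: integral_ge0.
pose p0 q := (\int[Pz]_s0 p1 (q, s0))%E.
have mp0 : measurable_fun setT p0 by exact: (measurable_fun_fubini_tonelli_F p1).
have p00 q : (0 <= p0 q)%E by exact: integral_ge0.
have msec d1 d2 (S1 : measurableType d1) (S2 : measurableType d2) (p : S1 * S2 -> \bar R) a :
    measurable_fun setT p -> measurable_fun setT (fun s => p (a, s)).
  by move=> mp; apply: (measurableT_comp mp); exact: measurable_fun_pair.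
pose U0 w := enc (runw t w).
have mU0 : measurable_fun setT U0 by exact: measurable_enc (stmeas_run t).
have := integral_next tT (indep_of_run (ltnW tT)) mphi phi0.
have -> : (\int[Pr]_w phi (enc (runw t w), zeta t w, xi t w, zeta1 t w, zeta2 t w) =
    \int[Pr]_w (g (runw t.+1 w))%:E)%E.
  apply: eq_integral => w _.
  rewrite -[LHS]/(g (stp (dec (enc (runw t w))) (zeta t w) (xi t w) (zeta1 t w) (zeta2 t w)))%:E.
  by rewrite encK.
move=> ->; rewrite -[X in (X + _)%E]/(\int[Pr]_w p0 (U0 w))%E.
have mh' : measurable_fun setT (fun w => (h (runw t w))%:E).
  by apply/measurable_EFinP; exact: mh (stmeas_run t).
have mg' : measurable_fun setT (fun w => (g (runw t w))%:E).
  by apply/measurable_EFinP; exact: mg (stmeas_run t).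
have mp0' : measurable_fun setT (fun w => p0 (U0 w)) by exact: measurableT_comp mp0 mU0.
have -> : (c%:E = \int[Pr]_w (cst c%:E w))%E.
  by rewrite integral_cst//= probability_setT mule1.
rewrite -!ge0_integralD//; try (by move=> w _; rewrite lee_fin).
apply: ge0_le_integral => //.
- by move=> w _; rewrite adde_ge0// lee_fin.
- exact: emeasurable_funD.
- exact: emeasurable_funD.
move=> w _; apply: (key w (fun s0 e s1 s2 => phi (U0 w, s0, e, s1, s2))).
- apply/funext => s0; apply/funext => e; apply/funext => s1; apply/funext => s2.
  rewrite -[LHS]/(g (stp (dec (enc (runw t w))) s0 e s1 s2))%:E.
  by rewrite encK.
- by move=> s0 e s1; exact: msec mphi.
- by move=> s0 e; exact: (msec _ _ _ _ p3 (U0 w, s0, e) mp3).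
- by move=> s0; exact: (msec _ _ _ _ p2 (U0 w, s0) mp2).
- exact: (msec _ _ _ _ p1 (U0 w) mp1).
Qed.

(** The state at time k + 1 is independent of tstar, so the integral over the event tstar = k + 1
    factors. These T events exhaust the space up to a null set, which is enough to compare
    integrals. *)
Lemma random_time_integral (g : state R m n -> R) : (0 < T)%N ->
  state_measurable g -> (forall s, 0 <= g s) ->
  (\int[Pr]_w (g (runw (tstar w) w))%:E <=
    \sum_(k < T) (T%:R^-1)%:E * \int[Pr]_w (g (runw k.+1 w))%:E)%E.
Proof.
move=> T0 mg g0.
pose D k := tstar @^-1` [set k].
have mD k : measurable (D k) by exact: measurable_funPTI.
have mgk k : measurable_fun setT (fun w => g (runw k w)) by exact: mg (stmeas_run k).
have [_ lt mi] := samp.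
have mf : measurable_fun setT (fun w => (g (runw (tstar w) w))%:E).
  apply/measurable_EFinP => _ B mB; rewrite setTI.
  have -> : (fun w => g (runw (tstar w) w)) @^-1` B = \bigcup_k (D k `&` (fun w => g (runw k w)) @^-1` B).
    apply/seteqP; split => [w /= Bw|w [k _ [/= <-]]//].
    by exists (tstar w).
  apply: bigcupT_measurable => k; apply: measurableI => //.
  by rewrite -[X in measurable X]setTI; exact: mgk.
have PD (k : 'I_T) : (\int[Pr]_w (g (runw k.+1 w) * \1_(D k.+1) w)%:E =
    (T%:R^-1)%:E * \int[Pr]_w (g (runw k.+1 w))%:E)%E.
  pose phi (q : n.-tuple R * m.-tuple R * n.-tuple R * nat) : \bar R :=
    (g (dec q.1) * \1_[set k.+1] q.2)%:E.
  have mphi : measurable_fun setT phi.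
    apply/measurable_EFinP; apply: measurable_funM.
      by apply: (mg _ _ (fun q : n.-tuple R * m.-tuple R * n.-tuple R * nat => dec q.1)); exact: stmeas_dec.
    by apply: measurableT_comp.
  have phi0 q : (0 <= phi q)%E by rewrite lee_fin mulr_ge0.
  have mU : measurable_fun setT (fun w => enc (runw k.+1 w)) by exact: measurable_enc (stmeas_run k.+1).
  have hT (E : set nat) (mE : measurable E) : G None (tstar @^-1` E) := events_pre tstar mE.
  (* The index of tstar lies in every [future], so each state of the run is independent of it. *)
  have nin : None \in future k.+1 by rewrite inE.
  have hlaw : has_law tstar (distribution Pr tstar) by [].
  have := indep_of_law G_setT mU hT nin (indep_of_run (ltn_ord k)) hlaw mphi phi0.
  have -> : (\int[Pr]_w phi (enc (runw k.+1 w), tstar w) = \int[Pr]_w (g (runw k.+1 w) * \1_(D k.+1) w)%:E)%E.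
    by apply: eq_integral => w _; rewrite /phi /= -[in LHS]/(dec (enc _)) encK.
  move=> ->; rewrite -ge0_integralZl//; last 2 first.
  - exact/measurable_EFinP.
  - by move=> w _; rewrite lee_fin.
  apply: eq_integral => w _.
  have -> : (\int[distribution Pr tstar]_s phi (enc (runw k.+1 w), s) =
      \int[distribution Pr tstar]_s ((g (runw k.+1 w))%:E * (\1_[set k.+1] s)%:E))%E.
    by apply: eq_integral => j _; rewrite /phi -[dec _]/(dec (enc _)) encK EFinM.
  rewrite ge0_integralZl//; last by rewrite lee_fin.
  have hk : (Pr (tstar @^-1` [set k.+1]) = (T%:R^-1)%:E)%E by apply: lt; rewrite /= ltn_ord.
  by rewrite integral_indic// setIT muleC; congr (_ * _)%E; exact: hk.
under eq_bigr do rewrite -PD.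
have mterm (k : 'I_T) : measurable_fun setT (fun w => (g (runw k.+1 w) * \1_(D k.+1) w)%:E).
  by apply/measurable_EFinP; apply: measurable_funM.
rewrite -ge0_integral_sum//; last by move=> k w _; rewrite lee_fin mulr_ge0.
apply: ae_ge0_le_integral => //.
- by move=> w _; rewrite lee_fin.
- by move=> w _; apply: sume_ge0 => k _; rewrite lee_fin mulr_ge0.
- exact: emeasurable_sum.
have mU : measurable (\bigcup_(k in `I_T) D k.+1) by exact: fin_bigcup_measurable.
(* Outside these events the sum vanishes while the left side need not; T events of probability 1 / T
   leave nothing there. *)
exists (~` \bigcup_(k in `I_T) D k.+1); split.
- exact: measurableC.
- transitivity (1 - Pr (\bigcup_(k in `I_T) D k.+1))%E; first exact: probability_setC.
  rewrite measure_fin_bigcup//; last first.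
    move=> i j _ _ [w []]; rewrite /D /= => e1 e2.
    by have := etrans (esym e1) e2; case.
  rewrite -fsbig_ord.
  have -> : (\sum_(k < T) Pr (D k.+1) = \sum_(k < T) (T%:R^-1)%:E)%E.
    by apply: eq_bigr => k _; rewrite lt//= ltn_ord.
  rewrite sumEFin sumr_const card_ord -[_^-1 *+ _]mulr_natl mulfV ?pnatr_eq0 -?lt0n//.
  exact: subee.
- move=> w; apply: contra_not => -[k /= kT]; rewrite /D /= => tk _.
  rewrite (bigD1 (Ordinal kT))//= indicE (_ : (w \in D k.+1) = true); last exact: mem_set.
  rewrite mulr1 tk leeDl//; apply: sume_ge0 => j _.
  by rewrite lee_fin mulr_ge0.
Qed.

End Chain.

(** * Step sizes and the final estimate *)

(** [kap] must not depend on T. Entries of the minima proportional to tau are compared directly; a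
    fixed entry k satisfies k >= (k / t1) tau, where t1 is the value of tau at T = 1. *)
Lemma step_size_bounds (R : realType) (Lf rho nA sbar : R) :
  0 <= Lf -> 0 <= rho -> 0 < nA -> 0 < sbar ->
  exists2 kap : R, 0 < kap & forall T : nat, (0 < T)%N ->
    let tau := tau_par Lf rho nA T in let eta := eta_par Lf rho nA T in
    let beta := beta_par Lf rho nA sbar T in
    [/\ 0 <= eta, eta <= (200 * nA ^+ 2)^-1 * tau, eta * nA ^+ 2 <= tau / 200
      & [/\ kap * tau <= beta, beta <= 1, beta <= tau / 100
          & beta * (36 * mu_par Lf * sbar ^+ 2) <= eta]].
Proof.
move=> Lf0 rho0 nA0 sb0.
have mu2 : 2 <= mu_par Lf by rewrite /mu_par le_max lexx.
have mu0 : 0 < mu_par Lf by apply: lt_le_trans mu2.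
have lam2 : 2 <= lambda_par Lf rho nA.
  rewrite /lambda_par; apply: (le_trans mu2); rewrite lerDr addr_ge0// mulr_ge0 ?sqr_ge0//.
have lam0 : 0 < lambda_par Lf rho nA by apply: lt_le_trans lam2.
pose t1 := 1 / (6 * lambda_par Lf rho nA ^+ 2).
have t10 : 0 < t1 by rewrite divr_gt0// mulr_gt0// exprn_gt0.
pose e1 := (2 * mu_par Lf + rho * nA) / (4 * nA ^+ 4).
have e10 : 0 < e1.
  by rewrite divr_gt0 ?mulr_gt0 ?exprn_gt0// ltr_wpDr ?mulr_gt0// mulr_ge0// ltW.
have nA2 : 0 < 200 * nA ^+ 2 by rewrite mulr_gt0 ?exprn_gt0.
pose e3 := (2 * mu_par Lf + rho * nA ^+ 2) / (20 * nA ^+ 2).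
have e30 : 0 < e3.
  by rewrite divr_gt0 ?mulr_gt0 ?exprn_gt0// ltr_wpDr ?mulr_gt0// mulr_ge0// sqr_ge0.
pose k1 := Num.min (e1 / t1) (Num.min (200 * nA ^+ 2)^-1 e3).
have k10 : 0 < k1 by rewrite !lt_min divr_gt0// invr_gt0 nA2 e30.
have s0 : 0 < 36 * mu_par Lf * sbar ^+ 2 by rewrite !mulr_gt0 ?exprn_gt0.
pose kap := Num.min (100^-1)
  (Num.min ((1 / (50 * lambda_par Lf rho nA)) / t1) (k1 / (36 * mu_par Lf * sbar ^+ 2))).
have b10 : 0 < 1 / (50 * lambda_par Lf rho nA) by rewrite divr_gt0// mulr_gt0.
exists kap; first by rewrite !lt_min; apply/and3P; split; [rewrite invr_gt0|exact: divr_gt0..].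
move=> T T0 tau eta beta.
have T1 : 1 <= Num.sqrt (T%:R : R) by rewrite -[leLHS]sqrtr1 ler_sqrt ?ler0n ?ler1n.
have sT0 : 0 < Num.sqrt (T%:R : R) by apply: lt_le_trans T1.
have tau0 : 0 < tau by rewrite /tau /tau_par divr_gt0// !mulr_gt0// exprn_gt0.
have tau1 : tau <= t1.
  rewrite /tau /tau_par /t1 !div1r lef_pV2 ?posrE ?mulr_gt0 ?exprn_gt0//.
  by rewrite ler_peMr// mulr_ge0 ?sqr_ge0.
have le1 k : 0 < k -> k / t1 * tau <= k.
  by move=> kp; rewrite mulrAC ler_pdivrMr// ler_wpM2l// ltW.
have etaL : k1 * tau <= eta.
  rewrite /eta /eta_par !le_min; apply/andP; split; [|apply/andP; split].
  - apply: le_trans (le1 _ e10); rewrite ler_wpM2r ?(ltW tau0)// /k1; by rewrite !ge_min lexx ?orbT.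
  - rewrite mulrC ler_wpM2l ?(ltW tau0)//; by rewrite !ge_min lexx ?orbT.
  - rewrite -mulrA mulrC ler_wpM2l ?(ltW tau0)//; by rewrite !ge_min lexx ?orbT.
have eta0 : 0 < eta by apply: lt_le_trans etaL; rewrite mulr_gt0.
have etaU : eta <= (200 * nA ^+ 2)^-1 * tau.
  rewrite mulrC /eta /eta_par; by rewrite !ge_min lexx ?orbT.
split=> //; first exact: ltW.
- have := ler_wpM2r (sqr_ge0 nA) etaU.
  have -> : (200 * nA ^+ 2)^-1 * tau * nA ^+ 2 = tau / 200 by field; rewrite gt_eqF.
  by [].
split.
- rewrite /beta /beta_par !le_min; apply/andP; split; [|apply/andP; split].
  - rewrite mulrC ler_wpM2l ?(ltW tau0)//; by rewrite !ge_min lexx ?orbT.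
  - apply: le_trans (le1 _ b10); rewrite ler_wpM2r ?(ltW tau0)//; by rewrite !ge_min lexx ?orbT.
  - rewrite ler_pdivlMr//; apply: le_trans etaL.
    rewrite mulrAC ler_wpM2r ?(ltW tau0)// -ler_pdivlMr//; by rewrite !ge_min lexx ?orbT.
- apply: (@le_trans _ _ (1 / (50 * lambda_par Lf rho nA))).
    by rewrite /beta /beta_par !ge_min lexx ?orbT.
  by rewrite div1r invf_le1 ?mulr_gt0//; lra.
- by rewrite /beta /beta_par !ge_min lexx ?orbT.
- rewrite -ler_pdivlMr// /beta /beta_par; by rewrite !ge_min lexx ?orbT.
Qed.

Lemma telescope_ereal (R : realType) (a h : nat -> \bar R) (c : R) (T : nat) :
  (forall t, (t < T)%N -> (a t.+1 + h t <= a t + c%:E)%E) ->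
  (\sum_(t < T) h t + a T <= a 0%N + (T%:R * c)%:E)%E.
Proof.
elim: T => [_|T IH key]; first by rewrite big_ord0 add0e mul0r adde0.
rewrite big_ord_recr/= -addeA [(h T + _)%E]addeC.
apply: (le_trans (leeD2l _ (key T _))) => //.
rewrite addeA -natr1 mulrDl mul1r EFinD addeA leeD2r// IH// => t tT.
exact: key (ltnW tT).
Qed.

(** With tau = t1 / sT and sT the square root of T, the right side of the summed inequality stays
    bounded while beta is at least of order 1 / sT. The sum is thus O(sT) and the average O(1 /
    sT). *)
Lemma shifted_average_bound (R : realType) (mu kap t1 V0 Cs D sT beta : R) (T : nat) (al : nat -> R) :
  0 < mu -> 0 < kap -> 0 < t1 -> 1 <= sT -> sT ^+ 2 = T%:R -> kap * (t1 / sT) <= beta ->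
  (forall t, 0 <= al t <= D) ->
  mu * beta / 2 * (\sum_(t < T) al t) <= V0 + T%:R * (Cs * (t1 / sT) ^+ 2) ->
  T%:R^-1 * (\sum_(k < T) al k.+1) <= (2 * V0 / (mu * kap * t1) + 2 * Cs * t1 / (mu * kap) + D) / sT.
Proof.
move=> mu0 kap0 t10 sT1 sTT kb alD hle.
have sT0 : 0 < sT by apply: lt_le_trans sT1.
have Tr0 : 0 < (T%:R : R) by rewrite -sTT exprn_gt0.
set s := \sum_(t < T) al t in hle.
have s0 : 0 <= s by apply: sumr_ge0 => t _; have /andP[] := alD t.
(* The decrease is summed over 0, ..., T - 1 but the output time ranges over 1, ..., T; the shift
   adds at most one bounded term. *)
have shift : \sum_(k < T) al k.+1 <= s + D.
  have e1 : \sum_(k < T.+1) al k = al 0%N + \sum_(k < T) al k.+1 by rewrite big_ord_recl.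
  have e2 : \sum_(k < T.+1) al k = s + al T by rewrite big_ord_recr.
  have /andP[a0 _] := alD 0%N; have /andP[_ aT] := alD T; lra.
have hs : s <= (V0 + Cs * t1 ^+ 2) * (2 * sT / (mu * kap * t1)).
  have c0 : 0 < mu * kap * t1 / (2 * sT) by rewrite divr_gt0 ?mulr_gt0.
  have -> : 2 * sT / (mu * kap * t1) = (mu * kap * t1 / (2 * sT))^-1.
    by rewrite invf_div.
  rewrite ler_pdivlMr//; apply: (@le_trans _ _ (mu * beta / 2 * s)).
    rewrite mulrC ler_wpM2r//.
    have -> : mu * kap * t1 / (2 * sT) = mu * (kap * (t1 / sT)) / 2 by field; rewrite gt_eqF.
    by rewrite ler_wpM2r// ler_wpM2l// ltW.
  apply: (le_trans hle); rewrite -sTT lerD2l le_eqVlt; apply/orP; left; apply/eqP.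
  by field; rewrite gt_eqF.
have D0 : 0 <= D by have /andP[a0 aD] := alD 0%N; apply: le_trans aD.
rewrite mulrC ler_pdivrMr//; apply: (le_trans shift).
have -> : (2 * V0 / (mu * kap * t1) + 2 * Cs * t1 / (mu * kap) + D) / sT * T%:R =
    (V0 + Cs * t1 ^+ 2) * (2 * sT / (mu * kap * t1)) + D * sT.
  by rewrite -sTT; field; rewrite !gt_eqF.
by apply: lerD => //; rewrite ler_peMr.
Qed.

Theorem theorem4p3 (R : realType) (m n p : nat) (m_gt0 : (0 < m)%N)
  (dz dx : measure_display) (Sz : measurableType dz) (Sx : measurableType dx)
  (Pz : probability Sz R) (Px : probability Sx R)
  (F : 'cV[R]_n -> Sx -> R) (f : 'cV[R]_n -> R)
  (Az : Sz -> 'M[R]_(m, n)) (bz : Sz -> 'cV[R]_m)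
  (A : 'M[R]_(m, n)) (b : 'cV[R]_m)
  (hA : forall i j, has_mean Pz (fun s => Az s i j) (A i j))
  (hb : forall i, has_mean Pz (fun s => bz s i 0) (b i 0))
  (hA2 : forall i j, (fun s => Az s i j) \in Lfun Pz 2%:E)
  (hb2 : forall i, (fun s => bz s i 0) \in Lfun Pz 2%:E)
  (hf : forall x, has_mean Px (F x) (f x))
  (hF : forall s x, differentiable (F ^~ s) x)
  (hgrad : forall x i, has_mean Px (fun s => grad (F ^~ s) x i 0) (grad f x i 0))
  (sigma : R)
  (hvar : forall x,
    ('E_Px[fun s => (enorm (grad (F ^~ s) x - grad f x) ^+ 2)%R] <= (sigma ^+ 2)%:E)%E)
  (H : 'M[R]_(p, n)) (h : 'cV[R]_p)
  (X : set 'cV[R]_n) (X_def : X = polyhedron H h)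
  (Lf flow : R) (hLf : smooth Lf f)
  (hflow : forall x, X x -> A *m x = b -> flow <= f x)
  (hX : compact X)
  (hri : relint [set A *m x - b | x in X] 0)
  (hrank : row_free A)
  (mu : R) (mu_def : mu = mu_par Lf)
  (rho : R) (hrho : 0 <= rho)
  (sbar : R) (hsbar : 0 < sbar)
  (heb : error_bound f A b X rho mu sbar)
  (MPsi : R)
  (hMPsi : forall z, MPsi <= Psi f A b X mu z)
  (r : R) (hr : 0 < r) (hreach : reach_radius A b X r)
  (My : R)
  (hMy : (MVconst f A b X rho mu - MPsi
          + 2 * Mconst f A b X rho mu) / r < My)
  (x0 : 'cV[R]_n) (hx0 : X x0) (y0 : 'cV[R]_m) :
  (forall z, differentiable (Psi f A b X mu) z) /\
  exists C : R, [/\ 0 < C,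
    forall (eps : R) (T : nat), 0 < eps <= 1 -> C / eps ^+ 4 <= T%:R ->
    forall (d : measure_display) (Om : measurableType d) (Pr : probability Om R)
      (zeta zeta1 zeta2 : nat -> {RV Pr >-> Sz}) (xi : nat -> {RV Pr >-> Sx})
      (tstar : {RV Pr >-> nat}),
    sampling Pz Px zeta zeta1 zeta2 xi tstar T ->
    ('E_Pr[fun w => enorm (grad (Psi f A b X mu)
        (zrun F Az bz X rho mu My
           (tau_par Lf rho (opnorm A) T) (eta_par Lf rho (opnorm A) T)
           (beta_par Lf rho (opnorm A) sbar T) x0 y0
           (zeta ^~ w) (xi ^~ w) (zeta1 ^~ w) (zeta2 ^~ w) (tstar w)))]
      <= eps%:E)%E
  & exists C' : R, forall eps : R, 0 < eps <= 1 ->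
      (oracle_calls `|Num.ceil (C / eps ^+ 4)|%N)%:R <= C' / eps ^+ 4].
Proof.
have cX : convex_set X by rewrite X_def; exact: polyhedron_convex.
have F0 : feasible A b X !=set0.
  have [[x Xx] + _] := hri; move=> /= /eqP; rewrite subr_eq0 => /eqP e.
  by exists x; split.
have X0 : X !=set0 by case: F0 => x [Xx _]; exists x.
have n_gt0 : (0 < n)%N.
  by apply: leq_trans m_gt0 _; move: hrank; rewrite /row_free => /eqP <-; exact: rank_leq_col.
have A0 : A != 0.
  by apply: contraTneq hrank => ->; rewrite /row_free mxrank0 eq_sym -lt0n.
have nA0 : 0 < opnorm A := opnorm_gt0 A0.
(* Full row rank with m > 0 forces n > 0, so there is a nonzero vector on which to test the
   Lipschitz inequality. *)
have Lf0 : 0 <= Lf.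
  pose v : 'cV[R]_n := delta_mx (Ordinal n_gt0) 0.
  have v0 : 0 < enorm v.
    rewrite lt_neqAle enorm_ge0 andbT eq_sym; apply/eqP => /enorm_eq0/matrixP/(_ (Ordinal n_gt0) 0).
    by rewrite !mxE !eqxx => /eqP; rewrite oner_eq0.
  have [_ /(_ v 0)] := hLf; rewrite subr0 => /(le_trans (enorm_ge0 _)).
  by rewrite pmulr_lge0.
have mu2 : 2 <= mu by rewrite mu_def /mu_par le_max lexx.
have mu0 : 0 < mu by apply: lt_le_trans mu2.
have mu4 : 4 * Lf <= mu by rewrite mu_def /mu_par le_max lexx orbT.
have gmu : 3 / 4 * mu <= mu - Lf by lra.
have gam0 : 0 < mu - Lf by apply: lt_le_trans gmu; rewrite mulr_gt0.
pose lam := lambda_par Lf rho (opnorm A).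
have mul : mu <= lam.
  by rewrite /lam /lambda_par mu_def lerDr addr_ge0// mulr_ge0 ?sqr_ge0.
have lam0 : 0 < lam by apply: lt_le_trans mul.
(* Differentiability gives meaning to [grad], whose directional derivatives otherwise take default
   values. *)
split; first by move=> z; have [] := Psi_diff hLf cX hX F0 mu0 gam0 z.
pose ce := (200 * opnorm A ^+ 2)^-1.
have ce0 : 0 <= ce by rewrite invr_ge0 mulr_ge0 ?sqr_ge0.
have [Cs [tau0 [Cs0 tau00 hstep]]] := step_expectation hA hb hA2 hb2 hf hF hgrad hvar hLf cX hX F0 hrho mu2 lam0
  gam0 gmu mul ce0 heb hMPsi hrank hr hreach hMy.
have [kap kap0 hkap] := step_size_bounds Lf0 hrho nA0 hsbar.
have [D2 [D3 [Gf [Dx [hD2 _ _ _]]]]] := compact_bounds A b hLf hX.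
have D20 : 0 <= D2 by have := hD2 _ _ hx0 hx0; rewrite subrr dotp0l.
pose V0 := Vfun f A b X rho mu lam x0 y0 x0 - MPsi.
have V00 : 0 <= V0.
  by rewrite subr_ge0; apply: le_trans (hMPsi x0) (Psi_le_Vfun rho mu hLf hX F0 lam0 x0 y0 x0).
pose t1 := 1 / (6 * lam ^+ 2).
have t10 : 0 < t1 by rewrite divr_gt0// mulr_gt0// exprn_gt0.
pose C4 := 2 * V0 / (mu * kap * t1) + 2 * Cs * t1 / (mu * kap) + D2.
have C40 : 0 <= C4.
  have m0 := ltW mu0; have k0 := ltW kap0; have t0 := ltW t10; rewrite /C4; nonneg.
(* T >= S^2 / eps^4 means sqrt T >= S / eps^2. The first summand gives the accuracy eps, the second
   gives tau <= tau0 (using eps <= 1), and the last makes S positive. *)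
pose S := mu ^+ 2 * C4 + t1 / tau0 + 1.
have S0 : 0 < S.
  have t0 := ltW t10; have u0 := ltW tau00; rewrite /S ltr_wpDl//; nonneg.
exists (S ^+ 2); split; first exact: exprn_gt0.
  move=> eps T /andP[eps0 eps1] hT d Om Pr zeta zeta1 zeta2 xi tstar samp.
  set tau := tau_par Lf rho (opnorm A) T; set eta := eta_par _ _ _ _; set beta := beta_par _ _ _ _ _.
  have T0 : (0 < T)%N.
    rewrite lt0n; apply/eqP => T0; move: hT; rewrite T0 leNgt => /negP; apply.
    by rewrite divr_gt0 ?exprn_gt0.
  have Tr0 : 0 < (T%:R : R) by rewrite ltr0n.
  have [] := hkap T T0; rewrite -/tau -/eta -/beta -mu_def -/ce => eta0 etac etaA [kb b1 bt bs].
  pose sT := Num.sqrt (T%:R : R).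
  have sT0 : 0 < sT by rewrite sqrtr_gt0.
  have sTT : sT ^+ 2 = T%:R by rewrite sqr_sqrtr// ltW.
  have tauE : tau = t1 / sT by rewrite /tau /tau_par -/lam -/sT /t1; field; rewrite !gt_eqF.
  have hS : S / eps ^+ 2 <= sT.
    rewrite -(@ler_pXn2r _ 2)// ?nnegrE ?divr_ge0 ?sqr_ge0 ?(ltW S0) ?(ltW sT0)//.
    by rewrite sTT expr_div_n -exprM.
  have S1 : S <= S / eps ^+ 2.
    by rewrite ler_pdivlMr ?exprn_gt0// ler_piMr ?(ltW S0)// exprn_ile1// ltW.
  have tau_gt0 : 0 < tau by rewrite tauE divr_gt0.
  have tau_le : tau <= tau0.
    rewrite tauE ler_pdivrMr// -ler_pdivrMl// mulrC.
    apply: le_trans hS; apply: le_trans S1; rewrite /S.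
    have := mulr_ge0 (sqr_ge0 mu) C40; move: (mu ^+ 2 * C4) (t1 / tau0) => ? ?; lra.
  have beta0 : 0 < beta by apply: lt_le_trans kb; rewrite mulr_gt0.
  have hp : step_params A mu ce sbar tau eta beta.
    by split; split => //; exact: ltW.
  have mF x : measurable_fun setT (F x).
    by have [/measurable_int/measurable_EFinP] := hf x.
  have mA : mxmeas Az by move=> i j; have [/measurable_int/measurable_EFinP] := hA i j.
  have mb : mxmeas bz by move=> i j; rewrite (ord1 j); have [/measurable_int/measurable_EFinP] := hb i.
  pose rw := runw F Az bz X rho mu My tau eta beta zeta zeta1 zeta2 xi x0 y0.
  have Xrun t w : X (rw t w).1.1 /\ X (rw t w).2.
    by apply: run_in => //; rewrite (ltW beta0).
  pose q (s : state R m n) := dotp (s.2 - xbar f A b X mu s.2) (s.2 - xbar f A b X mu s.2).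
  have mq : state_measurable q.
    move=> d' Om' s [_ _ hz]; apply: measurable_dotp; apply: mxmeasB => //.
      exact: (xbar_measurable hLf cX hX F0 mu0 gam0 hz).
    exact: (xbar_measurable hLf cX hX F0 mu0 gam0 hz).
  have q0 s : 0 <= q s by exact: dotp_ge0.
  have qD t w : q (rw t w) <= D2.
    by apply: hD2; [have [] := Xrun t w|exact: (xbar_X mu hLf hX F0)].
  pose a t := (\int[Pr]_w (q (rw t w))%:E)%E.
  have mqr t : measurable_fun setT (fun w => (q (rw t w))%:E).
    by apply/measurable_EFinP; apply: mq; exact: stmeas_run.
  have a0 t : (0 <= a t)%E by apply: integral_ge0 => w _; rewrite lee_fin.
  have aD t : (a t <= D2%:E)%E.
    apply: (@le_trans _ _ (\int[Pr]_w (cst D2%:E w))%E).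
      by apply: ge0_le_integral => //= w _; rewrite lee_fin.
    by rewrite integral_cst//= probability_setT mule1.
  (* The squared distances are bounded by D2, so from here on the averages can be computed in the
     reals. *)
  have afin t : a t \is a fin_num by rewrite ge0_fin_numE//; exact: le_lt_trans (aD t) (ltry _).
  have aE t : a t = (fine (a t))%:E by rewrite fineK.
  pose g (s : state R m n) := Vstate f A b X rho mu lam s - MPsi.
  have g0 s : 0 <= g s.
    rewrite subr_ge0; apply: (le_trans (hMPsi s.2)).
    exact: (Psi_le_Vfun rho mu hLf hX F0 lam0).
  have mg : state_measurable g.
    move=> d' Om' s [hx hy hz]; apply: measurable_funB; last exact: measurable_cst.
    exact: (Vfun_measurable hLf cX hX F0 hrho mu0 lam0 gam0 hx hy hz).
  pose hh s := mu * beta / 2 * q s.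
  have mb0 : 0 <= mu * beta / 2 by rewrite divr_ge0// mulr_ge0 ?ltW.
  have mh : state_measurable hh.
    by move=> d' Om' s hs; apply: measurable_funM; [exact: measurable_cst|exact: mq].
  have h0 s : 0 <= hh s by rewrite mulr_ge0.
  have Ct0 : 0 <= Cs * tau ^+ 2 by rewrite mulr_ge0 ?sqr_ge0.
  have tele : (\sum_(t < T) \int[Pr]_w (hh (rw t w))%:E + \int[Pr]_w (g (rw T w))%:E <=
      \int[Pr]_w (g (rw 0%N w))%:E + (T%:R * (Cs * tau ^+ 2))%:E)%E.
    apply: (@telescope_ereal _ (fun t => \int[Pr]_w (g (rw t w))%:E)%E
      (fun t => \int[Pr]_w (hh (rw t w))%:E)%E) => t tT.
    apply: (one_step_integral mF hF mA mb cX X0 hX samp tT Ct0 mg mh g0 h0) => w Phi PhiE m1 m2 m3 m4.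
    have [Xx Xz] := Xrun t w; rewrite -/(rw t w) in PhiE *.
    have := hstep tau eta beta hp tau_le (rw t w).1.1 (rw t w).1.2 (rw t w).2 Phi Xx Xz _ m1 m2 m3 m4 _.
    have Phi0 s0 e s1 s2 : (0 <= Phi s0 e s1 s2)%E by rewrite PhiE lee_fin.
    have PhiL s0 e s1 s2 : (Phi s0 e s1 s2 <= (Vstate f A b X rho mu lam
       (step F Az bz X rho mu My tau eta beta ((rw t w).1.1, (rw t w).1.2, (rw t w).2) s0 e s1 s2) - MPsi)%:E)%E.
      by rewrite PhiE lee_fin /g; case: (rw t w) => [[]].
    move=> /(_ Phi0 PhiL) hle; apply: (le_trans (leeD2r _ hle)).
    rewrite -!EFinD lee_fin /g /hh /q /Vstate.
    by move: (Vfun _ _ _ _ _ _ _ _ _ _) (dotp _ _) => ? ?; lra.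
  have alD t : 0 <= fine (a t) <= D2 by rewrite -!lee_fin -aE a0 aD.
  have hle : mu * beta / 2 * (\sum_(t < T) fine (a t)) <= V0 + T%:R * (Cs * (t1 / sT) ^+ 2).
    rewrite -tauE -lee_fin.
    have hhE t : (\int[Pr]_w (hh (rw t w))%:E = (mu * beta / 2 * fine (a t))%:E)%E.
      by rewrite EFinM -aE -ge0_integralZl// => w _; rewrite lee_fin.
    have i0 : (\int[Pr]_w (g (rw 0%N w))%:E = V0%:E)%E.
      rewrite -[LHS]/(\int[Pr]_w cst V0%:E w)%E.
      by rewrite integral_cst//= probability_setT mule1.
    rewrite EFinD -i0.
    apply: le_trans tele; apply: (@le_trans _ _ (\sum_(t < T) \int[Pr]_w (hh (rw t w))%:E)%E).
      by rewrite mulr_sumr -sumEFin; apply: lee_sum => t _; rewrite hhE.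
    by apply: leeDl; apply: integral_ge0 => w _; rewrite lee_fin.
  have sT1 : 1 <= sT by rewrite -[leLHS]sqrtr1 ler_sqrt ?ler0n ?ler1n.
  rewrite tauE in kb.
  have := shifted_average_bound mu0 kap0 t10 sT1 sTT kb alD hle; rewrite -/C4 => havg.
  have mE : state_measurable (fun s => eps / 2 + mu ^+ 2 / (2 * eps) * q s).
    by move=> d' Om' s hs; apply: measurable_funD => //; apply: measurable_funM => //; exact: mq.
  pose c2 := mu ^+ 2 / (2 * eps).
  have c20 : 0 <= c2 by rewrite divr_ge0 ?sqr_ge0// mulr_ge0// ltW.
  have gradE z : enorm (grad (Psi f A b X mu) z) = mu * enorm (z - xbar f A b X mu z).
    by have [_ ->] := Psi_diff hLf cX hX F0 mu0 gam0 z; rewrite enormZ gtr0_norm.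
  have mg' : state_measurable (fun s : state R m n => enorm (grad (Psi f A b X mu) s.2)).
    move=> d' Om' s hs; under eq_fun do rewrite gradE.
    apply: measurable_funM => //; rewrite /enorm.
    by apply: measurableT_comp; [apply: continuous_measurable_fun; exact: sqrt_continuous|exact: mq].
  rewrite unlock.
  apply: (le_trans (random_time_integral rho mu My tau eta beta mF hF mA mb cX X0 hX samp x0 y0
    T0 mg' (fun s => enorm_ge0 _))).
  have key k : (\int[Pr]_w (enorm (grad (Psi f A b X mu) (rw k w).2))%:E <= (eps / 2 + c2 * fine (a k))%:E)%E.
    apply: (@le_trans _ _ (\int[Pr]_w ((eps / 2)%:E + c2%:E * (q (rw k w))%:E))%E).
      apply: ge0_le_integral => //.
      - by move=> w _; rewrite lee_fin enorm_ge0.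
      - by apply/measurable_EFinP; apply: (mg' _ _ (rw k)); exact: stmeas_run.
      - by apply/measurable_EFinP; apply: (mE _ _ (rw k)); exact: stmeas_run.
      move=> w _; rewrite -EFinM -EFinD lee_fin gradE /q -enorm_sqr.
      move: (enorm _) => v; rewrite -subr_ge0.
      have -> : eps / 2 + c2 * v ^+ 2 - mu * v = (eps - mu * v) ^+ 2 / (2 * eps).
        by rewrite /c2; field; rewrite gt_eqF.
      by rewrite divr_ge0 ?sqr_ge0// mulr_ge0// ltW.
    rewrite ge0_integralD//; first last.
    - by apply: measurable_funeM.
    - by move=> w _; rewrite mule_ge0 ?lee_fin.
    - by move=> w _; rewrite lee_fin divr_ge0// ltW.
    rewrite ge0_integralZl//; last by move=> w _; rewrite lee_fin.
    rewrite -/(a k) aE (_ : (fun _ => (eps / 2)%:E) = cst (eps / 2)%:E)//.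
    by rewrite integral_cst//= probability_setT mule1.
  apply: (@le_trans _ _ (\sum_(k < T) (T%:R^-1 * (eps / 2 + c2 * fine (a k.+1)))%:E)%E).
    by apply: lee_sum => k _; rewrite EFinM lee_wpmul2l ?lee_fin ?invr_ge0.
  rewrite sumEFin lee_fin -mulr_sumr big_split/= sumr_const card_ord -mulr_sumr mulrDr.
  rewrite -[eps / 2 *+ T]mulr_natl mulKf ?gt_eqF// mulrCA.
  have hC : c2 * (C4 / sT) <= eps / 2.
    have hS' : mu ^+ 2 * C4 <= eps ^+ 2 * sT.
      move: hS; rewrite ler_pdivrMr ?exprn_gt0// [sT * _]mulrC; apply: le_trans.
      by rewrite /S -addrA lerDl addr_ge0// divr_ge0// ltW.
    have -> : c2 * (C4 / sT) = mu ^+ 2 * C4 / (2 * eps * sT).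
      by rewrite /c2; field; rewrite !gt_eqF.
    rewrite ler_pdivrMr ?mulr_gt0//; apply: (le_trans hS').
    by rewrite le_eqVlt; apply/orP; left; apply/eqP; field.
  by rewrite [leRHS](splitr eps) lerD2l; apply: le_trans hC; exact: ler_wpM2l.
(* Each iteration draws four samples; rounding T up adds at most 1, which is at most 1 / eps^4. *)
exists (4 * (S ^+ 2 + 1)) => eps /andP[eps0 eps1].
rewrite /oracle_calls /sample_index card_prod !card_ord natrM mulrC.
have e40 : 0 < eps ^+ 4 by rewrite exprn_gt0.
have q0 : 0 <= S ^+ 2 / eps ^+ 4 by rewrite divr_ge0 ?sqr_ge0// ltW.
rewrite -mulrA ler_wpM2l// mulrDl.
have : (Num.ceil (S ^+ 2 / eps ^+ 4))%:~R <= S ^+ 2 / eps ^+ 4 + 1.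
  have /andP[+ _] := ceil_itv (S ^+ 2 / eps ^+ 4).
  by move/ltW; rewrite intrB lerBlDr.
have c0 : 0 <= Num.ceil (S ^+ 2 / eps ^+ 4) by rewrite -(ler_int R); apply: le_trans (ceil_ge _).
rewrite natr_absz ger0_norm// => hc; apply: (le_trans hc); rewrite lerD2l.
by rewrite div1r invf_ge1// exprn_ile1// ltW.
Qed.
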